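(* Let $k$ be a commutative unital ring. Let $\varphi$ be a special homotopy $\varphi:\overline{(P\times Q)_*}\to\overline{(P\times Q)_{*+1}}$, natural in the cyclic $k$-modules $P,Q$: that is, $\varphi$ is $k$-linear and natural and satisfies $$\overline{sh}\,\overline{AW}=1+b\varphi+\varphi b,\qquad \varphi\,\overline{sh}=0,\qquad \overline{AW}\,\varphi=0,\qquad \varphi^2=0 .$$ Put $$\varphi_\infty=\sum_{m\ge 0}(\varphi B)^m\varphi,\qquad \overline{sh}_\infty=(1+\varphi_\infty B)\,\overline{sh},\qquad \overline{AW}_\infty=\overline{AW}\,(1+B\varphi_\infty).$$ Then $\overline{sh}_\infty$ (with components $\overline{sh}_m=(\varphi B)^m\overline{sh}$) is a coextension of $\overline{sh}$, $\overline{AW}_\infty$ (with components $\overline{AW}_m=\overline{AW}(B\varphi)^m$) is a coextension of $\overline{AW}$, and for all cyclic $k$-modules $P,Q$ the chain maps they define between the negative cyclic complexes $C^-_*(\overline{P_*}\otimes\overline{Q_*})$ and $C^-_*(\overline{(P\times Q)_*})$ are inverse to each other up to chain homotopy.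
   Context: Cyclic $k$-modules: simplicial $k$-modules $P$ with operators $t_n:P_n\to P_n$ such that $t_n^{n+1}=1$, $d_it_n=t_{n-1}d_{i-1}$ and $s_it_n=t_{n+1}s_{i-1}$ for $1\le i\le n$, $d_0t_n=d_n$, $s_0t_n=t_{n+1}^2s_n$. $P_*$ is the associated complex, with $b=\sum_{i=0}^n(-1)^id_i:P_n\to P_{n-1}$, and with Connes' operator $B:P_n\to P_{n+1}$, $B=(1-(-1)^{n+1}t_{n+1})\,t_{n+1}s_n\sum_{i=0}^n(-1)^{ni}t_n^i$. The normalized complex is $\overline{P}_n=P_n/\sum_i s_iP_{n-1}$; $b$ and $B$ induce operators on it, still denoted $b,B$, with $b^2=B^2=0$, $bB=-Bb$. $P\times Q$ is the cyclic module $(P\times Q)_n=P_n\otimes_k Q_n$ with diagonal structure. On $\overline{P_*}\otimes\overline{Q_*}$ (total degree), $b(x\otimes y)=bx\otimes y+(-1)^px\otimes by$ and $B(x\otimes y)=Bx\otimes y+(-1)^px\otimes By$ for $x$ of degree $p$. The shuffle $sh:P_*\otimes Q_*\to(P\times Q)_*$ is $sh(x\otimes y)=\sum\varepsilon(\mu,\nu)\,(s_{\nu_q}\cdots s_{\nu_1}x)\otimes(s_{\mu_p}\cdots s_{\mu_1}y)$ for $x\in P_p$, $y\in Q_q$, summed over the $(p,q)$-shuffles, i.e. partitions $\{\mu_1<\dots<\mu_p\}\sqcup\{\nu_1<\dots<\nu_q\}=\{0,\dots,p+q-1\}$, with $\varepsilon(\mu,\nu)$ the signature of $(\mu_1,\dots,\mu_p,\nu_1,\dots,\nu_q)$.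 The Alexander–Whitney map $AW:(P\times Q)_*\to P_*\otimes Q_*$ is $AW(x\otimes y)=\sum_{i=0}^n (d_{i+1}\cdots d_n x)\otimes (d_0)^i y$ for $x\in P_n,y\in Q_n$. Both commute with $b$ and pass to the normalized complexes, giving $\overline{sh},\overline{AW}$, with $\overline{AW}\,\overline{sh}=1$. For non-negatively graded $P_*$ with differentials $b$ (degree $-1$) and $B$ (degree $+1$), $bB=-Bb$: $C^-_d(P_* )=\prod_{i\ge0}P_{d+2i}$ with differential $b+B$. A coextension of a morphism of $b$-complexes $f:P_*\to Q_*$ is a sequence $f_\infty=(f_m)_{m\ge0}$, $f_0=f$, $f_m:P_*\to Q_{*+2m}$, such that $[b,f_m]+[B,f_{m-1}]=0$ for all $m\geq 0$ (with $f_{-1}=0$; $[b,f]=bf-fb$, $[B,f]=Bf-fB$); it defines the chain map $\sum_m f_m:C^-_*(P_* )\to C^-_*(Q_* )$. *)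

(* Defs.v *)
(* Mathematical Components, with the classical axioms of MathComp-Analysis
   (every type is a choiceType). *)
From HB Require Import structures.
From mathcomp Require Import all_boot all_order perm all_algebra.
From mathcomp Require Import boolp classical_sets.

Set Implicit Arguments.
Unset Strict Implicit.
Unset Printing Implicit Defensive.

Import GRing.Theory.
Local Open Scope ring_scope.
Local Open Scope quotient_scope.

Definition dprodm (k : pzRingType) (I : Type) (M : I -> lmodType k) : Type :=
  forall i, M i.

Section DepProd.
Context {k : pzRingType} {I : Type} {M : I -> lmodType k}.
Implicit Types x y z : dprodm M.

HB.instance Definition _ := gen_eqMixin (dprodm M).
HB.instance Definition _ := gen_choiceMixin (dprodm M).

Let add x y : dprodm M := fun i => x i + y i.
Let opp x : dprodm M := fun i => - x i.
Let zero : dprodm M := fun=> 0.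

Fact dprodm_addA : associative add.
Proof. by move=> x y z; apply: functional_extensionality_dep => i; exact: addrA. Qed.
Fact dprodm_addC : commutative add.
Proof. by move=> x y; apply: functional_extensionality_dep => i; exact: addrC. Qed.
Fact dprodm_add0 : left_id zero add.
Proof. by move=> x; apply: functional_extensionality_dep => i; exact: add0r. Qed.
Fact dprodm_addN : left_inverse zero opp add.
Proof. by move=> x; apply: functional_extensionality_dep => i; exact: addNr. Qed.

HB.instance Definition _ := GRing.isZmodule.Build (dprodm M)
  dprodm_addA dprodm_addC dprodm_add0 dprodm_addN.

Let scale (a : k) x : dprodm M := fun i => a *: x i.

Fact dprodm_scaleA a b x : scale a (scale b x) = scale (a * b) x.
Proof. by apply: functional_extensionality_dep => i; exact: scalerA. Qed.
Fact dprodm_scale1 : left_id 1 scale.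
Proof. by move=> x; apply: functional_extensionality_dep => i; exact: scale1r. Qed.
Fact dprodm_scaleDr : right_distributive scale +%R.
Proof. by move=> a x y; apply: functional_extensionality_dep => i; exact: scalerDr. Qed.
Fact dprodm_scaleDl x : {morph scale^~ x : a b / a + b}.
Proof. by move=> a b; apply: functional_extensionality_dep => i; exact: scalerDl. Qed.

HB.instance Definition _ := GRing.Zmodule_isLmodule.Build k (dprodm M)
  dprodm_scaleA dprodm_scale1 dprodm_scaleDr dprodm_scaleDl.
End DepProd.

Inductive span (k : pzRingType) (V : lmodType k) (G : set V) : V -> Prop :=
| span_gen x : G x -> span G x
| span_0 : span G 0
| span_lin a x y : span G x -> span G y -> span G (a *: x + y).

Section QuotRel.
Context {k : pzRingType} {V : lmodType k} (G : set V).

Lemma spanD x y : span G x -> span G y -> span G (x + y).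
Proof. by move=> hx hy; rewrite -[x]scale1r; exact: span_lin. Qed.
Lemma spanZ a x : span G x -> span G (a *: x).
Proof. by move=> hx; rewrite -[_ *: _]addr0; apply: span_lin => //; exact: span_0. Qed.
Lemma spanN x : span G x -> span G (- x).
Proof. by rewrite -scaleN1r; exact: spanZ. Qed.

Definition quotm_rel : rel V := fun x y => `[< span G (x - y) >].

Fact quotm_refl : reflexive quotm_rel.
Proof. by move=> x; apply/asboolP; rewrite subrr; exact: span_0. Qed.
Fact quotm_sym : symmetric quotm_rel.
Proof.
by move=> x y; apply/asboolP/asboolP => /spanN; rewrite opprB.
Qed.
Fact quotm_trans : transitive quotm_rel.
Proof.
move=> y x z /asboolP hxy /asboolP hyz; apply/asboolP.
by rewrite -(subrK y x) -addrA; exact: spanD.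
Qed.
Canonical quotm_equiv := EquivRel quotm_rel quotm_refl quotm_sym quotm_trans.
End QuotRel.

Definition quotm (k : pzRingType) (V : lmodType k) (G : set V) : Type :=
  {eq_quot (quotm_equiv G)}.
HB.instance Definition _ (k : pzRingType) (V : lmodType k) (G : set V) :=
  Choice.on (quotm G).

Definition qpi (k : pzRingType) (V : lmodType k) (G : set V) (x : V) : quotm G :=
  \pi_({eq_quot (quotm_equiv G)}) x.
Definition qrepr (k : pzRingType) (V : lmodType k) (G : set V) (x : quotm G) : V :=
  repr (x : {eq_quot (quotm_equiv G)}).

Section Quot.
Context {k : pzRingType} {V : lmodType k} {G : set V}.
Implicit Types x y z : quotm G.

Lemma qreprK : cancel (@qrepr k V G) (qpi G).
Proof. by move=> x; exact: reprK. Qed.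

Lemma qpiP (u v : V) : qpi G u = qpi G v <-> span G (u - v).
Proof.
split=> [|h]; first by move/eqmodP/asboolP.
by apply/eqmodP/asboolP.
Qed.

Lemma qreprP (u : V) : span G (qrepr (qpi G u) - u).
Proof. by apply/qpiP; exact: qreprK. Qed.

Let add x y : quotm G := qpi G (qrepr x + qrepr y).
Let opp x : quotm G := qpi G (- qrepr x).
Let zero : quotm G := qpi G 0.
Let scale (a : k) x : quotm G := qpi G (a *: qrepr x).

Let addE u v : add (qpi G u) (qpi G v) = qpi G (u + v).
Proof.
by apply/qpiP; rewrite opprD addrACA; apply: spanD; exact: qreprP.
Qed.
Let oppE u : opp (qpi G u) = qpi G (- u).
Proof. by apply/qpiP; rewrite -opprD; apply: spanN; exact: qreprP. Qed.
Let scaleE a u : scale a (qpi G u) = qpi G (a *: u).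
Proof. by apply/qpiP; rewrite -scalerBr; apply: spanZ; exact: qreprP. Qed.

Fact quotm_addA : associative add.
Proof.
move=> x y z; rewrite -(qreprK x) -(qreprK y) -(qreprK z).
by rewrite !addE addrA.
Qed.
Fact quotm_addC : commutative add.
Proof. by move=> x y; rewrite -(qreprK x) -(qreprK y) !addE addrC. Qed.
Fact quotm_add0 : left_id zero add.
Proof. by move=> x; rewrite -(qreprK x) addE add0r. Qed.
Fact quotm_addN : left_inverse zero opp add.
Proof. by move=> x; rewrite -(qreprK x) oppE addE addNr. Qed.

HB.instance Definition _ := GRing.isZmodule.Build (quotm G)
  quotm_addA quotm_addC quotm_add0 quotm_addN.

Fact quotm_scaleA a b x : scale a (scale b x) = scale (a * b) x.
Proof. by rewrite -(qreprK x) !scaleE scalerA. Qed.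
Fact quotm_scale1 : left_id 1 scale.
Proof. by move=> x; rewrite -(qreprK x) scaleE scale1r. Qed.
Fact quotm_scaleDr : right_distributive scale +%R.
Proof.
move=> a x y; rewrite -(qreprK x) -(qreprK y).
by rewrite [_ + _]addE !scaleE [RHS]addE scalerDr.
Qed.
Fact quotm_scaleDl x : {morph scale^~ x : a b / a + b}.
Proof. by move=> a b; rewrite -(qreprK x) !scaleE [RHS]addE scalerDl. Qed.

HB.instance Definition _ := GRing.Zmodule_isLmodule.Build k (quotm G)
  quotm_scaleA quotm_scale1 quotm_scaleDr quotm_scaleDl.

Fact qpi_is_linear : linear (qpi G).
Proof.
move=> a u v.
by rewrite [_ *: qpi G u]scaleE [RHS]addE.
Qed.
HB.instance Definition _ := GRing.isLinear.Build k V (quotm G) _ (qpi G) qpi_is_linear.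
End Quot.

(* [qmap f] is the map induced by [f] on quotients: it is evaluated on a
   representative, and [qmapE] shows that, for a linear [f] that maps the
   generators of the first submodule into the second one, the choice of the
   representative is immaterial. *)
Definition qmap (k : pzRingType) (V W : lmodType k) (G : set V) (H : set W)
  (f : V -> W) (x : quotm G) : quotm H := qpi H (f (qrepr x)).
Arguments qmap {k V W G H} f x.

Lemma qmapE (k : pzRingType) (V W : lmodType k) (G : set V) (H : set W)
    (f : {linear V -> W}) (hf : forall x, G x -> span H (f x)) (x : V) :
  qmap (H := H) f (qpi G x) = qpi H (f x).
Proof.
apply/qpiP; rewrite -linearB; elim: (qreprP (G := G) x) => [y /hf //||a y z _ hy _ hz].
  by rewrite linear0; exact: span_0.
by rewrite linearP; exact: span_lin.
Qed.

(* Formal sums of pairs, modulo the congruence generated by biadditivity and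
   [a u (x) v = u (x) a v]. *)
Inductive tens_cong (k : comPzRingType) (U V : lmodType k) :
  seq (U * V) -> seq (U * V) -> Prop :=
| tens_refl s : tens_cong s s
| tens_sym s s' : tens_cong s s' -> tens_cong s' s
| tens_trans s s' s'' : tens_cong s s' -> tens_cong s' s'' -> tens_cong s s''
| tens_cat s1 s2 s1' s2' : tens_cong s1 s1' -> tens_cong s2 s2' ->
    tens_cong (s1 ++ s2) (s1' ++ s2')
| tens_catC s s' : tens_cong (s ++ s') (s' ++ s)
| tens_0l v : tens_cong [:: (0, v)] [::]
| tens_Dl u u' v : tens_cong [:: (u + u', v)] [:: (u, v); (u', v)]
| tens_Dr u v v' : tens_cong [:: (u, v + v')] [:: (u, v); (u, v')]
| tens_Zlr a u v : tens_cong [:: (a *: u, v)] [:: (u, a *: v)].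

Section TensRel.
Context {k : comPzRingType} (U V : lmodType k).
Definition tens_rel : rel (seq (U * V)) := fun s s' => `[< tens_cong s s' >].
Fact tens_rel_refl : reflexive tens_rel.
Proof. by move=> s; apply/asboolP; exact: tens_refl. Qed.
Fact tens_rel_sym : symmetric tens_rel.
Proof. by move=> s s'; apply/asboolP/asboolP; exact: tens_sym. Qed.
Fact tens_rel_trans : transitive tens_rel.
Proof.
move=> s' s s'' /asboolP h1 /asboolP h2.
by apply/asboolP; exact: tens_trans h1 h2.
Qed.
Canonical tens_equiv := EquivRel tens_rel tens_rel_refl tens_rel_sym tens_rel_trans.
End TensRel.

Definition tens (k : comPzRingType) (U V : lmodType k) : Type :=
  {eq_quot (tens_equiv U V)}.
HB.instance Definition _ (k : comPzRingType) (U V : lmodType k) :=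
  Choice.on (tens U V).

Section Tens.
Context {k : comPzRingType} {U V : lmodType k}.
Implicit Types (x y z : tens U V) (s : seq (U * V)).

Definition tpi s : tens U V := \pi_({eq_quot (tens_equiv U V)}) s.
Definition trepr x : seq (U * V) := repr (x : {eq_quot (tens_equiv U V)}).

Lemma treprK : cancel trepr tpi.
Proof. by move=> x; exact: reprK. Qed.
Lemma tpiP s s' : tpi s = tpi s' <-> tens_cong s s'.
Proof.
split=> [|h]; first by move/eqmodP/asboolP.
by apply/eqmodP/asboolP.
Qed.
Lemma treprP s : tens_cong (trepr (tpi s)) s.
Proof. by apply/tpiP; exact: treprK. Qed.

Definition pure (u : U) (v : V) : tens U V := tpi [:: (u, v)].

Let mapl (a : k) s := [seq (a *: w.1, w.2) | w <- s].

Let mapl_cong a s s' : tens_cong s s' -> tens_cong (mapl a s) (mapl a s').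
Proof.
rewrite /mapl.
elim=> {s s'} [s|s s' _ h|s s' s'' _ h1 _ h2|s1 s2 s1' s2' _ h1 _ h2|s s'|v|u u' v
  |u v v'|b u v] /=.
- exact: tens_refl.
- exact: tens_sym.
- exact: tens_trans h1 h2.
- by rewrite !map_cat; exact: tens_cat.
- by rewrite !map_cat; exact: tens_catC.
- by rewrite scaler0; exact: tens_0l.
- by rewrite scalerDr; exact: tens_Dl.
- exact: tens_Dr.
- by rewrite scalerA mulrC -scalerA; exact: tens_Zlr.
Qed.

Let add x y : tens U V := tpi (trepr x ++ trepr y).
Let opp x : tens U V := tpi (mapl (-1) (trepr x)).
Let zero : tens U V := tpi [::].
Let scale (a : k) x : tens U V := tpi (mapl a (trepr x)).

Let addE s s' : add (tpi s) (tpi s') = tpi (s ++ s').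
Proof. by apply/tpiP; apply: tens_cat; exact: treprP. Qed.
Let scaleE a s : scale a (tpi s) = tpi (mapl a s).
Proof. by apply/tpiP; apply: mapl_cong; exact: treprP. Qed.

Fact tens_addA : associative add.
Proof.
move=> x y z; rewrite -(treprK x) -(treprK y) -(treprK z).
by rewrite !addE catA.
Qed.
Fact tens_addC : commutative add.
Proof.
move=> x y; rewrite -(treprK x) -(treprK y) !addE.
by apply/tpiP; exact: tens_catC.
Qed.
Fact tens_add0 : left_id zero add.
Proof. by move=> x; rewrite -(treprK x) addE. Qed.
Let cons_tpi w s : tpi (w :: s) = add (tpi [:: w]) (tpi s).
Proof. by rewrite addE. Qed.

Fact tens_addN : left_inverse zero opp add.
Proof.
move=> x; rewrite -(treprK x) /opp -/(scale _ _) scaleE addE.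
elim: (trepr x) => [//|[u v] s ih] /=.
rewrite -ih; apply/tpiP.
apply: (@tens_trans _ _ _ _ (([:: (- 1 *: u, v)] ++ [:: (u, v)]) ++ (mapl (-1) s ++ s))).
  rewrite -[X in tens_cong X _]/([:: (- 1 *: u, v)] ++ (mapl (-1) s ++ ([:: (u, v)] ++ s))).
  rewrite -catA; apply: tens_cat; first exact: tens_refl.
  by rewrite !catA; apply: tens_cat; [exact: tens_catC|exact: tens_refl].
rewrite -[X in tens_cong _ X]cat0s; apply: tens_cat; last exact: tens_refl.
apply: (@tens_trans _ _ _ _ [:: (- 1 *: u + u, v)]); first exact/tens_sym/tens_Dl.
by rewrite scaleN1r addNr; exact: tens_0l.
Qed.

HB.instance Definition _ := GRing.isZmodule.Build (tens U V)
  tens_addA tens_addC tens_add0 tens_addN.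

Fact tens_scaleA a b x : scale a (scale b x) = scale (a * b) x.
Proof.
rewrite -(treprK x) !scaleE /mapl -map_comp; congr tpi.
by apply: eq_map => w /=; rewrite scalerA.
Qed.
Fact tens_scale1 : left_id 1 scale.
Proof.
move=> x; rewrite -[in RHS](treprK x); congr tpi.
by rewrite -[RHS]map_id; apply: eq_map => -[u v] /=; rewrite scale1r.
Qed.
Fact tens_scaleDr : right_distributive scale +%R.
Proof.
move=> a x y; rewrite -(treprK x) -(treprK y) [_ + _]addE !scaleE [RHS]addE.
by rewrite /mapl map_cat.
Qed.
Fact tens_scaleDl x : {morph scale^~ x : a b / a + b}.
Proof.
move=> a b /=; rewrite -(treprK x) !scaleE [RHS]addE.
elim: (trepr x) => [//|[u v] s ih] /=.
rewrite cons_tpi ih addE; apply/tpiP.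
apply: (@tens_trans _ _ _ _ (([:: (a *: u, v)] ++ [:: (b *: u, v)])
  ++ (mapl a s ++ mapl b s))).
  apply: tens_cat; last exact: tens_refl.
  by rewrite scalerDl; exact: tens_Dl.
rewrite -[X in tens_cong _ X]/([:: (a *: u, v)] ++
  (mapl a s ++ ([:: (b *: u, v)] ++ mapl b s))) -catA.
apply: tens_cat; first exact: tens_refl.
by rewrite !catA; apply: tens_cat; [exact: tens_catC|exact: tens_refl].
Qed.

HB.instance Definition _ := GRing.Zmodule_isLmodule.Build k (tens U V)
  tens_scaleA tens_scale1 tens_scaleDr tens_scaleDl.

Lemma pure_linearl v : linear (pure^~ v).
Proof.
move=> a u u'; rewrite [_ *: pure u v]scaleE [RHS]addE /=.
by apply/tpiP; exact: tens_Dl.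
Qed.
Lemma pureZr a u v : pure u (a *: v) = a *: pure u v.
Proof. by rewrite [RHS]scaleE; apply/tpiP/tens_sym; exact: tens_Zlr. Qed.
Lemma pure_linearr u : linear (pure u).
Proof.
move=> a v v'; rewrite -pureZr [RHS]addE /=.
by apply/tpiP; exact: tens_Dr.
Qed.

Lemma tpi_sum s : tpi s = \sum_(w <- s) pure w.1 w.2.
Proof.
elim: s => [|[u v] s ih]; first by rewrite big_nil.
by rewrite big_cons -ih cons_tpi.
Qed.

Lemma tens_ind (A : tens U V -> Prop) :
  A 0 -> (forall x y, A x -> A y -> A (x + y)) ->
  (forall u v, A (pure u v)) -> forall x, A x.
Proof.
move=> A0 AD Ap x; rewrite -(treprK x) tpi_sum.
by elim: (trepr x) => [|w s ih]; rewrite ?big_nil // big_cons; apply: AD.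
Qed.

(* The map out of the tensor product induced by a bilinear map; [tlift_pure]
   and [tlift_is_linear] are its characteristic properties. *)
Definition tlift (W : lmodType k) (f : U -> V -> W) (x : tens U V) : W :=
  \sum_(w <- trepr x) f w.1 w.2.

Section Lift.
Context {W : lmodType k} {f : U -> V -> W}.
Hypotheses (fl : forall v, linear (f^~ v)) (fr : forall u, linear (f u)).

Lemma tlift_tpi s : tlift f (tpi s) = \sum_(w <- s) f w.1 w.2.
Proof.
have D1 v u u' : f (u + u') v = f u v + f u' v.
  by have := fl v 1 u u'; rewrite /= !scale1r.
have D2 u v v' : f u (v + v') = f u v + f u v'.
  by have := fr u 1 v v'; rewrite !scale1r.
have f0l v : f 0 v = 0 by apply: (addrI (f 0 v)); rewrite -D1 !addr0.
have f0r u : f u 0 = 0 by apply: (addrI (f u 0)); rewrite -D2 !addr0.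
suff cong s1 s2 : tens_cong s1 s2 ->
    \sum_(w <- s1) f w.1 w.2 = \sum_(w <- s2) f w.1 w.2 by exact: cong (treprP s).
elim=> {s s1 s2} [//|s s' _ -> //|s s' s'' _ -> _ -> //|s1 s2 s1' s2' _ h1 _ h2|s s'|v|u u' v|u v v'|a u v].
- by rewrite !big_cat h1 h2.
- by rewrite !big_cat /= addrC.
- by rewrite big_seq1 big_nil f0l.
- by rewrite big_seq1 big_cons big_seq1 D1.
- by rewrite big_seq1 big_cons big_seq1 D2.
- rewrite !big_seq1 /=.
  have := fl v a u 0; rewrite /= f0l !addr0 => ->.
  by have := fr u a v 0; rewrite f0r !addr0 => ->.
Qed.

Lemma tlift_pure u v : tlift f (pure u v) = f u v.
Proof. by rewrite tlift_tpi big_seq1. Qed.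

Lemma tlift_is_linear : linear (tlift f).
Proof.
move=> a x y; rewrite -(treprK x) -(treprK y) [_ *: _]scaleE [_ + _]addE.
rewrite !tlift_tpi big_cat big_map scaler_sumr /=; congr (_ + _).
apply: eq_bigr => -[u v] _ /=.
have f0l : f 0 v = 0.
  by apply: (addrI (f 0 v)); have := fl v 1 0 0; rewrite /= !scale1r !addr0 => <-.
by have := fl v a u 0; rewrite /= f0l !addr0.
Qed.
End Lift.
End Tens.

Definition tmap (k : comPzRingType) (U U' V V' : lmodType k)
    (f : U -> U') (g : V -> V') : tens U V -> tens U' V' :=
  tlift (fun u v => pure (f u) (g v)).

Section TensMap.
Context {k : comPzRingType} {U U' V V' : lmodType k}.
Context (f : {linear U -> U'}) (g : {linear V -> V'}).

Let tmapl v : linear (fun u => pure (f u) (g v)).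
Proof. by move=> a u u'; rewrite linearP pure_linearl. Qed.
Let tmapr u : linear (fun v => pure (f u) (g v)).
Proof. by move=> a v v'; rewrite linearP pure_linearr. Qed.

Lemma tmap_pure u v : tmap f g (pure u v) = pure (f u) (g v).
Proof. exact: tlift_pure tmapl tmapr u v. Qed.

Fact tmap_is_linear : linear (tmap f g).
Proof. exact: tlift_is_linear tmapl tmapr. Qed.
HB.instance Definition _ := GRing.isLinear.Build k (tens U V) (tens U' V') _
  (tmap f g) tmap_is_linear.
End TensMap.

(* The operators are indexed by all natural numbers, but only the faces
   [face n i : P_(n+1) -> P_n] with [i <= n + 1] and the degeneracies
   [degen n i : P_n -> P_(n+1)] with [i <= n] are constrained or used. *)
Record cyclicModule (k : comPzRingType) := CyclicModule {
  cmod :> nat -> lmodType k;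
  face : forall n : nat, nat -> {linear cmod n.+1 -> cmod n};
  degen : forall n : nat, nat -> {linear cmod n -> cmod n.+1};
  cyc : forall n : nat, {linear cmod n -> cmod n};
  face_face : forall n i j x, (i < j)%N -> (j <= n.+2)%N ->
    face n i (face n.+1 j x) = face n j.-1 (face n.+1 i x);
  degen_degen : forall n i j x, (i <= j)%N -> (j <= n)%N ->
    degen n.+1 i (degen n j x) = degen n.+1 j.+1 (degen n i x);
  face_degen_lt : forall n i j x, (i < j)%N -> (j <= n.+1)%N ->
    face n.+1 i (degen n.+1 j x) = degen n j.-1 (face n i x);
  face_degen_eq : forall n j x, (j <= n)%N -> face n j (degen n j x) = x;
  face_degen_succ : forall n j x, (j <= n)%N -> face n j.+1 (degen n j x) = x;
  face_degen_gt : forall n i j x, (j.+1 < i)%N -> (i <= n.+2)%N ->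
    face n.+1 i (degen n.+1 j x) = degen n j (face n i.-1 x);
  cyc_order : forall n x, iter n.+1 (cyc n) x = x;
  face_cyc : forall n i x, (0 < i)%N -> (i <= n.+1)%N ->
    face n i (cyc n.+1 x) = cyc n (face n i.-1 x);
  face0_cyc : forall n x, face n 0 (cyc n.+1 x) = face n n.+1 x;
  degen_cyc : forall n i x, (0 < i)%N -> (i <= n)%N ->
    degen n i (cyc n x) = cyc n.+1 (degen n i.-1 x);
  degen0_cyc : forall n x,
    degen n 0 (cyc n x) = cyc n.+1 (cyc n.+1 (degen n n x))
}.

Record cyclicHom (k : comPzRingType) (P Q : cyclicModule k) := CyclicHom {
  chom :> forall n, {linear P n -> Q n};
  chom_face : forall n i x, (i <= n.+1)%N ->
    chom n (face P n i x) = face Q n i (chom n.+1 x);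
  chom_degen : forall n i x, (i <= n)%N ->
    chom n.+1 (degen P n i x) = degen Q n i (chom n x);
  chom_cyc : forall n x, chom n (cyc P n x) = cyc Q n (chom n x)
}.

Section CyclicProduct.
Context {k : comPzRingType} (P Q : cyclicModule k).

Let car n : lmodType k := tens (P n) (Q n).
Let pface n i : {linear car n.+1 -> car n} := tmap (face P n i) (face Q n i).
Let pdegen n i : {linear car n -> car n.+1} := tmap (degen P n i) (degen Q n i).
Let pcyc n : {linear car n -> car n} := tmap (cyc P n) (cyc Q n).

Let lin_ext (V : lmodType k) n (f g : {linear car n -> V}) :
  (forall u v, f (pure u v) = g (pure u v)) -> f =1 g.
Proof.
by move=> h; apply: tens_ind => [|x y hx hy|//]; rewrite ?linear0 // !linearD hx hy.
Qed.

Fact cprod_face_face n i j x : (i < j)%N -> (j <= n.+2)%N ->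
  pface n i (pface n.+1 j x) = pface n j.-1 (pface n.+1 i x).
Proof.
move=> h h'; apply: (lin_ext (f := pface n i \o pface n.+1 j)
  (g := pface n j.-1 \o pface n.+1 i)) => u v.
by rewrite /= !tmap_pure !(@face_face _ _ _ i j).
Qed.
Fact cprod_degen_degen n i j x : (i <= j)%N -> (j <= n)%N ->
  pdegen n.+1 i (pdegen n j x) = pdegen n.+1 j.+1 (pdegen n i x).
Proof.
move=> h h'; apply: (lin_ext (f := pdegen n.+1 i \o pdegen n j)
  (g := pdegen n.+1 j.+1 \o pdegen n i)) => u v.
by rewrite /= !tmap_pure !(@degen_degen _ _ _ i j).
Qed.
Fact cprod_face_degen_lt n i j x : (i < j)%N -> (j <= n.+1)%N ->
  pface n.+1 i (pdegen n.+1 j x) = pdegen n j.-1 (pface n i x).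
Proof.
move=> h h'; apply: (lin_ext (f := pface n.+1 i \o pdegen n.+1 j)
  (g := pdegen n j.-1 \o pface n i)) => u v.
by rewrite /= !tmap_pure !(@face_degen_lt _ _ _ i j).
Qed.
Fact cprod_face_degen_eq n j x : (j <= n)%N -> pface n j (pdegen n j x) = x.
Proof.
move=> h; apply: (lin_ext (f := pface n j \o pdegen n j) (g := idfun)) => u v.
by rewrite /= !tmap_pure !face_degen_eq.
Qed.
Fact cprod_face_degen_succ n j x : (j <= n)%N -> pface n j.+1 (pdegen n j x) = x.
Proof.
move=> h; apply: (lin_ext (f := pface n j.+1 \o pdegen n j) (g := idfun)) => u v.
by rewrite /= !tmap_pure !face_degen_succ.
Qed.
Fact cprod_face_degen_gt n i j x : (j.+1 < i)%N -> (i <= n.+2)%N ->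
  pface n.+1 i (pdegen n.+1 j x) = pdegen n j (pface n i.-1 x).
Proof.
move=> h h'; apply: (lin_ext (f := pface n.+1 i \o pdegen n.+1 j)
  (g := pdegen n j \o pface n i.-1)) => u v.
by rewrite /= !tmap_pure !(@face_degen_gt _ _ _ i j).
Qed.
Fact cprod_cyc_order n x : iter n.+1 (pcyc n) x = x.
Proof.
move: x; apply: tens_ind => [|x y hx hy|u v].
- by elim: n.+1 => [//|m /= ->]; rewrite linear0.
- rewrite -[in RHS]hx -[in RHS]hy; elim: n.+1 => [//|m /= ->].
  by rewrite linearD.
- rewrite -[in RHS](cyc_order u) -[in RHS](cyc_order v).
  by elim: n.+1 => [//|m /= ->]; rewrite /pcyc tmap_pure.
Qed.
Fact cprod_face_cyc n i x : (0 < i)%N -> (i <= n.+1)%N ->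
  pface n i (pcyc n.+1 x) = pcyc n (pface n i.-1 x).
Proof.
move=> h h'; apply: (lin_ext (f := pface n i \o pcyc n.+1)
  (g := pcyc n \o pface n i.-1)) => u v.
by rewrite /= !tmap_pure !face_cyc.
Qed.
Fact cprod_face0_cyc n x : pface n 0 (pcyc n.+1 x) = pface n n.+1 x.
Proof.
apply: (lin_ext (f := pface n 0 \o pcyc n.+1) (g := pface n n.+1)) => u v.
by rewrite /= !tmap_pure !face0_cyc.
Qed.
Fact cprod_degen_cyc n i x : (0 < i)%N -> (i <= n)%N ->
  pdegen n i (pcyc n x) = pcyc n.+1 (pdegen n i.-1 x).
Proof.
move=> h h'; apply: (lin_ext (f := pdegen n i \o pcyc n)
  (g := pcyc n.+1 \o pdegen n i.-1)) => u v.
by rewrite /= !tmap_pure !degen_cyc.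
Qed.
Fact cprod_degen0_cyc n x :
  pdegen n 0 (pcyc n x) = pcyc n.+1 (pcyc n.+1 (pdegen n n x)).
Proof.
apply: (lin_ext (f := pdegen n 0 \o pcyc n)
  (g := pcyc n.+1 \o (pcyc n.+1 \o pdegen n n))) => u v.
by rewrite /= !tmap_pure !degen0_cyc.
Qed.

Definition cprod : cyclicModule k := CyclicModule
  cprod_face_face cprod_degen_degen cprod_face_degen_lt cprod_face_degen_eq
  cprod_face_degen_succ cprod_face_degen_gt cprod_cyc_order cprod_face_cyc
  cprod_face0_cyc cprod_degen_cyc cprod_degen0_cyc.
End CyclicProduct.

(* The identities [b^2 = B^2 = 0] and [b B = - B b], which hold in all the
   cases considered below, play no role in the definitions. *)
Record mixedModule (k : comPzRingType) := MixedModule {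
  mcar :> nat -> lmodType k;
  mb : forall n, mcar n.+1 -> mcar n;
  mB : forall n, mcar n -> mcar n.+1
}.

Definition bdry (k : comPzRingType) (M : mixedModule k) (n : nat) : M n -> M n.-1 :=
  match n return M n -> M n.-1 with
  | 0%N => fun=> 0
  | m.+1 => fun x => mb x
  end.

(* The component in degree [j] of a homogeneous element [x] of degree [i],
   that is, [x] if [i = j] and [0] otherwise. It replaces transports along
   equalities of degrees. *)
Definition hcomp (k : pzRingType) (I : eqType) (M : I -> lmodType k) (i j : I)
    (x : M i) : M j :=
  match i =P j with
  | ReflectT e => ecast l (M l) e x
  | ReflectF _ => 0
  end.
Arguments hcomp {k I} M {i} j x.

Section Normalized.
Context {k : comPzRingType} (P : cyclicModule k).

Definition degenerate (n : nat) : set (P n) :=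
  match n return set (P n) with
  | 0%N => fun=> False
  | m.+1 => fun x => exists i : nat, (i <= m)%N /\ exists y, x = degen P m i y
  end.

Definition hochschild n (x : P n.+1) : P n :=
  \sum_(i < n.+2) (-1) ^+ i *: face P n i x.

Definition connes n (x : P n) : P n.+1 :=
  let y := cyc P n.+1 (degen P n n
             (\sum_(i < n.+1) (-1) ^+ (n * i) *: iter i (cyc P n) x)) in
  y - (-1) ^+ n.+1 *: cyc P n.+1 y.

Definition normalized : mixedModule k :=
  MixedModule (mcar := fun n => quotm (@degenerate n))
    (fun n => qmap (@hochschild n)) (fun n => qmap (@connes n)).
End Normalized.

Section Tot.
Context {k : comPzRingType}.

Definition bigr (M N : nat -> lmodType k) (pq : nat * nat) : lmodType k :=
  tens (M pq.1) (N pq.2).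

(* [(M (x) N)_n], the sum over [p <= n] of the [M_p (x) N_(n-p)]. *)
Definition tot (M N : nat -> lmodType k) (n : nat) : lmodType k :=
  dprodm (fun p : 'I_n.+1 => bigr M N (p : nat, n - p)%N).

(* The inclusion of [M_p (x) N_q] in degree [n = p + q]; it is zero if
   [p + q] is not [n]. *)
Definition tinj (M N : nat -> lmodType k) (n p q : nat)
    (w : tens (M p) (N q)) : tot M N n :=
  fun i => hcomp (bigr M N) (i := (p, q)) (i : nat, n - i)%N w.
Arguments tinj {M N} n {p q} w.

Definition tot_b (M N : mixedModule k) n (z : tot M N n.+1) : tot M N n :=
  \sum_(p < n.+2)
    (tinj n (tmap (@bdry k M p) id (z p))
     + (-1) ^+ p *: tinj n (tmap id (@bdry k N (n.+1 - p)) (z p))).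

Definition tot_B (M N : mixedModule k) n (z : tot M N n) : tot M N n.+1 :=
  \sum_(p < n.+1)
    (tinj n.+1 (tmap (@mB k M p) id (z p))
     + (-1) ^+ p *: tinj n.+1 (tmap id (@mB k N (n - p)) (z p))).

Definition tensMixed (M N : mixedModule k) : mixedModule k :=
  MixedModule (mcar := tot M N) (@tot_b M N) (@tot_B M N).
End Tot.

(* A (p,q)-shuffle is encoded by the permutation
   [(mu_1, ..., mu_p, nu_1, ..., nu_q)] of [{0, ..., p+q-1}]. *)
Definition is_shuffle (p q : nat) (s : 'S_(p + q)) : bool :=
  [forall i : 'I_p, forall j : 'I_p,
     (i < j)%N ==> (s (lshift q i) < s (lshift q j))%N]
  && [forall i : 'I_q, forall j : 'I_q,
     (i < j)%N ==> (s (rshift p i) < s (rshift p j))%N].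

Definition shuffle_mu (p q : nat) (s : 'S_(p + q)) : nat -> nat :=
  nth 0%N [seq (s (lshift q i) : nat) | i <- enum 'I_p].
Definition shuffle_nu (p q : nat) (s : 'S_(p + q)) : nat -> nat :=
  nth 0%N [seq (s (rshift p j) : nat) | j <- enum 'I_q].

Section EilenbergZilber.
Context {k : comPzRingType}.

(* [s_(a (r-1)) ... s_(a 1) s_(a 0) x] *)
Fixpoint degens (P : cyclicModule k) (a : nat -> nat) (r n : nat) (x : P n) :
    P (r + n)%N :=
  match r return P (r + n)%N with
  | 0%N => x
  | r'.+1 => degen P (r' + n) (a r') (degens a r' x)
  end.

(* [d_(n+1) ... d_(n+r) x] *)
Fixpoint front (P : cyclicModule k) (r n : nat) : P (r + n)%N -> P n :=
  match r return P (r + n)%N -> P n with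
  | 0%N => id
  | r'.+1 => fun x => front (face P (r' + n) (r' + n).+1 x)
  end.

(* [(d_0)^r x] *)
Fixpoint back (P : cyclicModule k) (r n : nat) : P (r + n)%N -> P n :=
  match r return P (r + n)%N -> P n with
  | 0%N => id
  | r'.+1 => fun x => back (face P (r' + n) 0 x)
  end.

Context (P Q : cyclicModule k).

Definition shuffle (p q : nat) (x : P p) (y : Q q) : cprod P Q (p + q)%N :=
  \sum_(s : 'S_(p + q) | is_shuffle s)
    (-1) ^+ s *: pure (hcomp P (p + q)%N (degens (shuffle_nu s) q x))
                      (degens (shuffle_mu s) p y).

Definition AW n (w : cprod P Q n) : tot P Q n :=
  fun i => tmap (fun x => front (hcomp P (n - i + i)%N x))
                (fun y => back (hcomp Q (i + (n - i))%N y)) w.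

(* The maps induced on the normalized complexes, evaluated on
   representatives. *)
Definition nsh n (z : tensMixed (normalized P) (normalized Q) n) :
    normalized (cprod P Q) n :=
  \sum_(p < n.+1)
    hcomp (normalized (cprod P Q)) n
      (tlift (fun (x : normalized P p) (y : normalized Q (n - p)%N) =>
                qpi (@degenerate k (cprod P Q) (p + (n - p))%N)
                    (shuffle (qrepr x) (qrepr y)))
             (z p)).

Definition nAW n (w : normalized (cprod P Q) n) :
    tensMixed (normalized P) (normalized Q) n :=
  fun i => tmap (qpi (@degenerate k P i)) (qpi (@degenerate k Q (n - i)%N))
                (AW (qrepr w) i).
End EilenbergZilber.

Definition nhom (k : comPzRingType) (P P' : cyclicModule k) (f : forall n, P n -> P' n)
  n : normalized P n -> normalized P' n := qmap (f n).

Record special_homotopy (k : comPzRingType)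
  (phi : forall (P Q : cyclicModule k) (n : nat),
     normalized (cprod P Q) n -> normalized (cprod P Q) n.+1) : Prop := {
  special_linear : forall P Q n, linear (phi P Q n);
  special_natural : forall (P P' Q Q' : cyclicModule k)
    (f : cyclicHom P P') (g : cyclicHom Q Q') n x,
    phi P' Q' n
      (nhom (P := cprod P Q) (P' := cprod P' Q') (fun n => tmap (f n) (g n)) x)
    = nhom (P := cprod P Q) (P' := cprod P' Q') (fun n => tmap (f n) (g n))
        (phi P Q n x);
  special_sh_AW : forall P Q n (x : normalized (cprod P Q) n),
    nsh (nAW x)
    = x + mb (phi P Q n x) + hcomp (normalized (cprod P Q)) n (phi P Q n.-1 (bdry x));
  special_phi_sh : forall P Q n (z : tensMixed (normalized P) (normalized Q) n),
    phi P Q n (nsh z) = 0;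
  special_AW_phi : forall P Q n (x : normalized (cprod P Q) n),
    nAW (phi P Q n x) = 0;
  special_phi_phi : forall P Q n (x : normalized (cprod P Q) n),
    phi P Q n.+1 (phi P Q n x) = 0
}.

Section Perturbation.
Context {k : comPzRingType}.

Section Powers.
Context (M : mixedModule k) (phi : forall n, M n -> M n.+1).

(* [(phi B)^m] *)
Fixpoint phiB_pow (m n : nat) (x : M n) : M (m.*2 + n)%N :=
  match m return M (m.*2 + n)%N with
  | 0%N => x
  | m'.+1 => phi (mB (phiB_pow m' x))
  end.

(* [(B phi)^m] *)
Fixpoint Bphi_pow (m n : nat) (x : M n) : M (m.*2 + n)%N :=
  match m return M (m.*2 + n)%N with
  | 0%N => x
  | m'.+1 => mB (phi (Bphi_pow m' x))
  end.

(* The component [(phi B)^m phi], of degree [2m+1], of [phi_oo]. *)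
Definition phi_inf (m n : nat) (x : M n) : M (m.*2 + n.+1)%N := phiB_pow m (phi x).
End Powers.

Context (P Q : cyclicModule k).
Context (phi : forall n, normalized (cprod P Q) n -> normalized (cprod P Q) n.+1).

(* The component of degree [2m] of [(1 + phi_oo B) sh]. *)
Definition sh_inf (m n : nat) (z : tensMixed (normalized P) (normalized Q) n) :
    normalized (cprod P Q) (m.*2 + n)%N :=
  match m return normalized (cprod P Q) (m.*2 + n)%N with
  | 0%N => nsh z
  | m'.+1 => hcomp (normalized (cprod P Q)) (m'.+1.*2 + n)%N
               (phi_inf phi m' (mB (nsh z)))
  end.

(* The component of degree [2m] of [AW (1 + B phi_oo)]. *)
Definition AW_inf (m n : nat) (w : normalized (cprod P Q) n) :
    tensMixed (normalized P) (normalized Q) (m.*2 + n)%N :=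
  match m return tensMixed (normalized P) (normalized Q) (m.*2 + n)%N with
  | 0%N => nAW w
  | m'.+1 => nAW (hcomp (normalized (cprod P Q)) (m'.+1.*2 + n)%N
                    (mB (phi_inf phi m' w)))
  end.
End Perturbation.
Arguments sh_inf {k P Q} phi m {n} z.
Arguments AW_inf {k P Q} phi m {n} w.
Arguments phiB_pow {k M} phi m {n} x.
Arguments Bphi_pow {k M} phi m {n} x.

Section NegativeCyclic.
Context {k : comPzRingType}.
Implicit Types M N : mixedModule k.

(* In degree [0] the commutator [[b, f_0]] takes values in [N_(-1) = 0]. *)
Definition coextension M N (f : forall n, M n -> N n)
    (F : forall m n, M n -> N (m.*2 + n)%N) : Prop :=
  [/\ forall m n, linear (F m n),
      forall n (x : M n), F 0%N n x = f n x,
      forall n (x : M n.+1), mb (F 0%N n.+1 x : N n.+1) - F 0%N n (mb x) = 0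
    & forall m n (x : M n),
        (mb (F m.+1 n x : N (m.*2 + n).+2)
         - hcomp N (m.*2 + n).+1 (F m.+1 n.-1 (bdry x)))
        + (mB (F m n x) - hcomp N (m.*2 + n).+1 (F m n.+1 (mB x))) = 0].

(* Extension by zero of a graded module to the negative degrees. *)
Definition extz M (d : int) : lmodType k :=
  match d with Posz n => M n | Negz _ => 'rV[k]_0 end.

(* An operator [M_n -> N_(r n)] extended by zero to the negative degrees, and
   followed by the projection on degree [e]. *)
Definition zmap M N (r : nat -> nat) (F : forall n, M n -> N (r n)) (d e : int) :
    extz M d -> extz N e :=
  match d return extz M d -> extz N e with
  | Posz n => fun x => hcomp (extz N) (i := Posz (r n)) e (F n x)
  | Negz _ => fun=> 0
  end.

(* [C^-_d(M)] is the product over [i >= 0] of the [M_(d+2i)]. *)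
Definition cneg M (d : int) : lmodType k :=
  dprodm (fun i : nat => extz M (d + i.*2%:Z)).

(* [b + B : C^-_(d+1) -> C^-_d] *)
Definition cneg_d M (d : int) (z : cneg M (d + 1)) : cneg M d :=
  fun i => zmap (@bdry k M) (d + i.*2%:Z) (z i)
           + (if i is j.+1 then zmap (@mB k M) (d + i.*2%:Z) (z j) else 0).

(* The map [\sum_m F_m] between the negative cyclic complexes. *)
Definition cneg_map M N (F : forall m n, M n -> N (m.*2 + n)%N) (d : int)
    (z : cneg M d) : cneg N d :=
  fun i => \sum_(m < i.+1) zmap (@F m) (d + i.*2%:Z) (z (i - m)%N).

Definition chain_map M N (f : forall d, cneg M d -> cneg N d) : Prop :=
  (forall d, linear (f d))
  /\ forall d (z : cneg M (d + 1)), f d (cneg_d z) = cneg_d (f (d + 1) z).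

Definition chain_homotopic M N (f g : forall d, cneg M d -> cneg N d) : Prop :=
  exists h : forall d, cneg M d -> cneg N (d + 1),
    (forall d, linear (h d))
    /\ forall d (z : cneg M (d + 1)),
         f (d + 1) z - g (d + 1) z = cneg_d (h (d + 1) z) + h d (cneg_d z).

Definition inverse_up_to_homotopy M N (f : forall d, cneg M d -> cneg N d)
    (g : forall d, cneg N d -> cneg M d) : Prop :=
  chain_homotopic (fun d z => g d (f d z)) (fun d z => z)
  /\ chain_homotopic (fun d z => f d (g d z)) (fun d z => z).
End NegativeCyclic.

(* Main.v *)
Require Import Defs.
From HB Require Import structures.
From mathcomp Require Import all_boot all_order perm all_algebra.
From mathcomp Require Import boolp classical_sets.
From mathcomp Require Import zify.

Set Implicit Arguments.
Unset Strict Implicit.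
Unset Printing Implicit Defensive.
Import GRing.Theory.
Local Open Scope ring_scope.

(** Let [C] be the normalized complex of the product and [A] the tensor product
    of the normalized complexes. The theorem is an instance of the homological
    perturbation lemma: [sh] and [AW] with the special homotopy [phi] retract [C]
    onto [A], and [B] is a perturbation of the differential [b] of [C]. The
    series [Phi = phi + phi B phi + ...] satisfies [Phi = phi + phi B Phi] and
    [Phi = phi + Phi B phi]. From these two equations, the side conditions,
    [B B = 0] and [b B = - B b] one gets, without summing anything,
    [AW_oo sh_oo = 1] and [sh_oo AW_oo = 1 + (b + B) Phi + Phi (b + B)]
    ([aw_tot_sh_tot] and [sh_tot_aw_tot]).

    The perturbation lemma makes [sh_oo] and [AW_oo] chain maps for the
    differential [b + AW B sh + AW B phi B sh + ...] of [A]. What has to be proved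
    is that this is [b + B], which amounts to two facts.

    - [AW B sh = B] ([nAW_mB_nsh]). Modulo degeneracies, [B] is the sum of the
      [e t^j] up to sign, where [e] is the extra degeneracy. Since [e t^j] carries
      a degeneracy to a degeneracy, with rotated index, a component of
      [AW (e t^j (s_nu x (x) s_mu y))] is nonzero only if rotation moves all the
      [mu] before all the [nu]; exactly one shuffle then survives, in which [mu]
      or [nu] is an interval, and it yields one term of [B x (x) y] or of
      [x (x) B y].

    - [AW B (phi B)^m sh = 0] for [m > 0] ([nAW_mB_phiB_nsh]). This uses the
      naturality of [phi]. The cyclic submodule of [P] generated by the elements
      of degree at most [p] has a normalized complex that vanishes above degree
      [p + 1], so that a natural operation defined on [P_p (x) Q_q] cannot raise
      the total degree by more than 2; this one would raise it by [2 m + 1].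

    That [AW] commutes with [b] and that [AW sh = 1] are checked on elements.
    These facts imply that [sh] commutes with [b]: because [b b = 0], the map
    [sh AW = 1 + b phi + phi b] commutes with [b], hence
    [b sh = (b sh AW) sh = sh AW b sh = sh b AW sh = sh b].

    The identities are proved for operators on the products [prod_n M_n], where
    operators of all degrees can be composed without casts. A graded identity is
    recovered by evaluating at a homogeneous element, and the negative cyclic
    complexes embed in such products. *)

(** * Linear maps and homogeneous components *)

Section Lin.
Context {k : pzRingType} {U V : lmodType k} {f : U -> V} (hf : linear f).

Let fl : {linear U -> V} := HB.pack f (GRing.isLinear.Build k U V _ f hf).
Lemma lin0 : f 0 = 0. Proof. exact: (linear0 fl). Qed.
Lemma linD x y : f (x + y) = f x + f y. Proof. exact: (linearD fl). Qed.
Lemma linN x : f (- x) = - f x. Proof. exact: (linearN fl). Qed.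
Lemma linB x y : f (x - y) = f x - f y. Proof. exact: (linearB fl). Qed.
Lemma linZ a x : f (a *: x) = a *: f x. Proof. exact: (linearZZ fl). Qed.
Lemma lin_sum (I : Type) (r : seq I) (A : pred I) (F : I -> U) :
  f (\sum_(i <- r | A i) F i) = \sum_(i <- r | A i) f (F i).
Proof. exact: (linear_sum fl). Qed.
End Lin.

Lemma lin_id {k : pzRingType} {U : lmodType k} : linear (id : U -> U).
Proof. by []. Qed.

Lemma lin_comp {k : pzRingType} {U V W : lmodType k} (f : V -> W) (g : U -> V) :
  linear f -> linear g -> linear (fun x => f (g x)).
Proof. by move=> hf hg a x y; rewrite hg hf. Qed.

Lemma lin_bigsum {k : comPzRingType} {U V : lmodType k} (I : Type) (r : seq I)
    (A : pred I) (F : I -> U -> V) :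
  (forall i, linear (F i)) -> linear (fun x => \sum_(i <- r | A i) F i x).
Proof.
move=> h a x y; rewrite scaler_sumr -big_split; apply: eq_bigr => i _.
exact: h.
Qed.

Lemma lin_scale {k : comPzRingType} {U V : lmodType k} (c : k) (f : U -> V) :
  linear f -> linear (fun x => c *: f x).
Proof. by move=> h a x y; rewrite h scalerDr !scalerA mulrC. Qed.

Lemma tens_ext {k : comPzRingType} {U V W : lmodType k} (f g : tens U V -> W) :
  linear f -> linear g -> (forall u v, f (pure u v) = g (pure u v)) -> f =1 g.
Proof.
move=> hf hg h; apply: tens_ind => [|x y hx hy|//]; first by rewrite !lin0.
by rewrite !linD // hx hy.
Qed.

Section Hcomp.
Context {k : pzRingType} {I : eqType}.
Implicit Types M N : I -> lmodType k.

Lemma hcomp_id M i (x : M i) : hcomp M i x = x.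
Proof. by rewrite /hcomp; case: eqP => // e; rewrite eq_axiomK. Qed.

Lemma hcomp_neq M i j (x : M i) : i <> j -> hcomp M j x = 0.
Proof. by rewrite /hcomp; case: eqP. Qed.

Lemma hcomp_linear M i j : linear (@hcomp k I M i j).
Proof.
case: (eqVneq i j) => [e | /eqP ne a x y]; last by rewrite !hcomp_neq // scaler0 addr0.
by case: j / e => a x y; rewrite !hcomp_id.
Qed.

Lemma hcomp0 M i j : hcomp M j (0 : M i) = 0.
Proof. exact: (lin0 (@hcomp_linear M i j)). Qed.

Lemma hcomp_hcomp M i j l (x : M i) :
  i = j -> hcomp M l (hcomp M j x) = hcomp M l x.
Proof. by move=> e; case: j / e; rewrite hcomp_id. Qed.

Lemma hcomp_hcompr M i j l (x : M i) :
  j = l -> hcomp M l (hcomp M j x) = hcomp M l x.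
Proof. by move=> e; case: l / e; rewrite hcomp_id. Qed.
End Hcomp.

Lemma hcomp_map {k : pzRingType} {I J : eqType} (M : I -> lmodType k)
    (N : J -> lmodType k) (g : I -> J) (F : forall i, M i -> N (g i)) :
  injective g -> (forall i, linear (F i)) ->
  forall i j (x : M i), hcomp N (g j) (F i x) = F j (hcomp M j x).
Proof.
move=> gI hF i j x; case: (eqVneq i j) => [e | /eqP ne].
  by case: j / e; rewrite !hcomp_id.
rewrite (hcomp_neq x) // (lin0 (hF j)) hcomp_neq // => /gI; exact: ne.
Qed.

(** * The extra degeneracy of a cyclic module *)

Section Calculus.
Context {k : comPzRingType} (P : cyclicModule k).

(** The extra degeneracy, usually written [s_(-1)] or [s_(n+1)]; it satisfies the
    simplicial identities of a degeneracy of index [-1]. *)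
Definition ext n (x : P n) : P n.+1 := cyc P n.+1 (degen P n n x).
Definition rot j n (x : P n) : P n := iter j (cyc P n) x.
Definition ext_rot j n (x : P n) : P n.+1 := ext (rot j x).

Lemma ext_linear n : linear (@ext n).
Proof. by move=> a x y; rewrite /ext !linearP. Qed.
Lemma rot_linear j n : linear (@rot j n).
Proof. by elim: j => [|j ih] a x y //; rewrite /rot !iterS -/(rot j _) ih linearP. Qed.
Lemma ext_rot_linear j n : linear (@ext_rot j n).
Proof. exact: lin_comp (@ext_linear n) (@rot_linear j n). Qed.

Lemma rotD i j n (x : P n) : rot (i + j) x = rot i (rot j x).
Proof. exact: iterD. Qed.
Lemma rotS j n (x : P n) : rot j.+1 x = cyc P n (rot j x).
Proof. by []. Qed.
Lemma rotSr j n (x : P n) : rot j.+1 x = rot j (cyc P n x).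
Proof. exact: iterSr. Qed.
Lemma rot_order n (x : P n) : rot n.+1 x = x.
Proof. exact: cyc_order. Qed.

Lemma face0_ext n (x : P n) : face P n 0 (ext x) = x.
Proof. by rewrite /ext face0_cyc face_degen_succ. Qed.

Lemma faceS_ext n i (x : P n.+1) : (i <= n)%N ->
  face P n.+1 i.+1 (ext x) = ext (face P n i x).
Proof. by move=> h; rewrite /ext face_cyc ?face_degen_lt // leqW. Qed.

Lemma face_last_ext n (x : P n) : face P n n.+1 (ext x) = cyc P n x.
Proof. by rewrite /ext face_cyc // face_degen_eq. Qed.

Lemma ext_degen n a (x : P n) : (a <= n)%N ->
  ext (degen P n a x) = degen P n.+1 a.+1 (ext x).
Proof. by move=> h; rewrite /ext degen_cyc // (@degen_degen _ P n a n). Qed.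

Lemma ext_ext n (x : P n) : ext (ext x) = degen P n.+1 0 (ext x).
Proof. by rewrite /ext degen0_cyc degen_cyc // (@degen_degen _ P n n n). Qed.

Lemma cyc_ext n (x : P n) : cyc P n.+1 (ext x) = degen P n 0 (cyc P n x).
Proof. by rewrite degen0_cyc. Qed.

Lemma rot_degen_lt j n a (x : P n) : (a + j <= n)%N ->
  rot j (degen P n a x) = degen P n (a + j) (rot j x).
Proof.
elim: j => [|j ih] h; first by rewrite addn0.
by rewrite !rotS ih ?addnS ?degen_cyc //; lia.
Qed.

Lemma rot_degen_wrap n a (x : P n) : (a <= n)%N ->
  rot (n.+1 - a) (degen P n a x) = ext (rot (n - a) x).
Proof.
by move=> h; rewrite subSn // rotS rot_degen_lt subnKC.
Qed.

Lemma ext_rot_degen_lt j n a (x : P n) : (a + j <= n)%N ->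
  ext_rot j (degen P n a x) = degen P n.+1 (a + j).+1 (ext_rot j x).
Proof. by move=> h; rewrite /ext_rot rot_degen_lt // ext_degen. Qed.

(** Once [t^j] has pushed the degeneracy past the last position it comes back as
    [e], and the next rotation turns [e] into [s_0 t]; one of the rotations is
    absorbed, hence the predecessor of [j]. *)
Lemma ext_rot_degen_ge j n a (x : P n) : (a <= n)%N -> (j <= n.+1)%N ->
  (n < a + j)%N ->
  ext_rot j (degen P n a x) = degen P n.+1 (a + j - n.+1) (ext_rot j.-1 x).
Proof.
move=> ha hj h; rewrite /ext_rot.
have [m ej] : exists m, j = (m + (n.+1 - a))%N by exists (a + j - n.+1)%N; lia.
subst j.
rewrite rotD rot_degen_wrap // (_ : (a + _ - _)%N = m); last by lia.
case: m hj h => [|m] hj h; first by rewrite add0n /= ext_ext subSn.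
rewrite rotSr cyc_ext rot_degen_lt ?ext_degen; try lia.
rewrite !add0n -rotS -rotD; congr (degen P n.+1 _ (ext (rot _ x))); lia.
Qed.

(** Membership in the image of [s_a]. A predicate is used rather than the
    preimage because the degree of the preimage would otherwise have to be cast. *)
Definition is_degen a n : P n -> Prop :=
  match n return P n -> Prop with
  | 0%N => fun=> False
  | m.+1 => fun z => (a <= m)%N /\ exists w, z = degen P m a w
  end.

Lemma is_degen_degen n a (w : P n) : (a <= n)%N -> is_degen a (degen P n a w).
Proof. by split=> //; exists w. Qed.

Lemma qpi_is_degen n a (z : P n) : is_degen a z -> qpi (@degenerate k P n) z = 0.
Proof.
case: n z => [|n] z //= [h [w ->]]; rewrite -(linear0 (qpi _)).
by apply/qpiP; rewrite subr0; apply: span_gen; exists a; split=> //; exists w.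
Qed.

Lemma is_degen_degen_gt n a b (z : P n) : (a < b)%N -> (b <= n)%N ->
  is_degen a z -> is_degen a (degen P n b z).
Proof.
case: n z => [|n] z //= h hb [ha [w ->]]; split; first lia.
exists (degen P n b.-1 w).
by rewrite (@degen_degen _ P n a b.-1) ?prednK //; lia.
Qed.

Lemma is_degen_degen_le n a b (z : P n) : (b <= a)%N ->
  is_degen a z -> is_degen a.+1 (degen P n b z).
Proof.
case: n z => [|n] z //= h [ha [w ->]]; split=> //.
by exists (degen P n b w); rewrite (@degen_degen _ P n b a).
Qed.

Lemma is_degen_face_last n a (z : P n.+1) : (a < n)%N ->
  is_degen a z -> is_degen a (face P n n.+1 z).
Proof.
case: n z => [|n] z //= h [ha [w ->]]; split=> //.
by exists (face P n n.+1 w); rewrite face_degen_gt.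
Qed.

Lemma is_degen_face0 n a (z : P n.+1) : is_degen a.+1 z -> is_degen a (face P n 0 z).
Proof.
case: n z => [|n] z [ha [w zE]] //; rewrite zE; split=> //.
by exists (face P n 0 w); rewrite face_degen_lt.
Qed.

Lemma is_degen_ext_rot_lt n j a (z : P n) : (a + j < n)%N ->
  is_degen a z -> is_degen (a + j).+1 (ext_rot j z).
Proof.
case: n z => [|n] z // h [ha [w ->]].
by rewrite ext_rot_degen_lt //; exact: is_degen_degen.
Qed.

Lemma is_degen_ext_rot_ge n j a (z : P n) : (j <= n)%N -> (n <= a + j)%N ->
  is_degen a z -> is_degen (a + j - n) (ext_rot j z).
Proof.
case: n z => [|n] z // hj h [ha [w ->]].
by rewrite ext_rot_degen_ge //; apply: is_degen_degen; lia.
Qed.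

Lemma is_degen_hcomp n n' a (z : P n) : n = n' -> is_degen a z -> is_degen a (hcomp P n' z).
Proof. by move=> e; case: n' / e; rewrite hcomp_id. Qed.

Lemma front_linear r n : linear (@front k P r n).
Proof. by elim: r => [|r ih] a x y //=; rewrite linearP ih. Qed.
Lemma back_linear r n : linear (@back k P r n).
Proof. by elim: r => [|r ih] a x y //=; rewrite linearP ih. Qed.
Lemma degens_linear f r n : linear (@degens k P f r n).
Proof. by elim: r => [|r ih] a x y //=; rewrite ih linearP. Qed.

Lemma is_degen_front r n a (z : P (r + n)%N) : (a < n)%N -> is_degen a z -> is_degen a (front z).
Proof.
move=> h; elim: r z => [|r ih] z //= hz; apply: ih.
by apply: (@is_degen_face_last (r + n)); first lia.
Qed.

Lemma is_degen_back r n a (z : P (r + n)%N) : (r <= a)%N -> is_degen a z -> is_degen (a - r) (back z).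
Proof.
elim: r a z => [|r ih] a z /=; first by rewrite subn0.
case: a => [|a] //= h hz; rewrite subSS; apply: ih => //.
exact: (@is_degen_face0 (r + n)).
Qed.

(** The top faces commute with [s_a] until one of them cancels it. *)
Lemma front_degen r n a (w : P (r + n)%N) : (n <= a)%N -> (a <= r + n)%N ->
  front (r := r.+1) (degen P (r + n) a w) = front w.
Proof.
elim: r w => [|r ih] w h1 h2.
  have -> : a = n by lia.
  by rewrite /= face_degen_succ.
move: h2; rewrite leq_eqVlt => /orP[/eqP ->|h2].
  by rewrite [LHS]/= face_degen_succ.
rewrite -[RHS](ih (face P (r + n) (r + n).+1 w)) //.
by rewrite [LHS]/= face_degen_gt.
Qed.

Lemma back_degen r n a (w : P (r + n)%N) : (a <= r)%N ->
  back (r := r.+1) (degen P (r + n) a w) = back w.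
Proof.
elim: r a w => [|r ih] a w h.
  have -> : a = 0%N by lia.
  by rewrite /= face_degen_eq.
case: a h => [|a] h; first by rewrite [LHS]/= face_degen_eq.
rewrite -[RHS](ih a (face P (r + n) 0 w)) //.
by rewrite [LHS]/= (@face_degen_lt _ _ _ 0 a.+1) //; exact: leq_trans h (leq_addr _ _).
Qed.

End Calculus.

(** * The relations between b and B on normalized complexes *)

Lemma sign_congr {k : pzRingType} (i j : nat) : odd i = odd j -> (-1) ^+ i = (-1) ^+ j :> k.
Proof. by move=> e; rewrite -signr_odd e signr_odd. Qed.

Lemma sign_congrN {k : pzRingType} (i j : nat) : odd i = ~~ odd j ->
  (-1) ^+ i = - (-1) ^+ j :> k.
Proof. by move=> e; rewrite -signr_odd e signrN signr_odd. Qed.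

(** Form of [qmapE] for a map given with a proof of linearity rather than as a
    linear structure. *)
Lemma qmap_qpi (k : pzRingType) (V W : lmodType k) (G : set V) (H : set W)
    (f : V -> W) : linear f -> (forall x, G x -> qpi H (f x) = 0) ->
  forall x, qmap (G := G) f (qpi G x) = qpi H (f x).
Proof.
move=> hf h; pose fl : {linear V -> W} := HB.pack f (GRing.isLinear.Build k V W _ f hf).
apply: (@qmapE _ _ _ G H fl) => x /h; rewrite -(linear0 (qpi H)) => /qpiP.
by rewrite subr0.
Qed.

Lemma quot_ind (k : pzRingType) (V : lmodType k) (G : set V) (A : quotm G -> Prop) :
  (forall x, A (qpi G x)) -> forall x, A x.
Proof. by move=> h x; rewrite -(qreprK x). Qed.

Lemma qpi_linear (k : pzRingType) (V : lmodType k) (G : set V) : linear (qpi G).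
Proof. by move=> a x y; rewrite linearP. Qed.

Section QpiLinear.
Context {k : pzRingType} {V : lmodType k} (G : set V).
Lemma qpi0 : qpi G 0 = 0. Proof. exact: lin0 (@qpi_linear k V G). Qed.
Lemma qpiB x y : qpi G (x - y) = qpi G x - qpi G y.
Proof. exact: linB (@qpi_linear k V G) x y. Qed.
Lemma qpiN x : qpi G (- x) = - qpi G x.
Proof. exact: linN (@qpi_linear k V G) x. Qed.
Lemma qpiZ a x : qpi G (a *: x) = a *: qpi G x.
Proof. exact: linZ (@qpi_linear k V G) a x. Qed.
Lemma qpi_sum (I : Type) (r : seq I) (A : pred I) (F : I -> V) :
  qpi G (\sum_(i <- r | A i) F i) = \sum_(i <- r | A i) qpi G (F i).
Proof. exact: lin_sum (@qpi_linear k V G) _ _ _ _. Qed.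
End QpiLinear.

Lemma qmap_linear (k : pzRingType) (V W : lmodType k) (G : set V) (H : set W)
    (f : V -> W) : linear f -> (forall x, G x -> qpi H (f x) = 0) ->
  linear (qmap (G := G) (H := H) f).
Proof.
move=> hf h a; elim/quot_ind => x; elim/quot_ind => y.
by rewrite -linearP !qmap_qpi // hf linearP.
Qed.

Section Mixed.
Context {k : comPzRingType} (P : cyclicModule k).

Local Notation qP n := (qpi (@degenerate k P n)).

Lemma degenerate_is_degen n (x : P n) : degenerate x -> exists a, is_degen a x.
Proof. by case: n x => [//|n] x [a [ha [y ->]]]; exists a; exact: is_degen_degen. Qed.

Lemma hochschild_linear n : linear (@hochschild k P n).
Proof. by apply: lin_bigsum => i; apply: lin_scale => a x y; rewrite linearP. Qed.

(** The norm of the cyclic group, with the sign twist that makes it invariant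
    under [(-1)^n t]. *)
Definition norm_op n (x : P n) : P n :=
  \sum_(i < n.+1) (-1) ^+ (n * i) *: rot i x.

Lemma norm_op_linear n : linear (@norm_op n).
Proof. by apply: lin_bigsum => i; apply: lin_scale; exact: rot_linear. Qed.

Lemma connesE n (x : P n) :
  connes x = ext (norm_op x) - (-1) ^+ n.+1 *: cyc P n.+1 (ext (norm_op x)).
Proof. by []. Qed.

Lemma connes_linear n : linear (@connes k P n).
Proof.
move=> a x y; rewrite !connesE norm_op_linear ext_linear linearP scalerDr opprD.
by rewrite scalerBr !scalerA mulrC -scalerA addrACA.
Qed.

(** The second half of [B] is degenerate because [t e = s_0 t]. *)
Lemma qpi_connes n (x : P n) :
  qP n.+1 (connes x) = \sum_(j < n.+1) (-1) ^+ (n * j) *: qP n.+1 (ext_rot j x).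
Proof.
rewrite connesE qpiB qpiZ cyc_ext.
rewrite (qpi_is_degen (is_degen_degen _ (leq0n _))) scaler0 subr0.
rewrite /norm_op (lin_sum (@ext_linear k P n)) qpi_sum; apply: eq_bigr => j _.
by rewrite (linZ (@ext_linear k P n)) qpiZ.
Qed.

Lemma qpi_connes_degenerate n (x : P n) : degenerate x -> qP n.+1 (connes x) = 0.
Proof.
move=> /degenerate_is_degen[a ha]; rewrite qpi_connes big1 // => j _.
case: (ltnP (a + j) n) => h.
  by rewrite (qpi_is_degen (is_degen_ext_rot_lt h ha)) scaler0.
by rewrite (qpi_is_degen (is_degen_ext_rot_ge _ h ha)) ?scaler0 // -ltnS.
Qed.

Lemma qpi_hochschild_degenerate n (x : P n.+1) :
  degenerate x -> qP n (hochschild x) = 0.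
Proof.
move=> [j [hj [w ->]]]; rewrite /hochschild qpi_sum.
have hj1 : (j < n.+2)%N by lia.
have hj2 : (j.+1 < n.+2)%N by lia.
rewrite (bigD1 (Ordinal hj1)) //= (bigD1 (Ordinal hj2)) /=; last first.
  by rewrite -val_eqE /=; lia.
rewrite big1 ?addr0 => [|i /andP[]]; last first.
  rewrite -!val_eqE /= => h1 h2; rewrite qpiZ.
  case: n x w hj hj1 hj2 i h1 h2 => [|n] x w hj hj1 hj2 i h1 h2.
    by move: (ltn_ord i); lia.
  have [h|h] := ltnP i j.
    by rewrite face_degen_lt // (qpi_is_degen (is_degen_degen _ _)) ?scaler0 //; lia.
  rewrite face_degen_gt; try by move: (ltn_ord i); lia.
  by rewrite (qpi_is_degen (is_degen_degen _ _)) ?scaler0 //; move: (ltn_ord i); lia.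
by rewrite face_degen_eq // face_degen_succ // exprS mulN1r scaleNr qpiN subrr.
Qed.

Lemma qpi_hochschild_degen0 n (y : P n) : qP n (hochschild (degen P n 0 y)) = 0.
Proof. by apply: qpi_hochschild_degenerate; exists 0%N; split=> //; exists y. Qed.

Lemma mb_qpi n (x : P n.+1) : mb (m := normalized P) (qP n.+1 x) = qP n (hochschild x).
Proof.
exact: (qmap_qpi (@hochschild_linear n) (@qpi_hochschild_degenerate n)).
Qed.
Lemma mB_qpi n (x : P n) : mB (m := normalized P) (qP n x) = qP n.+1 (connes x).
Proof. exact: (qmap_qpi (@connes_linear n) (@qpi_connes_degenerate n)). Qed.
Lemma mb_linear n : linear (@mb k (normalized P) n).
Proof.
exact: (qmap_linear (@hochschild_linear n) (@qpi_hochschild_degenerate n)).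
Qed.
Lemma mB_linear n : linear (@mB k (normalized P) n).
Proof. exact: (qmap_linear (@connes_linear n) (@qpi_connes_degenerate n)). Qed.

(** The sum telescopes because [t^(n+1) = 1] and [n (n + 1)] is even. *)
Lemma norm_op_telescope n (x : P n) :
  \sum_(j < n.+1) ((-1) ^+ (n * j) *: rot j x - (-1) ^+ (n * j.+1) *: rot j.+1 x) = 0.
Proof.
rewrite -(big_mkord predT (fun j => (-1) ^+ (n * j) *: rot j x
   - (-1) ^+ (n * j.+1) *: rot j.+1 x)).
rewrite -[RHS]oppr0; apply: (canRL (@opprK _)); rewrite -sumrN.
under eq_bigr do rewrite opprB.
rewrite telescope_sumr // rot_order muln0 -signr_odd oddM /= andbN.
by rewrite subrr.
Qed.

Lemma norm_op_sub_cyc n (x : P n) : norm_op (x - (-1) ^+ n *: cyc P n x) = 0.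
Proof.
rewrite -[RHS](norm_op_telescope x); apply: eq_bigr => j _.
rewrite (linB (@rot_linear k P j n)) (linZ (@rot_linear k P j n)) -rotSr.
by rewrite scalerBr scalerA -exprD mulnSr.
Qed.

(** Modulo degeneracies [B = e N], and [B = (1 - (-1)^(n+1) t) e N] exactly, so
    that [N (1 - (-1)^(n+1) t) = 0] applies. *)
Lemma connes_connes n (x : P n) : qP n.+2 (connes (connes x)) = 0.
Proof.
rewrite [connes _]connesE qpiB qpiZ cyc_ext.
rewrite (qpi_is_degen (is_degen_degen _ (leq0n _))) scaler0 subr0 connesE norm_op_sub_cyc.
by rewrite (lin0 (@ext_linear k P _)) qpi0.
Qed.

Lemma face_rot_le n i j (x : P n.+1) : (j <= i)%N -> (i <= n.+1)%N ->
  face P n i (rot j x) = rot j (face P n (i - j) x).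
Proof.
elim: j i => [|j ih] i h hi; first by rewrite subn0.
rewrite !rotS face_cyc //; last lia.
by rewrite ih; try lia; congr (cyc P n (rot j (face P n _ x))); lia.
Qed.

Lemma face_rot_gt n i j (x : P n.+1) : (i < j)%N -> (j <= n.+2)%N ->
  face P n i (rot j x) = rot j.-1 (face P n (n.+2 + i - j) x).
Proof.
elim: i j => [|i ih] [//|j] h hj.
  rewrite rotS face0_cyc face_rot_le //.
  by congr (rot j (face P n _ x)); lia.
rewrite rotS face_cyc; try lia.
rewrite ih; try lia.
by case: j h hj => [//|j] h hj; rewrite -rotS; congr (rot _ (face P n _ x)); lia.
Qed.

(** The differential usually written [b'], which omits the last face. *)
Definition bprime n (x : P n.+1) : P n :=
  \sum_(i < n.+1) (-1) ^+ i *: face P n i x.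

Lemma faceZ n i a (x : P n.+1) : face P n i (a *: x) = a *: face P n i x.
Proof. exact: linearZZ. Qed.

(** The relation [b' N = N b]. Every [d_i t^j] on the left equals one [t^l d_m] on
    the right: [(l, m) = (j, i - j)] if [j <= i], and
    [(l, m) = (j - 1, n + 2 + i - j)] otherwise. *)
Lemma bprime_norm n (x : P n.+1) : bprime (norm_op x) = norm_op (hochschild x).
Proof.
rewrite /bprime /norm_op /hochschild.
under eq_bigr do rewrite linear_sum scaler_sumr.
under [RHS]eq_bigr do rewrite (lin_sum (@rot_linear k P _ n)) scaler_sumr.
rewrite !pair_big /=.
(* [h] sends [(l, m)] to the pair [(i, j)] with [d_i t^j = t^l d_m]; [g] is its inverse. *)
pose h (p : 'I_n.+1 * 'I_n.+2) : 'I_n.+1 * 'I_n.+2 :=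
  if (p.2 + p.1 < n.+1)%N then (inord (p.2 + p.1), inord p.1)
  else (inord (p.2 + p.1 - n.+1), inord p.1.+1).
pose g (p : 'I_n.+1 * 'I_n.+2) : 'I_n.+1 * 'I_n.+2 :=
  if (p.2 <= p.1)%N then (inord p.2, inord (p.1 - p.2))
  else (inord p.2.-1, inord (n.+2 + p.1 - p.2)).
have hlt (l : 'I_n.+1) (m : 'I_n.+2) : (m + l < n.+1)%N ->
    ((h (l, m)).1 = m + l :> nat)%N * ((h (l, m)).2 = l :> nat).
  by move=> e; rewrite /h /= e /= !inordK //; move: (ltn_ord l); lia.
have hge (l : 'I_n.+1) (m : 'I_n.+2) : (n.+1 <= m + l)%N ->
    ((h (l, m)).1 = m + l - n.+1 :> nat)%N * ((h (l, m)).2 = l.+1 :> nat)%N.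
  move=> e; rewrite /h /= ltnNge e /= !inordK //; move: (ltn_ord l) (ltn_ord m); lia.
rewrite (reindex_onto h g) /=.
  apply: eq_big => [p|[l m] _]; last first.
    rewrite faceZ (linZ (@rot_linear k P _ n)) !scalerA.
    move: (ltn_ord l) (ltn_ord m) => hl hm.
    have [e|e] := ltnP (m + l) n.+1.
      rewrite !hlt // face_rot_le; try lia.
      rewrite addnK; congr (_ *: _); rewrite -!exprD; apply: sign_congr.
      by rewrite !(oddD, oddM) /= ?oddD; case: (odd n); case: (odd m); case: (odd l).
    rewrite !hge // face_rot_gt; try lia.
    rewrite (_ : (n.+2 + _ - _)%N = m); last by lia.
    rewrite /=; congr (_ *: _); rewrite -!exprD; apply: sign_congr.
    rewrite !(oddD, oddM) /= ?oddB // ?oddD /=.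
    by case: (odd n); case: (odd m); case: (odd l).
  case: p => l m /=; rewrite -[RHS]/true; apply/eqP.
  move: (ltn_ord l) (ltn_ord m) => hl hm.
  have [e|e] := ltnP (m + l) n.+1.
    have [e1 e2] := hlt l m e.
    rewrite /g e1 e2 leq_addl; congr (_, _); apply: val_inj; rewrite /= inordK; lia.
  have [e1 e2] := hge l m e.
  rewrite /g e1 e2 ifF; last by lia.
  congr (_, _); apply: val_inj; rewrite /= inordK; lia.
move=> [i j] _ /=; move: (ltn_ord i) (ltn_ord j) => hi hj.
rewrite /g /=; have [e|e] := leqP j i.
  rewrite /h /= !inordK; try lia.
  rewrite ifT; last lia.
  congr (_, _); apply: val_inj; rewrite /= inordK; lia.
rewrite /h /= !inordK; try lia.
rewrite ifF; last lia.
congr (_, _); apply: val_inj; rewrite /= inordK; lia.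
Qed.

(** This expresses that [e] contracts [b']: all the faces of [e x] except the
    first and the last are of the form [e (d_i x)]. *)
Lemma hochschild_ext n (x : P n.+1) :
  hochschild (ext x) = x - ext (bprime x) + (-1) ^+ n.+2 *: cyc P n.+1 x.
Proof.
rewrite /hochschild big_ord_recr /= face_last_ext; congr (_ + _).
rewrite big_ord_recl /= expr0 scale1r face0_ext; congr (_ + _).
rewrite (lin_sum (@ext_linear k P n)) -sumrN; apply: eq_bigr => i _.
rewrite (linZ (@ext_linear k P n)) /bump /= add1n faceS_ext; last by rewrite -ltnS.
by rewrite exprS mulN1r scaleNr.
Qed.

Lemma hochschild_ext0 (x : P 0) : hochschild (ext x) = x - cyc P 0 x.
Proof.
rewrite /hochschild big_ord_recr /= face_last_ext big_ord1 /= face0_ext expr1 expr0.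
by rewrite scale1r scaleN1r.
Qed.

(** [b e N = (1 - t) N - e b' N] up to the sign of [t], and [(1 - t) N = 0]. *)
Lemma hochschild_ext_norm n (x : P n.+1) :
  hochschild (ext (norm_op x)) = - ext (norm_op (hochschild x)).
Proof.
rewrite hochschild_ext bprime_norm addrAC -[RHS]add0r; congr (_ - _).
rewrite -[RHS](norm_op_telescope x) big_split /=; congr (_ + _).
rewrite linear_sum scaler_sumr; apply: eq_bigr => j _.
rewrite linearZZ scalerA -exprD -scaleNr; congr (_ *: _).
by apply: sign_congrN; rewrite !(oddD, oddM) /=; case: (odd n); case: (odd j).
Qed.

Lemma b_connes0 (x : P 0) : qP 0 (hochschild (connes x)) = 0.
Proof.
have h0 : cyc P 0 x = x by exact: (rot_order x).
rewrite connesE (linB (@hochschild_linear _)) qpiB.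
rewrite (linZ (@hochschild_linear _)) qpiZ cyc_ext.
rewrite qpi_hochschild_degen0.
rewrite scaler0 subr0 hochschild_ext0 /norm_op big_ord1 muln0 expr0 scale1r.
by rewrite /rot /= h0 subrr qpi0.
Qed.

Lemma b_connes n (x : P n.+1) :
  qP n.+1 (hochschild (connes x)) = - qP n.+1 (connes (hochschild x)).
Proof.
rewrite !connesE (linB (@hochschild_linear _)) !qpiB.
rewrite (linZ (@hochschild_linear _)) !qpiZ !cyc_ext.
rewrite qpi_hochschild_degen0.
rewrite (qpi_is_degen (is_degen_degen _ (leq0n _))) !scaler0 !subr0.
by rewrite hochschild_ext_norm qpiN.
Qed.

End Mixed.

Section MixedRelations.
Context {k : comPzRingType} (P : cyclicModule k).
Local Notation C := (normalized P).

Lemma mB_mB n (x : C n) : mB (mB x) = 0 :> C n.+2.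
Proof. by elim/quot_ind: x => x; rewrite !mB_qpi connes_connes. Qed.
Lemma mb_mB n (x : C n.+1) : mb (mB x) = - mB (mb x) :> C n.+1.
Proof. by elim/quot_ind: x => x; rewrite mB_qpi !mb_qpi mB_qpi b_connes. Qed.
Lemma mb_mB0 (x : C 0) : mb (mB x) = 0 :> C 0.
Proof. by elim/quot_ind: x => x; rewrite mB_qpi !mb_qpi b_connes0. Qed.
End MixedRelations.

(** * Total tensor products and the Alexander-Whitney map *)

Notation tin n w := (@tinj _ _ _ n _ _ w).

Section Tensor.
Context {k : comPzRingType}.

Lemma pure0l (U V : lmodType k) (v : V) : pure (0 : U) v = 0.
Proof. exact: (lin0 (pure_linearl v)). Qed.
Lemma pure0r (U V : lmodType k) (u : U) : pure u (0 : V) = 0.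
Proof. exact: (lin0 (pure_linearr u)). Qed.
Lemma pureZl (U V : lmodType k) a (u : U) (v : V) : pure (a *: u) v = a *: pure u v.
Proof. exact: (linZ (pure_linearl v)). Qed.
Lemma pure_suml (U V : lmodType k) I (r : seq I) (F : I -> U) (v : V) :
  pure (\sum_(i <- r) F i) v = \sum_(i <- r) pure (F i) v.
Proof. exact: (lin_sum (pure_linearl v)). Qed.
Lemma pure_sumr (U V : lmodType k) I (r : seq I) (F : I -> V) (u : U) :
  pure u (\sum_(i <- r) F i) = \sum_(i <- r) pure u (F i).
Proof. exact: (lin_sum (pure_linearr u)). Qed.

Section TmapLin.
Context (U U' V V' : lmodType k) (f : U -> U') (g : V -> V').
Hypotheses (hf : linear f) (hg : linear g).
Let fl : {linear U -> U'} := HB.pack f (GRing.isLinear.Build k U U' _ f hf).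
Let gl : {linear V -> V'} := HB.pack g (GRing.isLinear.Build k V V' _ g hg).
Lemma tmapE u v : tmap f g (pure u v) = pure (f u) (g v).
Proof. exact: (tmap_pure fl gl). Qed.
Lemma tmap_linear : linear (tmap f g).
Proof. exact: (tmap_is_linear fl gl). Qed.
End TmapLin.

Lemma tmap0l (U U' V V' : lmodType k) (g : V -> V') (w : tens U V) :
  tmap (fun=> 0 : U') g w = 0.
Proof. by rewrite /tmap /tlift big1 // => i _; rewrite pure0l. Qed.

Section Tot.
Context {M N : nat -> lmodType k}.

(** The component in bidegree [(p, q)], typed by [p] and [q] so that the second
    degree need not be of the form [n - p]. *)
Definition tget n (z : tot M N n) (p q : nat) : tens (M p) (N q) :=
  hcomp (bigr M N) (p, q) (z (inord p)).

Lemma tget_linear n p q : linear (fun z : tot M N n => tget z p q).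
Proof. by move=> a x y; exact: hcomp_linear. Qed.

Lemma tget_ord n (z : tot M N n) (i : 'I_n.+1) : z i = tget z i (n - i).
Proof. by rewrite /tget inord_val hcomp_id. Qed.

Lemma tget_val n (z : tot M N n) (i : 'I_n.+1) p q :
  val i = p -> hcomp (bigr M N) (p, q) (z i) = tget z p q.
Proof. by move=> <-; rewrite /tget inord_val. Qed.

Lemma tot_ext n (z z' : tot M N n) :
  (forall p q, (p + q = n)%N -> tget z p q = tget z' p q) -> z = z'.
Proof.
move=> h; apply: functional_extensionality_dep => i.
by rewrite !tget_ord h // subnKC ?leq_ord.
Qed.

Lemma tinj_linear n p q : linear (@tinj k M N n p q).
Proof.
move=> a x y; apply: functional_extensionality_dep => i.
exact: hcomp_linear.
Qed.

Lemma tget_tinj n p q p' q' (w : tens (M p) (N q)) : (p' + q' = n)%N ->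
  tget (tin n w) p' q' = hcomp (bigr M N) (i := (p, q)) (p', q') w.
Proof.
move=> e; rewrite /tget /tinj.
have hp : (inord p' : 'I_n.+1) = p' :> nat by rewrite inordK //; lia.
by rewrite hcomp_hcompr // hp; congr (_, _); lia.
Qed.

Lemma tot_sum_tinj n (z : tot M N n) : z = \sum_(p < n.+1) tin n (z p).
Proof.
apply: tot_ext => p q e; rewrite (lin_sum (@tget_linear n p q)).
have hp : (p < n.+1)%N by lia.
rewrite (bigD1 (Ordinal hp)) //= big1 ?addr0 => [|i].
  by rewrite tget_tinj //; exact/esym/(tget_val z (i := Ordinal hp)).
rewrite -val_eqE /= => /eqP h; rewrite tget_tinj // hcomp_neq // => -[h1 _].
exact: h.
Qed.

Lemma tot_lin_ext n (W : lmodType k) (f g : tot M N n -> W) :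
  linear f -> linear g ->
  (forall p q (x : M p) (y : N q), (p + q = n)%N ->
     f (tin n (pure x y)) = g (tin n (pure x y))) -> f =1 g.
Proof.
move=> hf hg h z; rewrite (tot_sum_tinj z) (lin_sum hf) (lin_sum hg).
apply: eq_bigr => p _.
apply: (tens_ext (f := fun w => f (tin n w)) (g := fun w => g (tin n w))) => [||u v].
- exact: lin_comp hf (@tinj_linear n _ _).
- exact: lin_comp hg (@tinj_linear n _ _).
- by apply: h; rewrite subnKC ?leq_ord.
Qed.
End Tot.

Section TotOps.
Context {M N : mixedModule k}.
Hypotheses (hMb : forall n, linear (@mb k M n)) (hNb : forall n, linear (@mb k N n)).
Hypotheses (hMB : forall n, linear (@mB k M n)) (hNB : forall n, linear (@mB k N n)).


Lemma tget_tot_b n (z : tot M N n.+1) p q : (p + q = n)%N ->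
  tget (tot_b z) p q = tmap (@mb k M p) id (tget z p.+1 q)
    + (-1) ^+ p *: tmap id (@mb k N q) (tget z p q.+1).
Proof.
move=> e; rewrite /tot_b (lin_sum (@tget_linear _ _ n p q)).
under eq_bigr => i _.
  rewrite (linD (@tget_linear _ _ n p q)) (linZ (@tget_linear _ _ n p q)).
  rewrite !tget_tinj // !(tget_ord z).
  over.
rewrite big_split /=.
have hp1 : (p.+1 < n.+2)%N by lia.
have hp : (p < n.+2)%N by lia.
congr (_ + _).
  rewrite (bigD1 (Ordinal hp1)) //= big1 ?addr0 => [|i].
    by rewrite (_ : (n.+1 - p.+1)%N = q) ?hcomp_id //; lia.
  rewrite -val_eqE /=; case: (val i) => [|j] /= h.
    by rewrite tmap0l hcomp0.
  by rewrite hcomp_neq // => -[h1 _]; lia.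
rewrite (bigD1 (Ordinal hp)) //= big1 ?addr0 => [|i].
  by rewrite (_ : (n.+1 - p)%N = q.+1) ?hcomp_id //; lia.
by rewrite -val_eqE /= => h; rewrite hcomp_neq ?scaler0 // => -[h1 _]; lia.
Qed.

Lemma tot_b_linear n : linear (@tot_b k M N n).
Proof.
move=> a x y; apply: tot_ext => p q e.
rewrite (@tget_linear _ _ n p q) !tget_tot_b // !(@tget_linear _ _ n.+1 _ _).
rewrite (tmap_linear (@hMb p) lin_id) (tmap_linear lin_id (@hNb q)) !scalerDr.
by rewrite !scalerA mulrC addrACA.
Qed.

Lemma tot_B_linear n : linear (@tot_B k M N n).
Proof.
apply: lin_bigsum => p a x y.
rewrite (tmap_linear (@hMB p) lin_id) (tmap_linear lin_id (@hNB _)).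
by rewrite !tinj_linear !scalerDr !scalerA mulrC addrACA.
Qed.

Lemma tot_B_pure p q (x : M p) (y : N q) n : (p + q = n)%N ->
  tot_B (tin n (pure x y)) = tin n.+1 (pure (mB x) y)
    + (-1) ^+ p *: tin n.+1 (pure x (mB y)).
Proof.
move=> e; rewrite /tot_B.
have hp : (p < n.+1)%N by lia.
rewrite (bigD1 (Ordinal hp)) //= [X in _ + X]big1 ?addr0 => [|i].
  have : (n - p)%N = q by lia.
  rewrite {2 4}/tinj /=; move: (n - p)%N => q' e'; subst q'; rewrite hcomp_id.
  by rewrite (tmapE (@hMB p) lin_id) (tmapE lin_id (@hNB q)).
rewrite -val_eqE /= => /eqP h.
have ne : (p, q) <> (i : nat, n - i)%N by case=> e1 _; apply: h.
rewrite {2 4}/tinj !(hcomp_neq _ ne).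
rewrite (lin0 (tmap_linear (@hMB _) lin_id)) (lin0 (tmap_linear lin_id (@hNB _))).
by rewrite !(lin0 (@tinj_linear _ _ _ _ _)) scaler0 addr0.
Qed.
End TotOps.
End Tensor.

Section Faces.
Context {k : comPzRingType} (P : cyclicModule k).

Lemma hcomp_face n m i (u : P n.+1) : n = m ->
  hcomp P m (face P n i u) = face P m i (hcomp P m.+1 u).
Proof. by move=> e; case: m / e; rewrite !hcomp_id. Qed.

Lemma hcomp_degen n m i (u : P n) :
  hcomp P m.+1 (degen P n i u) = degen P m i (hcomp P m u).
Proof.
apply: (hcomp_map (g := S) (F := fun n => degen P n i)); first exact: succn_inj.
by move=> l a x y; rewrite linearP.
Qed.

(** The case [i = p + 1] is included for the cancellation in [alt_sum_glue]. *)
Lemma front_face_le q p i (u : P (q + p).+1) : (i <= p.+1)%N ->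
  front (face P (q + p) i u) = face P p i (front (hcomp P (q + p.+1)%N u)).
Proof.
move=> h; elim: q u => [|q ih] u; first by rewrite hcomp_id.
have := ih (face P (q + p).+1 (q + p).+2 u).
rewrite hcomp_face ?addnS // => e; rewrite [LHS]/=.
rewrite -(@face_face _ P (q + p) i (q + p).+2) // ?e; last lia.
by rewrite /=; congr (face P p i (front (face P (q + p.+1) _ _))); rewrite addnS.
Qed.

Lemma front_face_gt q p i (u : P (q + p).+1) : (p < i)%N -> (i <= (q + p).+1)%N ->
  front (face P (q + p) i u) = front (r := q.+1) u.
Proof.
move=> h; elim: q u => [|q ih] u hi; first by rewrite (_ : i = p.+1) //; lia.
move: hi; rewrite leq_eqVlt => /orP[/eqP -> //|hi].
rewrite [RHS]/= -[RHS](ih (face P (q + p).+1 (q + p).+2 u)) //.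
by rewrite [LHS]/= -(@face_face _ P (q + p) i (q + p).+2).
Qed.

Lemma back_face_le q p i (v : P (p + q).+1) : (i <= p)%N ->
  back (face P (p + q) i v) = back (r := p.+1) v.
Proof.
elim: p i v => [|p ih] [|i] v h //.
rewrite [RHS]/= -[RHS](ih i (face P (p + q).+1 0 v)) //.
by rewrite [LHS]/= (@face_face _ P (p + q) 0 i.+1) //; move: (leq_addr q p); lia.
Qed.

Lemma back_face_ge q p i (v : P (p + q).+1) : (p <= i)%N -> (i <= (p + q).+1)%N ->
  back (face P (p + q) i v) = face P q (i - p) (back (hcomp P (p + q.+1)%N v)).
Proof.
elim: p i v => [|p ih] i v h hi; first by rewrite hcomp_id subn0.
case: i h hi => [//|i] h hi.
have := ih i (face P (p + q).+1 0 v) h hi.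
by rewrite hcomp_face ?addnS // subSS => <-; rewrite [LHS]/= (@face_face _ P (p + q) 0 i.+1).
Qed.
End Faces.

(** The cancellation in the proof that [AW] commutes with [b]: the last face of
    the front factor and the first face of the back factor give the same term,
    with opposite signs. *)
Lemma alt_sum_glue (k : comPzRingType) (V : lmodType k) p q (a b c : nat -> V) :
  (forall i, (i <= p)%N -> c i = a i) ->
  (forall j, (j <= q)%N -> c (p + j.+1)%N = b j.+1) -> a p.+1 = b 0%N ->
  \sum_(i < p.+2) (-1) ^+ i *: a i + (-1) ^+ p *: \sum_(j < q.+2) (-1) ^+ j *: b j
  = \sum_(i < (p + q).+2) (-1) ^+ i *: c i.
Proof.
move=> ha hb hab; rewrite big_ord_recr [\sum_(j < q.+2) _]big_ord_recl /= hab expr0 scale1r.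
rewrite scalerDr -addrA (addrA (_ *: b 0%N)) exprS mulN1r scaleNr addNr add0r.
rewrite -(addSn p q) -(addnS p.+1 q) big_split_ord /=; congr (_ + _).
  by apply: eq_bigr => i _; rewrite ha // -ltnS.
rewrite scaler_sumr; apply: eq_bigr => j _.
by rewrite scalerA -exprD /bump /= add1n addSnnS hb // -ltnS.
Qed.

Section AlexanderWhitney.
Context {k : comPzRingType} (P Q : cyclicModule k).
Local Notation qP n := (qpi (@degenerate k P n)).
Local Notation qQ n := (qpi (@degenerate k Q n)).
Local Notation qC n := (qpi (@degenerate k (cprod P Q) n)).
Local Notation T n := (tensMixed (normalized P) (normalized Q) n).

(** The component in bidegree [(p, q)] of the class of [AW (u (x) v)]. *)
Definition front_back n p q (u : P n) (v : Q n) : tens (normalized P p) (normalized Q q) :=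
  pure (qP p (front (hcomp P (q + p)%N u))) (qQ q (back (hcomp Q (p + q)%N v))).

(** [AW] followed by the projection to the normalized complexes; it is defined on
    [P_n (x) Q_n] itself and kills the degenerate elements, which makes it easier
    to compute with than [nAW]. *)
Definition AWq n (w : cprod P Q n) : T n :=
  fun i => tmap (qP i) (qQ (n - i)) (AW w i).

Lemma AWq_linear n : linear (@AWq n).
Proof.
move=> a x y; apply: functional_extensionality_dep => i; rewrite /AWq /AW.
rewrite (tmap_linear (lin_comp (@front_linear _ P _ _) (@hcomp_linear _ _ P _ _))
  (lin_comp (@back_linear _ Q _ _) (@hcomp_linear _ _ Q _ _))).
by rewrite (tmap_linear (@qpi_linear _ _ _) (@qpi_linear _ _ _)).
Qed.

Lemma tget_AWq n (u : P n) (v : Q n) p q : (p + q = n)%N ->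
  tget (AWq (pure u v)) p q = front_back p q u v.
Proof.
move=> e; rewrite /tget /AWq /AW.
rewrite (tmapE (lin_comp (@front_linear _ P _ _) (@hcomp_linear _ _ P _ _))
  (lin_comp (@back_linear _ Q _ _) (@hcomp_linear _ _ Q _ _))).
rewrite (tmapE (@qpi_linear _ _ _) (@qpi_linear _ _ _)) -/(front_back _ _ u v).
have -> : (inord p : 'I_n.+1) = p :> nat by rewrite inordK //; lia.
by rewrite (_ : (n - p)%N = q) ?hcomp_id //; lia.
Qed.

Lemma front_back_front_eq0 n p q (u : P n) (v : Q n) a : (p + q = n)%N ->
  (a < p)%N -> is_degen a u -> front_back p q u v = 0.
Proof.
move=> e h hu; rewrite /front_back (@qpi_is_degen _ _ _ a) ?pure0l //.
by apply: is_degen_front => //; apply: is_degen_hcomp => //; rewrite addnC.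
Qed.

Lemma front_back_back_eq0 n p q (u : P n) (v : Q n) a : (p + q = n)%N ->
  (p <= a)%N -> is_degen a v -> front_back p q u v = 0.
Proof.
move=> e h hv; rewrite /front_back (@qpi_is_degen _ Q _ (a - p)) ?pure0r //.
by apply: is_degen_back => //; exact: is_degen_hcomp.
Qed.

(** For [s_a u (x) s_a v] in bidegree [(p, q)], the front face is degenerate if
    [a < p] and the back face is degenerate if [a >= p]. *)
Lemma AWq_degenerate n (w : cprod P Q n) : degenerate w -> AWq w = 0.
Proof.
case: n w => [//|n] w [a [ha [y ->]]].
apply: (tens_ext (f := fun y => AWq (degen (cprod P Q) n a y)) (g := fun=> 0)).
- by apply: (lin_comp (@AWq_linear _)) => b x z; rewrite linearP.
- by move=> b x z; rewrite scaler0 addr0.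
move=> u v; apply: tot_ext => p q e; rewrite /= tmap_pure tget_AWq //.
rewrite (lin0 (@tget_linear _ _ _ _ p q)).
have [h|h] := ltnP a p.
  by apply: front_back_front_eq0 h (is_degen_degen _ _).
by apply: front_back_back_eq0 h (is_degen_degen _ _).
Qed.

(** The chosen representative of a class may be replaced by any other one. *)
Lemma lin_qrepr (V W : lmodType k) (G : set V) (f : V -> W) :
  linear f -> (forall x, G x -> f x = 0) -> forall x, f (qrepr (qpi G x)) = f x.
Proof.
move=> hf h x; apply/eqP; rewrite -subr_eq0 -(linB hf).
apply/eqP; elim: (qreprP (G := G) x) => [y /h //||a y z _ hy _ hz].
  exact: lin0 hf.
by rewrite hf hy hz scaler0 addr0.
Qed.

Lemma nAW_qpi n (w : cprod P Q n) : nAW (qC n w) = AWq w.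
Proof. exact: (lin_qrepr (@AWq_linear n) (@AWq_degenerate n)). Qed.

Lemma nAW_linear n : linear (@nAW k P Q n).
Proof.
move=> a; elim/quot_ind => x; elim/quot_ind => y.
by rewrite -linearP !nAW_qpi AWq_linear.
Qed.

(** In bidegree [(p, q)] the faces [d_i] with [i <= p] act on the front factor and
    those with [i > p] on the back factor. *)
Lemma nAW_mb n (x : normalized (cprod P Q) n.+1) :
  mb (nAW x : T n.+1) = nAW (mb x).
Proof.
elim/quot_ind: x => w; rewrite mb_qpi !nAW_qpi.
apply: (tens_ext (f := fun w => tot_b (AWq w))
                 (g := fun w => AWq (hochschild (P := cprod P Q) w))) w.
- exact: (lin_comp (@tot_b_linear _ (normalized P) (normalized Q)
    (@mb_linear _ P) (@mb_linear _ Q) n) (@AWq_linear _)).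
- exact: lin_comp (@AWq_linear _) (@hochschild_linear _ (cprod P Q) n).
move=> u v; apply: tot_ext => p q e; subst n.
rewrite tget_tot_b //.
rewrite !tget_AWq ?addnS // /hochschild (lin_sum (@AWq_linear _)).
rewrite (lin_sum (@tget_linear _ _ _ _ p q)).
under [RHS]eq_bigr => i _.
  rewrite (linZ (@AWq_linear _)) (linZ (@tget_linear _ _ _ _ p q)) /= tmap_pure.
  rewrite tget_AWq //.
  over.
rewrite /front_back (tmapE (@mb_linear _ P p) lin_id) (tmapE lin_id (@mb_linear _ Q q)).
rewrite !mb_qpi /hochschild !qpi_sum pure_suml pure_sumr.
pose F0 := front (hcomp P (q.+1 + p)%N u).
pose F1 := front (hcomp P (q + p.+1)%N u).
pose B0 := back (hcomp Q (p + q.+1)%N v).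
pose B1 := back (hcomp Q (p.+1 + q)%N v).
transitivity (\sum_(i < p.+2) (-1) ^+ i *: pure (qP p (face P p i F1)) (qQ q B1)
    + (-1) ^+ p *: \sum_(j < q.+2) (-1) ^+ j *: pure (qP p F0) (qQ q (face Q q j B0))).
  congr (_ + _ *: _); apply: eq_bigr => i _; rewrite qpiZ.
    exact: pureZl.
  exact: pureZr.
apply: (alt_sum_glue (a := fun i => pure (qP p (face P p i F1)) (qQ q B1))
    (b := fun i => pure (qP p F0) (qQ q (face Q q i B0)))
    (c := fun i => pure (qP p (front (hcomp P (q + p) (face P (p + q) i u))))
       (qQ q (back (hcomp Q (p + q) (face Q (p + q) i v)))))) => [i hi|j hj|].
- rewrite (hcomp_face _ _ (addnC p q)) front_face_le; last exact: leqW.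
  rewrite hcomp_id back_face_le // hcomp_hcomp; last by rewrite addnC.
  by rewrite /F1 /B1 hcomp_id.
- rewrite (hcomp_face _ _ (addnC p q)) front_face_gt; try lia.
  rewrite hcomp_id back_face_ge; try lia.
by rewrite addKn /F0 /B0.
congr (pure (qP p _) (qQ q _)).
  rewrite /F1 /F0.
  have := @front_face_le _ P q p p.+1 (hcomp P (q + p).+1 u) (leqnn _).
  rewrite front_face_gt // ?ltnS ?leq_addl // => ->.
  by rewrite hcomp_hcomp // addnC.
have := @back_face_ge _ Q q p p v (leqnn _) (leqW (leq_addr _ _)).
by rewrite back_face_le // subnn /B1 /B0 hcomp_id => ->.
Qed.
End AlexanderWhitney.

(** * Shuffles and their signs *)

Section OddPerm.

Lemma lift_permP n (s : 'S_n.+1) : exists s' : 'S_n,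
  s = lift_perm ord_max (s ord_max) s'.
Proof.
set v := s ord_max.
have hne (i : 'I_n) : v != s (lift ord_max i).
  by rewrite (inj_eq perm_inj) neq_lift.
pose f (i : 'I_n) := odflt i (unlift v (s (lift ord_max i))).
have fK i : lift v (f i) = s (lift ord_max i).
  by rewrite /f; case: unliftP (hne i) => [j <- //|->]; rewrite eqxx.
have fI : injective f.
  by move=> i j e; apply: (@lift_inj _ ord_max); apply: (@perm_inj _ s); rewrite -!fK e.
exists (perm fI); apply/permP => i; case: (unliftP ord_max i) => [j ->|->].
  by rewrite lift_perm_lift permE fK.
by rewrite lift_perm_id.
Qed.

(** Removing the last index changes the sign of the permutation by the parity of
    its position plus that of its value, by [odd_lift_perm]. This value exceeds
    all the earlier values of the second block, so removing it leaves them
    unchanged; if the second block is empty, the last value is the largest one. *)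
Lemma odd_perm_two_blocks n p (s : 'S_n) :
  (forall i j : 'I_n, (i < j < p)%N -> (s i < s j)%N) ->
  (forall i j : 'I_n, (p <= i < j)%N -> (s i < s j)%N) ->
  odd_perm s = odd (\sum_(i < n | p <= i) (i + s i))%N.
Proof.
elim: n s => [|n ih] s h1 h2.
  have -> : s = 1%g by apply/permP => -[].
  by rewrite odd_perm1 big_ord0.
have [s' es] := lift_permP s; move: es; set v := s ord_max => es.
have sliftE (i : 'I_n) : s (lift ord_max i) = lift v (s' i) by rewrite es lift_perm_lift.
have lE (i : 'I_n) : lift ord_max i = i :> nat by rewrite /= /bump leqNgt ltn_ord.
have mono (i j : 'I_n) : (s (lift ord_max i) < s (lift ord_max j))%N = (s' i < s' j)%N.
  by rewrite !sliftE /= !ltnNge leq_bump2.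
have ih' : odd_perm s' = odd (\sum_(i < n | p <= i) (i + s' i))%N.
  by apply: ih => i j h; rewrite -mono; [apply: h1|apply: h2]; rewrite !lE.
rewrite es odd_lift_perm ih' -es [in RHS]big_mkcond [in RHS]big_ord_recr /= -[in RHS]big_mkcond /=.
have eqw (i : 'I_n) : widen_ord (leqnSn n) i = lift ord_max i.
  by apply: val_inj; rewrite /= /bump leqNgt ltn_ord.
have [hp|hp] := leqP p n.
  have -> : (\sum_(i < n | p <= i) (i + s (widen_ord (leqnSn n) i))
      = \sum_(i < n | p <= i) (i + s' i))%N.
    apply: eq_bigr => i hi; congr (_ + _)%N; rewrite eqw sliftE.
    have : (s (lift ord_max i) < v)%N by apply: h2; rewrite lE hi /= ltn_ord.
    by rewrite sliftE /= /bump; case: leqP => // /[swap]; lia.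
  by rewrite -/v oddD addbC oddD.
rewrite addn0 big_pred0 ?big_pred0 /= => [|i|i]; last 2 first.
- by apply/negbTE; move: (ltn_ord i); lia.
- by apply/negbTE; move: (ltn_ord i); lia.
have -> : v = ord_max; last by rewrite addbb.
apply: contraTeq (leqnn n) => hv.
pose j := (s^-1)%g ord_max.
have hj : (j < n)%N.
  rewrite ltn_neqAle -[(j <= n)%N]ltnS ltn_ord andbT; apply: contra hv => /eqP e.
  have ej : j = ord_max by exact: val_inj.
  by apply/eqP; rewrite /v -[X in s X]ej permKV.
have : (s j < s ord_max)%N by apply: h1; rewrite /= hj.
by rewrite {1}/j permKV /= ltnNge -ltnS ltn_ord.
Qed.

Lemma perm_of_seq n (l : seq nat) : uniq l -> size l = n ->
  (forall e, e \in l -> (e < n)%N) ->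
  exists s : 'S_n, forall i, s i = nth 0%N l i :> nat.
Proof.
move=> lu ls lb.
have hb (i : 'I_n) : (nth 0%N l i < n)%N by apply/lb/mem_nth; rewrite ls.
have fI : injective (fun i : 'I_n => Ordinal (hb i)).
  move=> i j /(congr1 val) /= /eqP; rewrite nth_uniq ?ls // => /eqP.
  exact: val_inj.
by exists (perm fI) => i; rewrite permE.
Qed.
End OddPerm.

Section Shuffles.
Context (p q : nat).
Implicit Type s : 'S_(p + q).

Definition mus s := [seq (s (lshift q i) : nat) | i <- enum 'I_p].
Definition nus s := [seq (s (rshift p i) : nat) | i <- enum 'I_q].

Lemma size_mus s : size (mus s) = p. Proof. by rewrite size_map size_enum_ord. Qed.
Lemma size_nus s : size (nus s) = q. Proof. by rewrite size_map size_enum_ord. Qed.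

Lemma shuffle_muE s (i : 'I_p) : shuffle_mu s i = s (lshift q i).
Proof. by rewrite /shuffle_mu (nth_map i) ?size_enum_ord // nth_ord_enum. Qed.
Lemma shuffle_nuE s (i : 'I_q) : shuffle_nu s i = s (rshift p i).
Proof. by rewrite /shuffle_nu (nth_map i) ?size_enum_ord // nth_ord_enum. Qed.

Lemma sorted_ord_map m (f : 'I_m -> nat) :
  (forall i j : 'I_m, (i < j)%N -> (f i < f j)%N) ->
  sorted ltn [seq f i | i <- enum 'I_m].
Proof.
move=> h; rewrite sorted_map.
have : sorted (relpre val ltn) (enum 'I_m).
  by rewrite -sorted_map val_enum_ord iota_ltn_sorted.
by apply: sub_sorted => i j; exact: h.
Qed.

Lemma shuffleP s : reflect
  ((forall i j : 'I_p, (i < j)%N -> (s (lshift q i) < s (lshift q j))%N)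
   /\ (forall i j : 'I_q, (i < j)%N -> (s (rshift p i) < s (rshift p j))%N))
  (is_shuffle s).
Proof.
apply: (iffP andP) => -[h1 h2]; split.
- by move=> i j; move/forallP/(_ i)/forallP/(_ j)/implyP: h1.
- by move=> i j; move/forallP/(_ i)/forallP/(_ j)/implyP: h2.
- by apply/forallP => i; apply/forallP => j; apply/implyP; exact: h1.
- by apply/forallP => i; apply/forallP => j; apply/implyP; exact: h2.
Qed.

Lemma sorted_mus s : is_shuffle s -> sorted ltn (mus s).
Proof. by move=> /shuffleP[h _]; exact: sorted_ord_map. Qed.
Lemma sorted_nus s : is_shuffle s -> sorted ltn (nus s).
Proof. by move=> /shuffleP[_ h]; exact: sorted_ord_map. Qed.

Lemma mem_mus s e : e \in mus s -> (e < p + q)%N.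
Proof. by case/mapP => i _ ->. Qed.
Lemma mem_nus s e : e \in nus s -> (e < p + q)%N.
Proof. by case/mapP => i _ ->. Qed.

Lemma mem_musP s e : reflect (exists2 a, (a < p)%N & e = shuffle_mu s a) (e \in mus s).
Proof.
apply: (iffP mapP) => [[i _ ->]|[a ha ->]].
  by exists i => //; rewrite shuffle_muE.
by exists (Ordinal ha); rewrite ?mem_enum // -shuffle_muE.
Qed.
Lemma mem_nusP s e : reflect (exists2 a, (a < q)%N & e = shuffle_nu s a) (e \in nus s).
Proof.
apply: (iffP mapP) => [[i _ ->]|[a ha ->]].
  by exists i => //; rewrite shuffle_nuE.
by exists (Ordinal ha); rewrite ?mem_enum // -shuffle_nuE.
Qed.

Lemma mem_mus_nus s e : (e < p + q)%N -> (e \in mus s) = (e \notin nus s).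
Proof.
move=> he; apply/idP/idP => [/mapP[i _ ->]|].
  apply/negP => /mapP[j _ /val_inj/perm_inj/eqP].
  by rewrite eq_lrshift.
have [i ->] : exists i, e = s i by exists ((s^-1)%g (Ordinal he)); rewrite permKV.
case: (split_ordP i) => j ->; first by move=> _; apply: map_f; rewrite mem_enum.
by move=> /negP[]; apply: map_f; rewrite mem_enum.
Qed.

Lemma shuffle_eq s s' : mus s = mus s' -> nus s = nus s' -> s = s'.
Proof.
move=> h1 h2; apply/permP => i; apply: val_inj; case: (split_ordP i) => j ->.
  by rewrite /= -!shuffle_muE /shuffle_mu -!/(mus _) h1.
by rewrite /= -!shuffle_nuE /shuffle_nu -!/(nus _) h2.
Qed.

Lemma shuffle_of_seqs l1 l2 : size l1 = p -> size l2 = q ->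
  sorted ltn l1 -> sorted ltn l2 -> uniq (l1 ++ l2) ->
  (forall e, e \in l1 ++ l2 -> (e < p + q)%N) ->
  exists s, [/\ is_shuffle s, mus s = l1 & nus s = l2].
Proof.
move=> h1 h2 s1 s2 u b.
have [|s hs] := perm_of_seq u _ b; first by rewrite size_cat h1 h2.
have hl (i : 'I_p) : s (lshift q i) = nth 0%N l1 i :> nat.
  by rewrite hs nth_cat h1 /= ltn_ord.
have hr (i : 'I_q) : s (rshift p i) = nth 0%N l2 i :> nat.
  by rewrite hs nth_cat h1 /= ltnNge leq_addr addKn.
exists s; split.
- apply/shuffleP; split=> i j h; rewrite ?hl ?hr.
    by apply: (sorted_ltn_nth ltn_trans) => //; rewrite inE h1.
  by apply: (sorted_ltn_nth ltn_trans) => //; rewrite inE h2.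
- apply: (@eq_from_nth _ 0%N) => [|a ha]; first by rewrite size_mus.
  rewrite size_mus in ha.
  by rewrite -/(shuffle_mu s a) (shuffle_muE s (Ordinal ha)) hl.
- apply: (@eq_from_nth _ 0%N) => [|a ha]; first by rewrite size_nus.
  rewrite size_nus in ha.
  by rewrite -/(shuffle_nu s a) (shuffle_nuE s (Ordinal ha)) hr.
Qed.

Lemma shuffle_sign s : is_shuffle s ->
  odd_perm s = odd (\sum_(b < q) (p + b + shuffle_nu s b))%N.
Proof.
move=> /shuffleP[h1 h2].
rewrite (@odd_perm_two_blocks _ p) => [|i j|i j].
- rewrite big_split_ord /= big_pred0 ?add0n => [|i]; last first.
    by apply/negbTE; rewrite -ltnNge ltn_ord.
  congr odd; apply: eq_big => [i|i _]; first by rewrite leq_addr.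
  by rewrite shuffle_nuE.
- case: (split_ordP i) => i1 ->; case: (split_ordP j) => j1 -> /andP[] /=;
    try by move: (ltn_ord i1) (ltn_ord j1); lia.
  by move=> h _; exact: h1.
- case: (split_ordP i) => i1 ->; case: (split_ordP j) => j1 -> /andP[] /=;
    try by move: (ltn_ord i1) (ltn_ord j1); lia.
  by move=> _; rewrite ltn_add2l; exact: h2.
Qed.
End Shuffles.

(** Two complementary increasing sequences are determined by the set of values
    of one of them. *)
Lemma sorted_block n c m (l1 l2 : seq nat) : sorted ltn l1 -> sorted ltn l2 ->
  (forall e, e \in l1 -> (e < n)%N) -> (forall e, e \in l2 -> (e < n)%N) ->
  (forall e, (e < n)%N -> (e \in l1) = (e \notin l2)) ->
  (c + m <= n)%N ->
  (forall e, e \in l1 -> (c <= e < c + m)%N) ->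
  (forall e, e \in l2 -> ~~ (c <= e < c + m)%N) ->
  l1 = iota c m /\ l2 = iota 0 c ++ iota (c + m) (n - (c + m)).
Proof.
move=> s1 s2 b1 b2 h12 hcm h1 h2.
have e1 e : (e \in l1) = (c <= e < c + m)%N.
  apply/idP/idP => [/h1 //|h]; rewrite h12; last lia.
  by apply/negP => /h2; rewrite h.
split; apply: (irr_sorted_eq ltn_trans ltnn) => //; try exact: iota_ltn_sorted.
- by move=> e; rewrite e1 mem_iota.
- rewrite (sorted_pairwise ltn_trans) pairwise_cat -!(sorted_pairwise ltn_trans).
  rewrite !iota_ltn_sorted !andbT; apply/allrelP => x y; rewrite !mem_iota; lia.
move=> e; rewrite mem_cat !mem_iota; have [he|he] := ltnP e n.
  by have := h12 e he; rewrite e1 => /(congr1 negb); rewrite negbK => <-; lia.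
have -> : (e \in l2) = false by apply/negP => /b2; lia.
lia.
Qed.

(** * The shuffle map on normalized complexes *)

Section Increasing.
Context (f : nat -> nat) (r : nat).
Hypothesis f_incr : forall a b, (a < b < r)%N -> (f a < f b)%N.

Lemma incr_step a d : (a + d < r)%N -> (f a + d <= f (a + d))%N.
Proof.
elim: d => [|d ih] h; first by rewrite !addn0.
rewrite !addnS; apply: leq_ltn_trans (ih _) (f_incr _); lia.
Qed.

Lemma incr_lower c a : (a < r)%N -> (c <= f 0)%N -> (c + a <= f a)%N.
Proof. by move=> h; have := @incr_step 0%N a; rewrite add0n => /(_ h); lia. Qed.

Lemma incr_upper n a : (forall b, (b < r)%N -> (f b < n + r)%N) ->
  (a < r)%N -> (f a <= n + a)%N.
Proof.
move=> hb h; have h1 : (r.-1 < r)%N by lia.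
have := hb _ h1; have := @incr_step a (r.-1 - a).
rewrite subnKC; last lia.
by move=> /(_ h1); lia.
Qed.
End Increasing.

Section ShuffleValues.
Context (p q : nat) (s : 'S_(p + q)) (hs : is_shuffle s).
Lemma shuffle_mu_incr a b : (a < b < p)%N -> (shuffle_mu s a < shuffle_mu s b)%N.
Proof.
move=> /andP[h hb]; have ha : (a < p)%N by lia.
rewrite (shuffle_muE s (Ordinal ha)) (shuffle_muE s (Ordinal hb)).
by case/shuffleP: hs => h1 _; exact: h1.
Qed.
Lemma shuffle_nu_incr a b : (a < b < q)%N -> (shuffle_nu s a < shuffle_nu s b)%N.
Proof.
move=> /andP[h hb]; have ha : (a < q)%N by lia.
rewrite (shuffle_nuE s (Ordinal ha)) (shuffle_nuE s (Ordinal hb)).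
by case/shuffleP: hs => _ h1; exact: h1.
Qed.
Lemma shuffle_mu_lt a : (a < p)%N -> (shuffle_mu s a < p + q)%N.
Proof. by move=> h; rewrite (shuffle_muE s (Ordinal h)) ltn_ord. Qed.
Lemma shuffle_nu_lt a : (a < q)%N -> (shuffle_nu s a < p + q)%N.
Proof. by move=> h; rewrite (shuffle_nuE s (Ordinal h)) ltn_ord. Qed.
Lemma shuffle_mu_le a : (a < p)%N -> (shuffle_mu s a <= q + a)%N.
Proof.
apply: (incr_upper shuffle_mu_incr) => b hb.
by rewrite addnC; exact: shuffle_mu_lt.
Qed.
Lemma shuffle_nu_le a : (a < q)%N -> (shuffle_nu s a <= p + a)%N.
Proof. by apply: (incr_upper shuffle_nu_incr) => b hb; exact: shuffle_nu_lt. Qed.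
End ShuffleValues.

Section Degens.
Context {k : comPzRingType} (P : cyclicModule k) (f : nat -> nat).

Lemma is_degen_degens r n (x : P n) b :
  (forall a b, (a < b < r)%N -> (f a < f b)%N) ->
  (forall a, (a < r)%N -> (f a <= n + a)%N) ->
  (b < r)%N -> is_degen (f b) (degens f r x).
Proof.
elim: r => [//|r ih] hi hb; rewrite ltnS leq_eqVlt => /orP[/eqP -> /=|h /=].
  by apply: is_degen_degen; rewrite addnC hb.
apply: is_degen_degen_gt; first by apply: hi; rewrite h ltnSn.
  by rewrite addnC hb.
by apply: ih => // [a c h'|a h']; [apply: hi|apply: hb]; lia.
Qed.

(** A degeneracy of index [c] of [x] becomes, after the degeneracies [f 0 < f 1 <
    ...], one of an index that is none of the [f a]. For a shuffle this index
    occurs among the complementary degeneracies, so that both tensor factors are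
    degenerate at the same index. *)
Lemma is_degen_degens_in r n (x : P n) c :
  (forall a b, (a < b < r)%N -> (f a < f b)%N) ->
  (forall a, (a < r)%N -> (f a <= n + a)%N) ->
  is_degen c x -> exists2 c', is_degen c' (degens f r x) & forall a, (a < r)%N -> f a != c'.
Proof.
move=> hi hb hx; elim: r hi hb => [|r ih] hi hb; first by exists c.
have [|a h'|c' h1 h2] := ih; first by move=> a b h'; apply: hi; lia.
  by apply: hb; lia.
have [h|h] := ltnP c' (f r).
  exists c'; first by apply: (is_degen_degen_gt h _ h1); rewrite addnC; exact: hb. 
  by move=> a; rewrite ltnS leq_eqVlt => /orP[/eqP ->|/h2 //]; lia.
exists c'.+1; first exact: is_degen_degen_le.
move=> a; rewrite ltnS leq_eqVlt => /orP[/eqP ->|ha]; first lia.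
by have := hi a r; rewrite ha ltnSn => /(_ isT); lia.
Qed.

Lemma front_degens r n (x : P n) :
  (forall a, (a < r)%N -> (n <= f a <= n + a)%N) -> front (degens f r x) = x.
Proof.
elim: r => [//|r ih] h; have /andP[h1 h2] := h r (ltnSn r).
rewrite front_degen //; last by rewrite addnC.
by apply: ih => a ha; apply: h; lia.
Qed.

Lemma back_degens r n (x : P n) :
  (forall a, (a < r)%N -> (f a <= a)%N) -> back (degens f r x) = x.
Proof.
elim: r => [//|r ih] h; rewrite back_degen ?h //; apply: ih => a ha; apply: h; lia.
Qed.
End Degens.

Section Sh.
Context {k : comPzRingType} (P Q : cyclicModule k).
Local Notation qP n := (qpi (@degenerate k P n)).
Local Notation qQ n := (qpi (@degenerate k Q n)).
Local Notation qC n := (qpi (@degenerate k (cprod P Q) n)).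
Local Notation T n := (tensMixed (normalized P) (normalized Q) n).
Local Notation C := (normalized (cprod P Q)).

Lemma is_degen_pure n c (u : P n) (v : Q n) :
  is_degen c u -> is_degen c v -> is_degen (P := cprod P Q) c (pure u v).
Proof.
case: n u v => [//|n] u v [hc [u' ->]] [_ [v' ->]]; split=> //.
by exists (pure u' v'); rewrite /= tmap_pure.
Qed.

Definition shuffle_l p q (s : 'S_(p + q)) (x : P p) : P (p + q)%N :=
  hcomp P (p + q)%N (degens (shuffle_nu s) q x).
Definition shuffle_r p q (s : 'S_(p + q)) (y : Q q) : Q (p + q)%N :=
  degens (shuffle_mu s) p y.

Lemma shuffleE p q (x : P p) (y : Q q) : shuffle x y =
  \sum_(s : 'S_(p + q) | is_shuffle s)
    (-1) ^+ s *: pure (shuffle_l s x) (shuffle_r s y).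
Proof. by []. Qed.

Lemma shuffle_l_linear p q (s : 'S_(p + q)) : linear (shuffle_l s).
Proof. exact: (lin_comp (@hcomp_linear _ _ P _ _) (@degens_linear _ P _ _ _)). Qed.
Lemma shuffle_r_linear p q (s : 'S_(p + q)) : linear (shuffle_r s).
Proof. exact: degens_linear. Qed.

Lemma shuffle_linearl p q (y : Q q) : linear (fun x : P p => shuffle x y).
Proof.
apply: lin_bigsum => s; apply: lin_scale.
exact: (lin_comp (pure_linearl _) (shuffle_l_linear s)).
Qed.
Lemma shuffle_linearr p q (x : P p) : linear (fun y : Q q => shuffle x y).
Proof.
apply: lin_bigsum => s; apply: lin_scale.
exact: (lin_comp (pure_linearr _) (shuffle_r_linear s)).
Qed.

Lemma is_degen_shuffle_l p q (s : 'S_(p + q)) (x : P p) b : is_shuffle s ->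
  (b < q)%N -> is_degen (shuffle_nu s b) (shuffle_l s x).
Proof.
move=> hs hb; apply: is_degen_hcomp; first exact: addnC.
by apply: is_degen_degens => //; [exact: shuffle_nu_incr|move=> a; exact: shuffle_nu_le].
Qed.
Lemma is_degen_shuffle_r p q (s : 'S_(p + q)) (y : Q q) b : is_shuffle s ->
  (b < p)%N -> is_degen (shuffle_mu s b) (shuffle_r s y).
Proof.
move=> hs hb.
by apply: is_degen_degens => //; [exact: shuffle_mu_incr|move=> a; exact: shuffle_mu_le].
Qed.

Lemma is_degen_lt n c (R : cyclicModule k) (z : R n) : is_degen c z -> (c < n)%N.
Proof. by case: n z => [//|n] z []. Qed.

(** Each summand is a degeneracy of the product, by [is_degen_degens_in]. *)
Lemma shuffle_degenl p q (x : P p) (y : Q q) : degenerate x -> qC _ (shuffle x y) = 0.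
Proof.
move=> /degenerate_is_degen[c hx]; rewrite shuffleE qpi_sum big1 // => s hs; rewrite qpiZ.
have [c' h1 h2] := is_degen_degens_in (shuffle_nu_incr hs)
  (fun a => shuffle_nu_le hs (a := a)) hx.
have h1' : is_degen c' (shuffle_l s x) by apply: is_degen_hcomp; first exact: addnC.
have := mem_mus_nus s (is_degen_lt h1').
have -> : (c' \notin nus s) by apply/mem_nusP => -[a /h2/eqP + e]; rewrite e.
move=> /mem_musP[a ha e]; subst c'.
by rewrite (qpi_is_degen (is_degen_pure h1' (is_degen_shuffle_r _ _ _))) ?scaler0.
Qed.

Lemma shuffle_degenr p q (x : P p) (y : Q q) : degenerate y -> qC _ (shuffle x y) = 0.
Proof.
move=> /degenerate_is_degen[c hy]; rewrite shuffleE qpi_sum big1 // => s hs; rewrite qpiZ.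
have [c' h1 h2] := is_degen_degens_in (shuffle_mu_incr hs)
  (fun a => shuffle_mu_le hs (a := a)) hy.
have := mem_mus_nus s (is_degen_lt h1).
have -> : (c' \in mus s) = false by apply/mem_musP => -[a /h2/eqP + e]; rewrite e.
move=> /esym/negbFE/mem_nusP[a ha e]; subst c'.
by rewrite (qpi_is_degen (is_degen_pure (is_degen_shuffle_l _ _ _) h1)) ?scaler0.
Qed.

(** The bilinear map on normalized complexes from which [nsh] is built. *)
Definition nshuffle p q (x : normalized P p) (y : normalized Q q) : C (p + q)%N :=
  qC (p + q)%N (shuffle (qrepr x) (qrepr y)).

Lemma nshuffleE p q (x : P p) (y : Q q) :
  nshuffle (qP p x) (qQ q y) = qC (p + q)%N (shuffle x y).
Proof.
rewrite /nshuffle.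
rewrite (lin_qrepr (f := fun x => qC (p + q) (shuffle x (qrepr (qQ q y))))).
- apply: (lin_qrepr (f := fun y => qC (p + q) (shuffle x y))) => [|z].
    exact: lin_comp (@qpi_linear _ _ _) (@shuffle_linearr p q x).
  exact: shuffle_degenr.
- exact: lin_comp (@qpi_linear _ _ _) (@shuffle_linearl p q _).
by move=> z; exact: shuffle_degenl.
Qed.

Lemma nshuffle_linearl p q (y : normalized Q q) : linear (fun x : normalized P p => nshuffle x y).
Proof.
elim/quot_ind: y => y a; elim/quot_ind => x; elim/quot_ind => x'.
by rewrite -qpi_linear !nshuffleE shuffle_linearl qpi_linear.
Qed.
Lemma nshuffle_linearr p q (x : normalized P p) : linear (fun y : normalized Q q => nshuffle x y).
Proof.
elim/quot_ind: x => x a; elim/quot_ind => y; elim/quot_ind => y'.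
by rewrite -qpi_linear !nshuffleE shuffle_linearr qpi_linear.
Qed.

Lemma nsh_linear n : linear (@nsh k P Q n).
Proof.
apply: lin_bigsum => p a x y /=.
rewrite (tlift_is_linear (@nshuffle_linearl p (n - p)) (@nshuffle_linearr p (n - p))).
by rewrite hcomp_linear.
Qed.

Lemma nsh_tinj n p q (x : P p) (y : Q q) : (p + q = n)%N ->
  nsh (tin n (pure (qP p x) (qQ q y))) = hcomp C n (qC (p + q)%N (shuffle x y)).
Proof.
move=> e; have hp : (p < n.+1)%N by lia.
have lift0 p' q' : tlift (@nshuffle p' q') 0 = 0.
  exact: (lin0 (tlift_is_linear (@nshuffle_linearl p' q') (@nshuffle_linearr p' q'))).
rewrite /nsh (bigD1 (Ordinal hp)) //= big1 ?addr0 => [|i].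
  have : (n - p)%N = q by lia.
  rewrite /tinj /=; move: (n - p)%N => q' e'; subst q'; rewrite hcomp_id.
  by rewrite (tlift_pure (@nshuffle_linearl p q) (@nshuffle_linearr p q)) nshuffleE.
rewrite -val_eqE /= => /eqP h.
have ne : (p, q) <> (i : nat, n - i)%N by case=> e1 _; apply: h.
by rewrite /tinj (hcomp_neq _ ne) lift0 hcomp0.
Qed.

Lemma sum_shuffle_single (V : lmodType k) p q (F : 'S_(p + q) -> V) s0 :
  is_shuffle s0 -> (forall s, is_shuffle s -> s != s0 -> F s = 0) ->
  \sum_(s : 'S_(p + q) | is_shuffle s) (-1) ^+ s *: F s = (-1) ^+ s0 *: F s0.
Proof.
move=> h0 h; rewrite (bigD1 s0) //= big1 ?addr0 // => s /andP[hs ne].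
by rewrite h ?scaler0.
Qed.

Lemma id_shuffle p q : is_shuffle (1%g : 'S_(p + q)).
Proof. by apply/shuffleP; split=> i j h; rewrite !perm1 /= ?ltn_add2l. Qed.

(** If [i < p] the largest [mu] is at least [i] and the back face is degenerate,
    and if [i > p] the smallest [nu] is less than [i] and the front face is
    degenerate. If [i = p], the same argument leaves only the shuffle with
    [nu = (p, p+1, ...)] and [mu = (0, 1, ...)]. *)
Lemma front_back_shuffle_neq p q (s : 'S_(p + q)) (x : P p) (y : Q q) i j : is_shuffle s ->
  (i + j = p + q)%N -> i != p \/ s != 1%g -> front_back i j (shuffle_l s x) (shuffle_r s y) = 0.
Proof.
move=> hs e hne.
have [[hq hn]|hn] : (0 < q /\ shuffle_nu s 0 < i)%N \/ (q = 0 \/ i <= shuffle_nu s 0)%N.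
- by case: posnP => hq; [right; left|case: (leqP i (shuffle_nu s 0)) => h; [right; right|left]].
- by apply: (front_back_front_eq0 _ e hn); exact: is_degen_shuffle_l.
have [[hp hm]|hm] : (0 < p /\ i <= shuffle_mu s p.-1)%N \/ (p = 0 \/ shuffle_mu s p.-1 < i)%N.
- by case: posnP => hp; [right; left|case: (leqP i (shuffle_mu s p.-1)) => h; [left|right; right]].
- by apply: (front_back_back_eq0 _ e hm); apply: is_degen_shuffle_r => //; lia.
have ip : i = p.
  have h1 : (i <= p)%N.
    case: hn => [hq|hn]; first lia.
    case: (posnP q) => hq; first lia.
    by have := shuffle_nu_le hs hq; lia.
  case: hm => [hp|hm]; first lia.
  case: (posnP p) => hp; first lia.
  have := incr_lower (shuffle_mu_incr hs) (c := 0) (a := p.-1); lia.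
subst i.
case: hne => [/eqP //|]; case/eqP; apply/permP => i; apply: val_inj.
rewrite perm1; case: (split_ordP i) => a ->.
  rewrite /= -shuffle_muE; move: (ltn_ord a) => ha.
  have h1 := incr_lower (shuffle_mu_incr hs) (c := 0) ha (leq0n _).
  have := incr_step (shuffle_mu_incr hs) (a := a) (d := p.-1 - a).
  by rewrite subnKC; lia.
rewrite /= -shuffle_nuE; move: (ltn_ord a) => ha.
have h1 := shuffle_nu_le hs ha.
have := incr_lower (shuffle_nu_incr hs) (c := p) ha; lia.
Qed.

Lemma front_back_shuffle_id p q (x : P p) (y : Q q) :
  front_back p q (shuffle_l 1%g x) (shuffle_r 1%g y) = pure (qP p x) (qQ q y).
Proof.
rewrite /front_back /shuffle_l /shuffle_r hcomp_hcompr 1?addnC // !hcomp_id.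
rewrite front_degens => [|a ha]; last first.
  by rewrite (shuffle_nuE _ (Ordinal ha)) perm1 /= leq_addr leqnn.
by rewrite back_degens // => a ha; rewrite (shuffle_muE _ (Ordinal ha)) perm1.
Qed.

Lemma nAW_nsh n (z : T n) : nAW (nsh z) = z.
Proof.
apply: (tot_lin_ext (f := fun z => nAW (nsh z)) (g := id)) z.
- exact: lin_comp (@nAW_linear _ P Q n) (@nsh_linear n).
- exact: lin_id.
move=> p q; elim/quot_ind => x; elim/quot_ind => y e; subst n.
rewrite nsh_tinj // hcomp_id nAW_qpi shuffleE (lin_sum (@AWq_linear _ P Q _)).
apply: tot_ext => i j e; rewrite (lin_sum (@tget_linear _ _ _ _ i j)).
under eq_bigr => s hs.
  rewrite (linZ (@AWq_linear _ P Q _)) (linZ (@tget_linear _ _ _ _ i j)).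
  rewrite tget_AWq //.
  over.
rewrite (sum_shuffle_single (id_shuffle p q)) => [|s hs ne]; last first.
  by apply: front_back_shuffle_neq => //; right.
rewrite odd_perm1 expr0 scale1r tget_tinj //.
have [ip|ne] := eqVneq i p.
  subst i; have ej : j = q by lia.
  by subst j; rewrite hcomp_id front_back_shuffle_id.
rewrite hcomp_neq; last by case=> h _; rewrite h eqxx in ne.
by apply: front_back_shuffle_neq => //; [exact: id_shuffle|left].
Qed.
End Sh.

(** * The operator B seen through the shuffle and Alexander-Whitney maps *)

(** The index of the degeneracy into which [e t^j] transforms one of index [a] in
    degree [n]: the residue of [a + j + 1] modulo [n + 1]. It is never [j], the
    place of the step from the last vertex to the first. *)
Definition rot_pos n j a : nat := if (a + j < n)%N then (a + j).+1 else (a + j - n)%N.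

Lemma is_degen_ext_rot (k : comPzRingType) (P : cyclicModule k) n j a (z : P n) :
  (j <= n)%N -> is_degen a z -> is_degen (rot_pos n j a) (ext_rot j z).
Proof.
rewrite /rot_pos => hj h; case: ltnP => h'; first exact: is_degen_ext_rot_lt.
exact: is_degen_ext_rot_ge.
Qed.

Section Block.
Context (n c m : nat).
Hypothesis hcm : (c + m <= n)%N.
(** The complement of the interval [[c, c + m)] in [[0, n)], in increasing order. *)
Definition block_compl := iota 0 c ++ iota (c + m) (n - (c + m)).

Lemma sorted_block_compl : sorted ltn block_compl.
Proof.
rewrite (sorted_pairwise ltn_trans) pairwise_cat -!(sorted_pairwise ltn_trans).
by rewrite !iota_ltn_sorted !andbT; apply/allrelP => x y; rewrite !mem_iota; lia.
Qed.

Lemma uniq_block : uniq (iota c m ++ block_compl).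
Proof.
rewrite cat_uniq iota_uniq (sorted_uniq ltn_trans ltnn sorted_block_compl) andbT /=.
by apply/hasPn => e; rewrite mem_cat !mem_iota; lia.
Qed.

Lemma mem_block e : e \in iota c m ++ block_compl -> (e < n)%N.
Proof. by rewrite !mem_cat !mem_iota; lia. Qed.

Lemma size_block_compl : size block_compl = (n - m)%N.
Proof. by rewrite size_cat !size_iota; lia. Qed.

Lemma nth_block_compl b : (b < n - m)%N ->
  nth 0%N block_compl b = if (b < c)%N then b else (b + m)%N.
Proof.
move=> h; rewrite nth_cat size_iota; case: ltnP => h'; rewrite nth_iota ?add0n //; lia.
Qed.
End Block.

Lemma odd_sum_shift q c p : (c <= q)%N ->
  odd (\sum_(b < q) (p + b + (if b < c then b : nat else b + p)))%N = odd (p * c)%N.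
Proof.
move=> h; pose g (b : 'I_q) : nat := if (b < c)%N then p else 0%N.
have -> : (\sum_(b < q) (p + b + (if b < c then b : nat else b + p))
    = \sum_(b < q) g b + \sum_(b < q) (b + (if (b < c)%N then 0 else p)).*2)%N.
  by rewrite -big_split /=; apply: eq_bigr => b _; rewrite /g; case: ifP; lia.
have -> : (\sum_(b < q) (b + (if (b < c)%N then 0 else p)).*2
  = (\sum_(b < q) (b + (if (b < c)%N then 0 else p))).*2)%N.
  by rewrite (big_morph _ doubleD double0).
rewrite oddD odd_double addbF /g -big_mkcond.
rewrite -(big_ord_widen q (fun=> p) h) sum_nat_const card_ord mulnC.
by [].
Qed.

Lemma odd_sum_block q c p :
  odd (\sum_(b < q) (p + b + (c + b)))%N = odd (q * (p + c))%N.
Proof.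
have -> : (\sum_(b < q) (p + b + (c + b)) = \sum_(b < q) (p + c) + \sum_(b < q) b.*2)%N.
  by rewrite -big_split /=; apply: eq_bigr => b _; lia.
have -> : (\sum_(b < q) b.*2 = (\sum_(b < q) b).*2)%N.
  by rewrite (big_morph _ doubleD double0).
by rewrite oddD odd_double addbF sum_nat_const card_ord.
Qed.

(** The shuffles that contribute the terms of [x (x) B y]. *)
Lemma block_mu_shuffle p q c : (c <= q)%N ->
  exists s : 'S_(p + q), [/\ is_shuffle s, mus s = iota c p,
    nus s = block_compl (p + q) c p & odd_perm s = odd (p * c)].
Proof.
move=> hc; have h : (c + p <= p + q)%N by lia.
have [||||||s [h1 h2 h3]] := @shuffle_of_seqs p q (iota c p) (block_compl (p + q) c p).
- exact: size_iota.
- by rewrite size_block_compl // addKn.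
- exact: iota_ltn_sorted.
- exact: sorted_block_compl.
- exact: uniq_block.
- by move=> e; exact: mem_block.
exists s; split=> //; rewrite shuffle_sign // -(odd_sum_shift _ hc); congr odd.
apply: eq_bigr => b _; congr (_ + _)%N; rewrite /shuffle_nu -/(nus s) h3.
by rewrite nth_block_compl // addKn.
Qed.

(** The shuffles that contribute the terms of [B x (x) y]. *)
Lemma block_nu_shuffle p q c : (c <= p)%N ->
  exists s : 'S_(p + q), [/\ is_shuffle s, nus s = iota c q,
    mus s = block_compl (p + q) c q & odd_perm s = odd (q * (p + c))].
Proof.
move=> hc; have h : (c + q <= p + q)%N by lia.
have [||||||s [h1 h2 h3]] := @shuffle_of_seqs p q (block_compl (p + q) c q) (iota c q).
- by rewrite size_block_compl // addnK.
- exact: size_iota.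
- exact: sorted_block_compl.
- exact: iota_ltn_sorted.
- by rewrite uniq_catC uniq_block.
- by move=> e; rewrite mem_cat orbC -mem_cat; exact: mem_block.
exists s; split=> //; rewrite shuffle_sign // -odd_sum_block; congr odd.
apply: eq_bigr => b _; congr (_ + _)%N; rewrite /shuffle_nu -/(nus s) h3.
by rewrite nth_iota.
Qed.

Section Rotated.
Context {k : comPzRingType} (P : cyclicModule k).

Lemma hcomp_ext_rot j n m (x : P n) :
  hcomp P m.+1 (ext_rot j x) = ext_rot j (hcomp P m x).
Proof.
exact: (hcomp_map (g := S) (F := @ext_rot k P j) succn_inj (@ext_rot_linear k P j)).
Qed.

Lemma degensS f r n (x : P n) :
  degens f r.+1 x = degen P (r + n) (f r) (degens f r x).
Proof. by []. Qed.

(** Each degeneracy beyond the interval of the [mu] absorbs one rotation and is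
    cancelled by a face; what remains is the last face of [e t^p x], which is
    [t^(p+1) x = x]. *)
Lemma front_ext_rot_degens p c (f : nat -> nat) r (x : P p) :
  (forall a, (a < r)%N -> f a = if (a < c)%N then a else (a + p)%N) ->
  front (r := r.+1) (ext_rot (p + (r - c)) (degens f r x)) = x.
Proof.
elim: r => [|r ih] hf.
  rewrite /= addn0 /ext_rot face_last_ext -rotS; exact: rot_order.
have ih' := ih (fun a ha => hf a (ltnW ha)).
rewrite -[RHS]ih' degensS hf //; case: ltnP => h.
  have e0 : (r.+1 - c = 0)%N by lia.
  have e1 : (r - c = 0)%N by lia.
  rewrite e0 e1 (@ext_rot_degen_lt _ P _ (r + p)) ?addn0 //.
  by rewrite (@front_degen _ P r.+1) //; lia.
rewrite (@ext_rot_degen_ge _ P _ (r + p)); try lia.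
rewrite (@front_degen _ P r.+1); try lia.
by congr (@front _ P r.+1 p (@ext_rot _ P _ (r + p) _)); lia.
Qed.

Lemma back_ext_rot_degens_block q c (f : nat -> nat) r (y : P q) : (c <= q)%N ->
  (forall a, (a < r)%N -> f a = (c + a)%N) ->
  back (hcomp P (r + q.+1)%N (ext_rot (r + (q - c)) (degens f r y))) = ext_rot (q - c) y.
Proof.
move=> hc; elim: r => [|r ih] hf; first by rewrite hcomp_id.
have ih' := ih (fun a ha => hf a (ltnW ha)).
rewrite -[RHS]ih' degensS hf //.
rewrite (@ext_rot_degen_ge _ P _ (r + q)); try lia.
rewrite (@hcomp_degen _ P _ (r + q.+1)) back_degen; last lia.
by congr (@back _ P r q.+1 (hcomp P _ (@ext_rot _ P _ (r + q) _))); lia.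
Qed.

Lemma front_ext_rot_degens_block p c j (f : nat -> nat) r (x : P p) : (c + j = p)%N ->
  (forall a, (a < r)%N -> f a = (c + a)%N) ->
  front (hcomp P (r + p.+1)%N (ext_rot j (degens f r x))) = ext_rot j x.
Proof.
move=> hc; elim: r => [|r ih] hf; first by rewrite hcomp_id.
have ih' := ih (fun a ha => hf a (ltnW ha)).
rewrite -[RHS]ih' degensS hf //.
rewrite (@ext_rot_degen_lt _ P _ (r + p)); last lia.
by rewrite (@hcomp_degen _ P _ (r + p.+1)) front_degen //; lia.
Qed.

Lemma back_ext_rot_degens q c (f : nat -> nat) r (y : P q) :
  (forall a, (a < r)%N -> f a = if (a < c)%N then a else (a + q)%N) ->
  back (r := r.+1) (ext_rot (r - c) (degens f r y)) = y.
Proof.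
elim: r => [|r ih] hf; first by rewrite /= face0_ext.
have ih' := ih (fun a ha => hf a (ltnW ha)).
rewrite -[RHS]ih' degensS hf //; case: ltnP => h.
  have e0 : (r.+1 - c = 0)%N by lia.
  have e1 : (r - c = 0)%N by lia.
  rewrite e0 e1 (@ext_rot_degen_lt _ P _ (r + q)) ?addn0 //; last lia.
  by rewrite (@back_degen _ P r.+1).
rewrite (@ext_rot_degen_ge _ P _ (r + q)); try lia.
rewrite (@back_degen _ P r.+1); try lia.
by congr (@back _ P r.+1 q (@ext_rot _ P _ (r + q) _)); lia.
Qed.
End Rotated.

Section AWBSh.
Context {k : comPzRingType} (P Q : cyclicModule k).
Local Notation qP n := (qpi (@degenerate k P n)).
Local Notation qQ n := (qpi (@degenerate k Q n)).
Local Notation qC n := (qpi (@degenerate k (cprod P Q) n)).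
Local Notation T n := (tensMixed (normalized P) (normalized Q) n).
Local Notation C := (normalized (cprod P Q)).

Lemma ext_rot_pure n j (u : P n) (v : Q n) :
  ext_rot (P := cprod P Q) j (pure u v) = pure (ext_rot j u) (ext_rot j v).
Proof.
rewrite /ext_rot /ext; have -> : rot (P := cprod P Q) j (pure u v) = pure (rot j u) (rot j v).
  by elim: j => [//|j ih]; rewrite !rotS ih /= tmap_pure.
by rewrite /= !tmap_pure.
Qed.

(** The component is nonzero only if [rot_pos] sends all the [nu] to [[i, n]] and
    all the [mu] below [i]. The preimage of [[0, i)] under [rot_pos] is an
    interval if [i <= j], and so is that of [[i, n]] if [i > j]; comparing sizes
    determines [i]. *)
Lemma front_back_ext_rot_cases p q (s : 'S_(p + q)) (x : P p) (y : Q q) j i l :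
  is_shuffle s -> (j <= p + q)%N -> (i + l = (p + q).+1)%N ->
  front_back i l (ext_rot j (shuffle_l s x)) (ext_rot j (shuffle_r s y)) != 0 ->
  [/\ i = p, (p <= j)%N, mus s = iota (p + q - j) p
    & nus s = block_compl (p + q) (p + q - j) p]
  \/ [/\ i = p.+1, (j <= p)%N, nus s = iota (p - j) q
    & mus s = block_compl (p + q) (p - j) q].
Proof.
move=> hs hj e /eqP ne.
have hnu e' : e' \in nus s -> (i <= rot_pos (p + q) j e')%N.
  move=> /mem_nusP[b hb ->]; rewrite leqNgt; apply/negP => h; apply: ne.
  by apply: (front_back_front_eq0 _ e h); apply: is_degen_ext_rot => //; exact: is_degen_shuffle_l.
have hmu e' : e' \in mus s -> (rot_pos (p + q) j e' < i)%N.
  move=> /mem_musP[b hb ->]; rewrite ltnNge; apply/negP => h; apply: ne.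
  by apply: (front_back_back_eq0 _ e h); apply: is_degen_ext_rot => //; exact: is_degen_shuffle_r.
have bmu := @mem_mus p q s; have bnu := @mem_nus p q s.
have smu := sorted_mus hs; have snu := sorted_nus hs.
have [h|h] := leqP i j.
  left; have [|e1|e1|h1 h2] := @sorted_block (p + q) (p + q - j) i (mus s) (nus s)
    smu snu bmu bnu (@mem_mus_nus p q s).
  - lia.
  - by move=> /[dup] /bmu + /hmu; rewrite /rot_pos; case: ifP; lia.
  - by move=> /[dup] /bnu + /hnu; rewrite /rot_pos; case: ifP; lia.
  have ip : i = p by have := size_mus s; rewrite h1 size_iota.
  by rewrite ip in h h1 h2; split.
right; have [e1 h1||e1|e1|h1 h2] := @sorted_block (p + q) (i - j.+1) ((p + q).+1 - i) (nus s) (mus s)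
  snu smu bnu bmu.
- by rewrite mem_mus_nus // negbK.
- lia.
- by move=> /[dup] /bnu + /hnu; rewrite /rot_pos; case: ifP; lia.
- by move=> /[dup] /bmu + /hmu; rewrite /rot_pos; case: ifP; lia.
have eq : ((p + q).+1 - i)%N = q by have := size_nus s; rewrite h1 size_iota.
have ip : i = p.+1 by lia.
by subst i; rewrite eq in h1 h2; split=> //; lia.
Qed.

(** The contribution of [e t^j] to [AW B (sh (x (x) y))] in bidegree [(i, l)], up
    to the sign [(-1)^(n j)]. *)
Definition ext_rot_term p q (x : P p) (y : Q q) j i l :=
  \sum_(s : 'S_(p + q) | is_shuffle s) (-1) ^+ s *:
    front_back i l (ext_rot j (shuffle_l s x)) (ext_rot j (shuffle_r s y)).

Lemma ext_rot_term0 p q (x : P p) (y : Q q) j i l :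
  (j <= p + q)%N -> (i + l = (p + q).+1)%N ->
  (i = p -> (j < p)%N) -> (i = p.+1 -> (p < j)%N) -> ext_rot_term x y j i l = 0.
Proof.
move=> hj e h1 h2; apply: big1 => s hs; rewrite -[RHS](scaler0 _ ((-1) ^+ s)).
congr (_ *: _); apply/eqP; apply/negPn/negP => /(front_back_ext_rot_cases hs hj e)[] [].
  by move=> /h1; lia.
by move=> /h2; lia.
Qed.

Lemma ext_rot_term_mu p q (x : P p) (y : Q q) j : (p <= j)%N -> (j <= p + q)%N ->
  ext_rot_term x y j p q.+1
  = (-1) ^+ (p * (p + q - j)) *: pure (qP p x) (qQ q.+1 (ext_rot (j - p) y)).
Proof.
move=> h hj; have hc : (p + q - j <= q)%N by lia.
have [s0 [hs0 hm hn hsg]] := block_mu_shuffle p hc.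
rewrite /ext_rot_term (sum_shuffle_single hs0); last first.
  move=> s hs; apply: contraNeq => /(front_back_ext_rot_cases hs hj (addnS p q))[] []; last lia.
  by move=> _ _ e1 e2; apply/eqP/shuffle_eq; rewrite ?e1 ?e2 ?hm ?hn.
rewrite hsg signr_odd; congr (_ *: _).
rewrite /front_back /shuffle_l /shuffle_r; congr (pure (qP p _) (qQ q.+1 _)).
  have -> : hcomp P (q.+1 + p) (ext_rot j (hcomp P (p + q) (degens (shuffle_nu s0) q x)))
      = ext_rot j (degens (shuffle_nu s0) q x).
    rewrite -hcomp_ext_rot hcomp_hcomp; last by rewrite addnC.
    exact: (hcomp_id (M := P)).
  have -> : j = (p + (q - (p + q - j)))%N by lia.
  apply: front_ext_rot_degens => a ha.
  by rewrite /shuffle_nu -/(nus s0) hn nth_block_compl //; lia.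
have e1 : j = (p + (q - (p + q - j)))%N by lia.
have e2 : (j - p = q - (p + q - j))%N by lia.
rewrite e2 {1}e1; apply: back_ext_rot_degens_block => // a ha.
by rewrite /shuffle_mu -/(mus s0) hm nth_iota.
Qed.

Lemma ext_rot_term_nu p q (x : P p) (y : Q q) j : (j <= p)%N ->
  ext_rot_term x y j p.+1 q
  = (-1) ^+ (q * j) *: pure (qP p.+1 (ext_rot j x)) (qQ q y).
Proof.
move=> h; have hc : (p - j <= p)%N by lia.
have hj : (j <= p + q)%N by lia.
have [s0 [hs0 hn hm hsg]] := block_nu_shuffle q hc.
rewrite /ext_rot_term (sum_shuffle_single hs0); last first.
  move=> s hs; apply: contraNeq => /(front_back_ext_rot_cases hs hj (addSn p q))[] []; first lia.
  by move=> _ _ e1 e2; apply/eqP/shuffle_eq; rewrite ?e1 ?e2 ?hm ?hn.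
rewrite hsg signr_odd; congr (_ *: _).
  by apply: sign_congr; rewrite !oddM oddD oddB //; rewrite addbA addbb.
rewrite /front_back /shuffle_l /shuffle_r; congr (pure (qP p.+1 _) (qQ q _)).
  have -> : hcomp P (q + p.+1) (ext_rot j (hcomp P (p + q) (degens (shuffle_nu s0) q x)))
      = hcomp P (q + p.+1) (ext_rot j (degens (shuffle_nu s0) q x)).
    by rewrite -hcomp_ext_rot hcomp_hcomp // addnC.
  apply: (front_ext_rot_degens_block (c := p - j)) => [|a ha]; first lia.
  by rewrite /shuffle_nu -/(nus s0) hn nth_iota.
rewrite hcomp_id; have -> : j = (p - (p - j))%N by lia.
apply: back_ext_rot_degens => a ha.
by rewrite /shuffle_mu -/(mus s0) hm nth_block_compl //; lia.
Qed.

(** The terms with [j >= p] give [x (x) B y] in bidegree [(p, q + 1)] and those with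
    [j <= p] give [B x (x) y] in bidegree [(p + 1, q)]; the term [j = p]
    contributes to both. *)
Lemma nAW_mB_nsh n (z : T n) : nAW (mB (nsh z)) = mB z :> T n.+1.
Proof.
apply: (tot_lin_ext (f := fun z => nAW (mB (nsh z))) (g := @tot_B k _ _ n)) z.
- apply: lin_comp (@nAW_linear _ P Q n.+1) _.
  exact: lin_comp (@mB_linear _ (cprod P Q) n) (@nsh_linear _ P Q n).
- exact: (@tot_B_linear _ (normalized P) (normalized Q) (@mB_linear _ P) (@mB_linear _ Q)).
move=> p q; elim/quot_ind => x; elim/quot_ind => y e; subst n.
rewrite nsh_tinj // hcomp_id (@tot_B_pure _ (normalized P) (normalized Q)) //;
  try exact: mB_linear.
rewrite !mB_qpi !qpi_connes (lin_sum (@nAW_linear _ P Q _)).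
apply: tot_ext => i l e; rewrite (lin_sum (@tget_linear _ _ _ _ i l)).
under eq_bigr => j _.
  rewrite (linZ (@nAW_linear _ P Q _)) (linZ (@tget_linear _ _ _ _ i l)) nAW_qpi.
  rewrite shuffleE (lin_sum (@ext_rot_linear _ (cprod P Q) _ _)).
  rewrite (lin_sum (@AWq_linear _ P Q _)) (lin_sum (@tget_linear _ _ _ _ i l)).
  under eq_bigr => s hs.
    rewrite (linZ (@ext_rot_linear _ (cprod P Q) _ _)) (linZ (@AWq_linear _ P Q _)).
    rewrite (linZ (@tget_linear _ _ _ _ i l)) ext_rot_pure tget_AWq //.
    over.
  over.
transitivity (\sum_(j < (p + q).+1) (-1) ^+ ((p + q) * j) *: ext_rot_term x y j i l).
  by [].
rewrite (linD (@tget_linear _ _ _ _ i l)) (linZ (@tget_linear _ _ _ _ i l)).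
rewrite !tget_tinj //.
have [ip|ne] := eqVneq i p.
  subst i; have el : l = q.+1 by lia.
  subst l; rewrite hcomp_id hcomp_neq ?add0r; last by case; lia.
  rewrite -(addnS p q) big_split_ord /= big1 ?add0r => [|j _]; last first.
    by rewrite ext_rot_term0 ?scaler0 //=; move: (ltn_ord j); lia.
  rewrite pure_sumr scaler_sumr; apply: eq_bigr => j _ /=.
  rewrite ext_rot_term_mu ?leq_addr //; last by move: (ltn_ord j); lia.
  rewrite pureZr !scalerA addKn -!exprD; congr (_ *: _); apply: sign_congr.
  move: (ltn_ord j); rewrite ltnS => hj.
  have -> : (p + q - (p + j) = q - j)%N by lia.
  rewrite !(oddD, oddM) (oddB hj).
  by case: (odd p); case: (odd q); case: (odd j).
have [ip|ne'] := eqVneq i p.+1.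
  subst i; have el : l = q by lia.
  subst l; rewrite hcomp_id [X in _ = _ + _ *: X]hcomp_neq ?scaler0 ?addr0; last by case; lia.
  rewrite -(addSn p q) big_split_ord /= [X in _ + X]big1 ?addr0 => [|j _]; last first.
    by rewrite ext_rot_term0 ?scaler0 //=; move: (ltn_ord j); lia.
  rewrite pure_suml; apply: eq_bigr => j _ /=.
  rewrite ext_rot_term_nu; last by rewrite -ltnS.
  rewrite pureZl !scalerA -!exprD; congr (_ *: _); apply: sign_congr.
  rewrite !(oddD, oddM).
  by case: (odd p); case: (odd q); case: (odd j).
rewrite !hcomp_neq ?scaler0 ?addr0; try by case; lia.
apply: big1 => j _; rewrite ext_rot_term0 ?scaler0 //; first by rewrite -ltnS.
  by move=> ip; rewrite ip eqxx in ne.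
by move=> ip; rewrite ip eqxx in ne'.
Qed.
End AWBSh.

(** * Cyclic skeletons *)

Section Submodule.
Context {k : pzRingType} {V : lmodType k} (G : set V).

Definition in_span : V -> bool := fun x => `[< Defs.span G x >].

Fact in_span_closed : GRing.subsemimod_closed in_span.
Proof.
split; [split|].
- by apply/asboolP; exact: span_0.
- by move=> x y /asboolP hx /asboolP hy; apply/asboolP; exact: spanD.
- by move=> a x /asboolP hx; apply/asboolP; exact: spanZ.
Qed.
HB.instance Definition _ := GRing.isSubmodClosed.Build k V in_span in_span_closed.

Definition submod := {x : V | in_span x}.
HB.instance Definition _ := SubChoice.on submod.
HB.instance Definition _ := [SubChoice_isSubLmodule of submod by <:].
End Submodule.

(* The same name is in use for the span of a sequence of vectors. *)
Notation span := Defs.span.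

Section Restrict.
Context {k : pzRingType} {V W : lmodType k} (G : set V) (H : set W).
Context (f : {linear V -> W}) (hf : forall x, span G x -> span H (f x)).

Definition restrict (x : submod G) : submod H :=
  exist _ (f (val x)) (asboolT (hf (asboolW (valP x)))).

Fact restrict_linear : linear restrict.
Proof. by move=> a x y; apply: val_inj; rewrite /= !linearP. Qed.
HB.instance Definition _ :=
  GRing.isLinear.Build k (submod G) (submod H) _ restrict restrict_linear.
End Restrict.

Lemma span_closed (k : pzRingType) (V : lmodType k) (G : set V) (A : V -> Prop) :
  A 0 -> (forall a x y, A x -> A y -> A (a *: x + y)) ->
  (forall x, G x -> A x) -> forall x, span G x -> A x.
Proof. by move=> h0 hl hg x; elim=> // a y z _ hy _ hz; exact: hl. Qed.

Section Skeleton.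
Context {k : comPzRingType} (P : cyclicModule k) (p : nat).

(** Membership in the cyclic submodule generated by the elements of degree at most
    [p], in normal form: everything up to degree [p], then degeneracies and the
    extra degeneracy of elements of degree [p], then only degeneracies. This form
    makes the vanishing of the normalized complex immediate, at the price of
    checking stability under the operators. *)
Fixpoint skeletal (r : nat) : P r -> Prop :=
  match r return P r -> Prop with
  | 0%N => fun=> True
  | r'.+1 => fun z => (r'.+1 <= p)%N \/
      span (fun z' => (exists j w, [/\ (j <= r')%N, skeletal w & z' = degen P r' j w])
                      \/ (r' = p /\ exists w, z' = ext w)) z
  end.

Lemma skeletal_low r (z : P r) : (r <= p)%N -> skeletal z.
Proof. by case: r z => [|r] z h //; left. Qed.

(** Induction principle above degree [p]; extra degeneracies occur only in degree
    [p + 1]. *)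
Lemma skeletal_high r (A : P r.+1 -> Prop) : (p <= r)%N ->
  A 0 -> (forall a x y, A x -> A y -> A (a *: x + y)) ->
  (forall j w, (j <= r)%N -> skeletal w -> A (degen P r j w)) ->
  (r = p -> forall w, A (ext w)) -> forall z, skeletal z -> A z.
Proof.
move=> h h0 hl hd he z [|]; first lia.
apply: span_closed => // x [[j [w [h1 h2 ->]]]|[h1 [w ->]]]; first exact: hd.
exact: he.
Qed.

Lemma skeletal0 r : skeletal (0 : P r).
Proof. by case: r => [|r] //; right; exact: span_0. Qed.

Lemma skeletal_lin r a (x y : P r) : skeletal x -> skeletal y -> skeletal (a *: x + y).
Proof.
case: r x y => [|r] x y //= [h|hx] [h'|hy]; try by left.
by right; exact: span_lin.
Qed.

Lemma skeletal_degen r j (w : P r) : (j <= r)%N -> skeletal w -> skeletal (degen P r j w).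
Proof. by move=> h hw; right; apply: span_gen; left; exists j, w. Qed.

(** Above degree [p] the extra degeneracy is not a new generator because
    [e s_j = s_(j+1) e] and [e e = s_0 e]. *)
Lemma skeletal_ext r (w : P r) : skeletal w -> skeletal (ext w).
Proof.
elim: r w => [|r ih] w hw.
  have [h|h] := posnP p; last by left.
  by right; apply: span_gen; right; split=> //; exists w.
have [h|h] := ltnP r p; first have [h'|h'] := ltnP r.+1 p; first by left.
  by right; apply: span_gen; right; split; [lia|exists w].
apply: (@skeletal_high r (fun z => skeletal (ext z)) h _ _ _ _ w hw) => [|a x y hx hy|j v hj hv|e v].
- by rewrite (lin0 (@ext_linear k P _)); exact: skeletal0.
- by rewrite (@ext_linear k P _); exact: skeletal_lin.
- by rewrite ext_degen //; apply: skeletal_degen => //; exact: ih.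
rewrite ext_ext; apply: skeletal_degen => //; apply: ih; apply: skeletal_low.
by rewrite e.
Qed.

Lemma skeletal_cyc r (w : P r) : skeletal w -> skeletal (cyc P r w).
Proof.
elim: r w => [//|r ih] w hw.
have [h|h] := ltnP r p; first by left.
apply: (@skeletal_high r (fun z => skeletal (cyc P r.+1 z)) h _ _ _ _ w hw)
  => [|a x y hx hy|j v hj hv|e v].
- by rewrite linear0; exact: skeletal0.
- by rewrite linearP; exact: skeletal_lin.
- move: hj; rewrite leq_eqVlt => /orP[/eqP ->|hj]; first exact: skeletal_ext.
  by rewrite -(@degen_cyc _ P r j.+1) //; apply: skeletal_degen => //; exact: ih.
by rewrite cyc_ext; apply: skeletal_degen => //; apply: skeletal_low; rewrite e.
Qed.

Lemma skeletal_face r i (z : P r.+1) : (i <= r.+1)%N -> skeletal z -> skeletal (face P r i z).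
Proof.
elim: r i z => [//|r ih] i z hi hz.
have [h|h] := ltnP r p; first by left.
apply: (@skeletal_high r.+1 (fun z => skeletal (face P r.+1 i z)) _ _ _ _ _ z hz)
  => [||a x y hx hy|j v hj hv|]; try lia.
- by rewrite linear0; exact: skeletal0.
- by rewrite linearP; exact: skeletal_lin.
have [hij|hij] := ltnP i j.
  rewrite face_degen_lt //; apply: skeletal_degen; first lia.
  by apply: ih => //; lia.
move: hij; rewrite leq_eqVlt => /orP[/eqP <-|hij]; first by rewrite face_degen_eq.
move: hij; rewrite leq_eqVlt => /orP[/eqP <-|hij]; first by rewrite face_degen_succ.
rewrite face_degen_gt //; apply: skeletal_degen; first lia.
by apply: ih => //; lia.
Qed.

Lemma span_skeletal r (z : P r) : span (@skeletal r) z -> skeletal z.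
Proof.
apply: span_closed => //; first exact: skeletal0.
by move=> a x y; exact: skeletal_lin.
Qed.

Let S r := submod (@skeletal r).
Let span_in r r' (f : P r -> P r') : (forall z, skeletal z -> skeletal (f z)) ->
  forall z, span (@skeletal r) z -> span (@skeletal r') (f z).
Proof. by move=> h z /span_skeletal/h; exact: span_gen. Qed.

(** Truncating the index makes stability hold for every index, also for those that
    the axioms of a cyclic module leave unconstrained. *)
Let face_ok n i := span_in (fun z => @skeletal_face n (minn i n.+1) z (geq_minr _ _)).
Let degen_ok n i := span_in (fun z => @skeletal_degen n (minn i n) z (geq_minr _ _)).
Let cyc_ok n := span_in (@skeletal_cyc n).

Let sface n i : {linear S n.+1 -> S n} := restrict (@face_ok n i).
Let sdegen n i : {linear S n -> S n.+1} := restrict (@degen_ok n i).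
Let scyc n : {linear S n -> S n} := restrict (@cyc_ok n).

Let minE a b : (a <= b)%N -> minn a b = a.
Proof. by move/minn_idPl. Qed.

Definition skeleton : cyclicModule k.
Proof.
apply: (@CyclicModule k S sface sdegen scyc).
- move=> n i j x h h'; apply: val_inj; rewrite /= !minE; try lia; exact: face_face.
- move=> n i j x h h'; apply: val_inj; rewrite /= !minE; try lia; exact: degen_degen.
- move=> n i j x h h'; apply: val_inj; rewrite /= !minE; try lia; exact: face_degen_lt.
- move=> n j x h; apply: val_inj; rewrite /= !minE; try lia; exact: face_degen_eq.
- move=> n j x h; apply: val_inj; rewrite /= !minE; try lia; exact: face_degen_succ.
- move=> n i j x h h'; apply: val_inj; rewrite /= !minE; try lia; exact: face_degen_gt.
- move=> n x; apply: val_inj; rewrite -[RHS](cyc_order (val x)).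
  by elim: n.+1 => [//|m ih]; rewrite !iterS -ih.
- move=> n i x h h'; apply: val_inj; rewrite /= !minE; try lia; exact: face_cyc.
- move=> n x; apply: val_inj; rewrite /= !minE; try lia; exact: face0_cyc.
- move=> n i x h h'; apply: val_inj; rewrite /= !minE; try lia; exact: degen_cyc.
- move=> n x; apply: val_inj; rewrite /= !minE; try lia; exact: degen0_cyc.
Defined.

Definition skeleton_incl : cyclicHom skeleton P.
Proof.
apply: (@CyclicHom k skeleton P (fun n => (val : S n -> P n))).
- by move=> n i x h; rewrite /= minE.
- by move=> n i x h; rewrite /= minE.
- by [].
Defined.

Lemma skeleton_incl_onto r (x : P r) : (r <= p)%N ->
  exists x' : skeleton r, skeleton_incl r x' = x.
Proof.
move=> h; have hx : in_span (@skeletal r) x.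
  by apply/asboolP/span_gen; exact: skeletal_low.
by exists (exist _ x hx).
Qed.

(** The cyclic counterpart of the fact that the [p]-skeleton of a simplicial module
    has no nondegenerate element above degree [p]; the circle contributes one
    more dimension. *)
Lemma normalized_skeleton_high r (x : normalized skeleton r) :
  (p.+1 < r)%N -> x = 0.
Proof.
case: r x => [//|r] x h; elim/quot_ind: x => x.
suff [x' [e hx']] : exists x' : skeleton r.+1,
    val x' = val x /\ span (@degenerate k skeleton r.+1) x'.
  rewrite -(val_inj e) -[RHS](qpi0 (@degenerate k skeleton r.+1)).
  by apply/qpiP; rewrite subr0.
have /asboolW/span_skeletal hx := valP x.
move: (val x) hx; apply: skeletal_high; first lia.
- by exists 0; split=> //; exact: span_0.
- move=> a y z [y' [e1 h1]] [z' [e2 h2]]; exists (a *: y' + z').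
  split; last exact: span_lin.
  by rewrite -e1 -e2; exact: (linearP (val : S r.+1 -> P r.+1)).
- move=> j w hj hw.
  have hw' : in_span (@skeletal r) w by apply/asboolP/span_gen.
  exists (degen skeleton r j (exist _ w hw')); split; first by rewrite /= minE.
  by apply: span_gen; exists j; split=> //; exists (exist _ w hw').
- lia.
Qed.
End Skeleton.

(** * Naturality and vanishing in high degrees *)

Section Nhom.
Context {k : comPzRingType} {P P' : cyclicModule k} (F : cyclicHom P P').
Local Notation qP n := (qpi (@degenerate k P n)).
Local Notation qP' n := (qpi (@degenerate k P' n)).

Lemma chom_degenerate n (x : P n) : degenerate x -> qP' n (F n x) = 0.
Proof.
case: n x => [//|n] x [i [hi [y ->]]]; rewrite chom_degen //.
exact: (qpi_is_degen (is_degen_degen _ hi)).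
Qed.

Lemma chom_linear n : linear (F n).
Proof. by move=> a x y; rewrite linearP. Qed.

Lemma nhom_qpi n (x : P n) : nhom (fun n => F n) (qP n x) = qP' n (F n x).
Proof. exact: (qmap_qpi (@chom_linear n) (@chom_degenerate n)). Qed.

Lemma nhom_linear n : linear (@nhom k P P' (fun n => F n) n).
Proof. exact: (qmap_linear (@chom_linear n) (@chom_degenerate n)). Qed.

Lemma chom_rot n j (x : P n) : F n (rot j x) = rot j (F n x).
Proof. by elim: j => [//|j ih]; rewrite !rotS chom_cyc ih. Qed.

Lemma chom_ext n (x : P n) : F n.+1 (ext x) = ext (F n x).
Proof. by rewrite /ext chom_cyc chom_degen. Qed.

Lemma chom_connes n (x : P n) : F n.+1 (connes x) = connes (F n x).
Proof.
have e : F n (norm_op x) = norm_op (F n x).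
  rewrite linear_sum; apply: eq_bigr => j _.
  by rewrite (linZ (@chom_linear n)) chom_rot.
by rewrite !connesE linearB (linZ (@chom_linear n.+1)) chom_cyc chom_ext e.
Qed.

Lemma nhom_mB n (x : normalized P n) :
  nhom (fun n => F n) (mB x) = mB (nhom (fun n => F n) x).
Proof.
by elim/quot_ind: x => x; rewrite mB_qpi !nhom_qpi mB_qpi chom_connes.
Qed.

Lemma chom_degens f r n (x : P n) :
  (forall a, (a < r)%N -> (f a <= n + a)%N) ->
  F (r + n)%N (degens f r x) = degens f r (F n x).
Proof.
elim: r => [//|r ih] h; rewrite !degensS (@chom_degen _ _ _ F (r + n)); last by rewrite addnC h.
by rewrite ih // => a ha; apply: h; exact: ltnW.
Qed.

Lemma chom_front r n (x : P (r + n)%N) : F n (front x) = front (F (r + n)%N x).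
Proof. by elim: r x => [//|r ih] x /=; rewrite ih chom_face. Qed.

Lemma chom_back r n (x : P (r + n)%N) : F n (back x) = back (F (r + n)%N x).
Proof. by elim: r x => [//|r ih] x /=; rewrite ih chom_face. Qed.

Lemma chom_hcomp n m (x : P n) : F m (hcomp P m x) = hcomp P' m (F n x).
Proof.
exact/esym/(hcomp_map (g := id) (F := fun n => F n) (@inj_id _) chom_linear).
Qed.
End Nhom.

Section CprodHom.
Context {k : comPzRingType} {P P' Q Q' : cyclicModule k}.
Context (f : cyclicHom P P') (g : cyclicHom Q Q').

Definition cprod_hom : cyclicHom (cprod P Q) (cprod P' Q').
Proof.
apply: (@CyclicHom k (cprod P Q) (cprod P' Q') (fun n => tmap (f n) (g n))).
- move=> n i x h; apply: (tens_ext (f := fun w => tmap (f n) (g n) (face (cprod P Q) n i w))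
    (g := fun w => face (cprod P' Q') n i (tmap (f n.+1) (g n.+1) w))).
  + by move=> a u v; rewrite !linearP.
  + by move=> a u v; rewrite !linearP.
  by move=> u v; rewrite /= !tmap_pure !chom_face.
- move=> n i x h; apply: (tens_ext (f := fun w => tmap (f n.+1) (g n.+1) (degen (cprod P Q) n i w))
    (g := fun w => degen (cprod P' Q') n i (tmap (f n) (g n) w))).
  + by move=> a u v; rewrite !linearP.
  + by move=> a u v; rewrite !linearP.
  by move=> u v; rewrite /= !tmap_pure !chom_degen.
- move=> n x; apply: (tens_ext (f := fun w => tmap (f n) (g n) (cyc (cprod P Q) n w))
    (g := fun w => cyc (cprod P' Q') n (tmap (f n) (g n) w))).
  + by move=> a u v; rewrite !linearP.
  + by move=> a u v; rewrite !linearP.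
  by move=> u v; rewrite /= !tmap_pure !chom_cyc.
Defined.

Local Notation H := (nhom (P := cprod P Q) (P' := cprod P' Q') (fun n => tmap (f n) (g n))).
Local Notation qC n := (qpi (@degenerate k (cprod P Q) n)).
Local Notation qC' n := (qpi (@degenerate k (cprod P' Q') n)).
Local Notation C := (normalized (cprod P Q)).
Local Notation C' := (normalized (cprod P' Q')).

Lemma nhom_cprod_qpi n (w : cprod P Q n) : H (qC n w) = qC' n (tmap (f n) (g n) w).
Proof. exact: (nhom_qpi cprod_hom). Qed.


Lemma nhom_cprod_mB n (x : C n) : H (mB x) = mB (H x).
Proof. exact: (nhom_mB cprod_hom). Qed.

Lemma nsh_natural n p q (x : P p) (y : Q q) : (p + q = n)%N ->
  H (nsh (tin n (pure (qpi (@degenerate k P p) x) (qpi (@degenerate k Q q) y))))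
  = nsh (tin n (pure (qpi (@degenerate k P' p) (f p x)) (qpi (@degenerate k Q' q) (g q y)))).
Proof.
move=> e; subst n; rewrite !nsh_tinj // !hcomp_id nhom_cprod_qpi; congr qpi.
rewrite !shuffleE (lin_sum (tmap_is_linear (f (p + q)) (g (p + q)))).
apply: eq_bigr => s hs.
rewrite (linZ (tmap_is_linear (f (p + q)) (g (p + q)))) tmap_pure.
congr (_ *: pure _ _).
  by rewrite /shuffle_l chom_hcomp chom_degens // => a; exact: shuffle_nu_le.
by rewrite /shuffle_r chom_degens // => a; exact: shuffle_mu_le.
Qed.

Lemma nAW_natural n (w : C n) i j : (i + j = n)%N ->
  tget (nAW (H w)) i j = tmap (@nhom k P P' (fun n => f n) i) (@nhom k Q Q' (fun n => g n) j) (tget (nAW w) i j).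
Proof.
move=> e; elim/quot_ind: w => w; rewrite nhom_cprod_qpi !nAW_qpi.
have tl := tmap_linear (@nhom_linear _ _ _ f i) (@nhom_linear _ _ _ g j).
apply: (tens_ext (f := fun w => tget (AWq (tmap (f n) (g n) w)) i j)
  (g := fun w => tmap (@nhom k P P' (fun n => f n) i) (@nhom k Q Q' (fun n => g n) j) (tget (AWq w) i j))) w.
- apply: lin_comp (@tget_linear _ _ _ _ i j) _.
  exact: lin_comp (@AWq_linear _ P' Q' _) (tmap_is_linear _ _).
- apply: lin_comp tl _.
  exact: lin_comp (@tget_linear _ _ _ _ i j) (@AWq_linear _ P Q _).
move=> u v; rewrite tmap_pure !tget_AWq // /front_back.
rewrite (tmapE (@nhom_linear _ _ _ f i) (@nhom_linear _ _ _ g j)).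
by rewrite !nhom_qpi chom_front chom_back !chom_hcomp.
Qed.
End CprodHom.

Lemma tens_trivial (k : comPzRingType) (U V : lmodType k) :
  (forall u : U, u = 0) \/ (forall v : V, v = 0) -> forall w : tens U V, w = 0.
Proof.
move=> h; apply: tens_ind => // [x y -> ->|u v]; first exact: addr0.
by case: h => h; [rewrite (h u) pure0l|rewrite (h v) pure0r].
Qed.

Section Vanishing.
Context {k : comPzRingType}.
Context (phi : forall (P Q : cyclicModule k) (n : nat),
     normalized (cprod P Q) n -> normalized (cprod P Q) n.+1).
Hypothesis hphi : special_homotopy phi.

Lemma phiB_pow_natural (P P' Q Q' : cyclicModule k) (f : cyclicHom P P')
    (g : cyclicHom Q Q') m n (x : normalized (cprod P Q) n) :
  nhom (P := cprod P Q) (P' := cprod P' Q') (fun n => tmap (f n) (g n))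
    (phiB_pow (@phi P Q) m x)
  = phiB_pow (@phi P' Q') m
      (nhom (P := cprod P Q) (P' := cprod P' Q') (fun n => tmap (f n) (g n)) x).
Proof.
by elim: m => [//|m ih]; rewrite /= -(special_natural hphi) nhom_cprod_mB ih.
Qed.

Lemma phiB_pow_linear (P Q : cyclicModule k) m n :
  linear (fun x : normalized (cprod P Q) n => phiB_pow (@phi P Q) m x).
Proof.
elim: m => [|m ih] /=; first exact: lin_id.
apply: (lin_comp (f := @phi P Q _) (g := fun x => mB (phiB_pow (@phi P Q) m x))).
  exact: (@special_linear _ _ hphi P Q).
exact: lin_comp (@mB_linear _ (cprod P Q) _) ih.
Qed.

(** By naturality the value on [x (x) y] comes from the skeletons generated in
    degrees [p] and [q]. The target degree is at least [p + q + 3], so in each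
    bidegree one of the two normalized skeletons vanishes. *)
Lemma nAW_mB_phiB_nsh (P Q : cyclicModule k) m n
    (z : tensMixed (normalized P) (normalized Q) n) : (0 < m)%N ->
  nAW (mB (phiB_pow (@phi P Q) m (nsh z))) = 0.
Proof.
move=> hm.
apply: (tot_lin_ext (f := fun z => nAW (mB (phiB_pow (@phi P Q) m (nsh z))))
  (g := fun=> 0)) z => [||p q].
- apply: lin_comp (@nAW_linear _ P Q _) _.
  apply: lin_comp (@mB_linear _ (cprod P Q) _) _.
  exact: lin_comp (@phiB_pow_linear P Q m n) (@nsh_linear _ P Q n).
- by move=> a x y; rewrite scaler0 addr0.
elim/quot_ind => x; elim/quot_ind => y e.
have [x' <-] := skeleton_incl_onto x (leqnn p).
have [y' <-] := skeleton_incl_onto y (leqnn q).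
rewrite -nsh_natural // -phiB_pow_natural -nhom_cprod_mB.
apply: tot_ext => i j eij; rewrite nAW_natural // (lin0 (@tget_linear _ _ _ _ i j)).
rewrite [X in tmap _ _ X]tens_trivial.
  exact: (lin0 (tmap_linear (@nhom_linear _ _ _ _ i) (@nhom_linear _ _ _ _ j))).
have [h|h] := ltnP p.+1 i; [left=> u|right=> v]; apply: normalized_skeleton_high => //.
move: eij; rewrite -addnn -e; lia.
Qed.
End Vanishing.

Section BoundarySquare.
Context {k : comPzRingType} (P : cyclicModule k).

(** The terms [d_i d_j] with [i < j] cancel the terms [d_(j-1) d_i]. *)
Lemma hochschild_hochschild n (x : P n.+2) : hochschild (hochschild x) = 0.
Proof.
rewrite /hochschild.
pose F (i j : nat) : P n := (-1) ^+ (i + j) *: face P n i (face P n.+1 j x).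
transitivity (\sum_(i < n.+2) \sum_(j < n.+3) F i j).
  apply: eq_bigr => i _; rewrite linear_sum scaler_sumr; apply: eq_bigr => j _.
  by rewrite faceZ scalerA -exprD.
have -> : \sum_(i < n.+2) \sum_(j < n.+3) F i j =
    \sum_(i < n.+2) (\sum_(j < n.+2 | (j <= i)%N) F i j
                     - \sum_(j < n.+2 | (i <= j)%N) F j i).
  apply: eq_bigr => i _; rewrite (bigID (fun j : 'I_n.+3 => (j <= i)%N)) /=.
  congr (_ + _).
    by rewrite big_mkcond big_ord_recr /= leqNgt ltn_ord addr0 -big_mkcond.
  rewrite big_mkcond big_ord_recl /= add0r -sumrN [RHS]big_mkcond /=.
  apply: eq_bigr => j _; rewrite /bump /= add1n -ltnNge ltnS.
  case: ifP => // h; rewrite /F (@face_face _ P n i j.+1) //.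
  by rewrite addnS exprS mulN1r scaleNr addnC.
rewrite big_split /= sumrN; apply/eqP; rewrite subr_eq0; apply/eqP.
exact: (exchange_big_dep xpredT).
Qed.

Lemma mb_mb n (x : normalized P n.+2) : mb (mb x) = 0 :> normalized P n.
Proof. by elim/quot_ind: x => x; rewrite !mb_qpi hochschild_hochschild qpi0. Qed.
End BoundarySquare.

(** * Perturbation of a special homotopy *)

Section Perturbation.
Context {k : pzRingType} {A C : lmodType k}.
Context {b B phi : C -> C} {bA BA : A -> A} {sh : A -> C} {aw : C -> A}.
Hypotheses (lb : linear b) (lB : linear B) (lphi : linear phi).
Hypotheses (lbA : linear bA) (lBA : linear BA) (lsh : linear sh) (law : linear aw).
Hypothesis bB : forall x, b (B x) = - B (b x).
Hypothesis BB : forall x, B (B x) = 0.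
Hypothesis sh_aw : forall x, sh (aw x) = x + b (phi x) + phi (b x).
Hypothesis phi_sh : forall z, phi (sh z) = 0.
Hypothesis aw_phi : forall x, aw (phi x) = 0.
Hypothesis phi_phi : forall x, phi (phi x) = 0.
Hypothesis aw_sh : forall z, aw (sh z) = z.
Hypothesis b_sh : forall z, b (sh z) = sh (bA z).
Hypothesis aw_b : forall x, aw (b x) = bA (aw x).
Hypothesis aw_B_sh : forall z, aw (B (sh z)) = BA z.

Definition sh_comp m z := iter m (fun x => phi (B x)) (sh z).
Definition aw_comp m x := aw (iter m (fun x => B (phi x)) x).

Lemma iter_linear (f : C -> C) m : linear f -> linear (iter m f).
Proof. by move=> hf; elim: m => [|m ih] a x y //; rewrite !iterS ih hf. Qed.

Lemma aw_comp_linear m : linear (aw_comp m).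
Proof. exact: lin_comp law (iter_linear m (lin_comp lB lphi)). Qed.

Lemma b_phi x : b (phi x) = sh (aw x) - x - phi (b x).
Proof. by rewrite sh_aw addrAC [x + _]addrC !addrK. Qed.

Lemma phi_b x : phi (b x) = sh (aw x) - x - b (phi x).
Proof. by rewrite b_phi subKr. Qed.

Lemma sh_compS m z : sh_comp m.+1 z = phi (B (sh_comp m z)).
Proof. by []. Qed.
Lemma aw_compS m x : aw_comp m.+1 x = aw_comp m (B (phi x)).
Proof. by rewrite /aw_comp iterSr. Qed.
Lemma iter_B_phi m x : iter m (fun y => B (phi y)) (B x) = B (iter m (fun y => phi (B y)) x).
Proof. by elim: m => [//|m ih]; rewrite !iterS ih. Qed.

Section Components.
Hypothesis aw_B_phiB_sh : forall m z, aw (B (sh_comp m.+1 z)) = 0.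

(** In [b phi B X = sh AW B X - B X - phi b B X] with [X = (phi B)^m sh], the first
    term is [sh B] if [m = 0] and zero otherwise, and [b B = - B b] turns the last
    one into the formula for [m - 1]. *)
Lemma sh_comp_coextension m z :
  b (sh_comp m.+1 z) - sh_comp m.+1 (bA z) + (B (sh_comp m z) - sh_comp m (BA z)) = 0.
Proof.
suff -> : b (sh_comp m.+1 z) = sh_comp m.+1 (bA z) - B (sh_comp m z) + sh_comp m (BA z).
  rewrite [X in X + _]addrAC (addrAC (sh_comp m.+1 _)) subrr sub0r.
  by rewrite addrACA addNr subrr addr0.
elim: m => [|m ih]; rewrite [in LHS]sh_compS b_phi bB (linN lphi) opprK.
  by rewrite aw_B_sh b_sh addrAC [X in X - _ = _]addrC addrAC.
rewrite aw_B_phiB_sh (lin0 lsh) sub0r ih (linD lB) (linB lB) BB subr0 (linD lphi).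
by rewrite addrA [- _ + _]addrC.
Qed.

(** Same induction as for [sh_comp_coextension], splitting the innermost factor
    [B phi] instead of the outermost one. *)
Lemma aw_comp_coextension m x :
  bA (aw_comp m.+1 x) - aw_comp m.+1 (b x) + (BA (aw_comp m x) - aw_comp m (B x)) = 0.
Proof.
suff -> : aw_comp m.+1 (b x) = bA (aw_comp m.+1 x) + (BA (aw_comp m x) - aw_comp m (B x)).
  by rewrite opprD [X in X + _]addrA subrr sub0r addNr.
elim: m x => [|m ih] x; rewrite [in LHS]aw_compS phi_b !(linB lB) -[B (b _)]opprK -bB opprK.
  rewrite !(linD (aw_comp_linear _)) !(linN (aw_comp_linear _)) {1 3}/aw_comp /= aw_B_sh.
  by rewrite aw_b addrC.
rewrite !(linD (aw_comp_linear _)) !(linN (aw_comp_linear _)).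
rewrite {1}/aw_comp iter_B_phi -/(sh_comp m.+1 (aw x)) aw_B_phiB_sh sub0r.
by rewrite ih BB (lin0 (aw_comp_linear m)) subr0 -!aw_compS addrC addrA.
Qed.
End Components.

Section Total.
Context {Phi : C -> C} (lPhi : linear Phi).
Hypothesis Phi_l : forall x, Phi x = phi x + phi (B (Phi x)).
Hypothesis Phi_r : forall x, Phi x = phi x + Phi (B (phi x)).
Hypothesis aw_B_Phi_B_sh : forall z, aw (B (Phi (B (sh z)))) = 0.

(** The map [(1 + Phi B) sh]; its components are the [(phi B)^m sh]. *)
Definition sh_tot z := sh z + Phi (B (sh z)).
(** The map [AW (1 + B Phi)]; its components are the [AW (B phi)^m]. *)
Definition aw_tot x := aw x + aw (B (Phi x)).

Lemma phi_Phi x : phi (Phi x) = 0.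
Proof. by rewrite Phi_l (linD lphi) !phi_phi addr0. Qed.
Lemma Phi_Phi x : Phi (Phi x) = 0.
Proof. by rewrite Phi_r phi_Phi (lin0 lB) (lin0 lPhi) addr0. Qed.
Lemma Phi_sh z : Phi (sh z) = 0.
Proof. by rewrite Phi_r phi_sh (lin0 lB) (lin0 lPhi) addr0. Qed.
Lemma aw_Phi x : aw (Phi x) = 0.
Proof. by rewrite Phi_l (linD law) !aw_phi addr0. Qed.

Lemma aw_tot_sh_tot z : aw_tot (sh_tot z) = z.
Proof.
rewrite /aw_tot /sh_tot (linD lPhi) Phi_sh Phi_Phi addr0 (lin0 lB) (lin0 law) addr0.
by rewrite (linD law) aw_sh aw_Phi addr0.
Qed.

(** With [v = (1 + B Phi) x] one has [phi v = Phi x], so that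
    [sh AW v = v + b Phi x + phi b v]; applying [1 + Phi B] turns [phi] into [Phi]
    and, by [B B = 0] and [b B = - B b], leaves exactly the asserted terms. *)
Lemma sh_tot_aw_tot x :
  sh_tot (aw_tot x) = x + (b (Phi x) + B (Phi x)) + Phi (b x + B x).
Proof.
have [v vE] : exists v, v = x + B (Phi x) by exists (x + B (Phi x)).
have -> : aw_tot x = aw v by rewrite /aw_tot -(linD law) vE.
have phi_v : phi v = Phi x by rewrite vE (linD lphi) -Phi_l.
have Phi_phi_r y : phi y + Phi (B (phi y)) = Phi y by rewrite -Phi_r.
rewrite /sh_tot sh_aw phi_v !(linD lB) !(linD lPhi) addrACA Phi_phi_r.
have -> : B v = B x by rewrite vE (linD lB) BB addr0.
have -> : b v = b x - B (b (Phi x)) by rewrite vE (linD lb) bB.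
rewrite vE.
rewrite (linB lPhi).
have e : x + B (Phi x) + b (Phi x) + (Phi (B x) + Phi (B (b (Phi x))))
   = x + (b (Phi x) + B (Phi x)) + Phi (B x) + Phi (B (b (Phi x))).
  by rewrite [LHS]addrA; congr (_ + _ + _); rewrite -addrA [X in x + X]addrC.
by rewrite e addrACA subrr addr0 [Phi (b x) + _]addrC [RHS]addrA.
Qed.

Lemma sh_tot_linear : linear sh_tot.
Proof.
move=> c x y; rewrite /sh_tot lsh lB lPhi scalerDr addrACA.
by [].
Qed.

Lemma addr_cancel_mid (V : zmodType) (u y s w : V) :
  u + y + (s - y + w) = u + w + s.
Proof. by rewrite [s - y + w]addrC addrACA [y + _]addrC subrK. Qed.

(** Replacing [(b + B) Phi] by [sh_oo AW_oo - 1 - Phi (b + B)] in [(b + B) sh_oo]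
    leaves [sh_oo b + sh_oo (AW_oo B sh)], and [AW_oo B sh = B]. *)
Lemma sh_tot_chain z :
  b (sh_tot z) + B (sh_tot z) = sh_tot (bA z + BA z).
Proof.
have e y : b (Phi y) + B (Phi y) = sh_tot (aw_tot y) - y - Phi (b y + B y).
  by rewrite sh_tot_aw_tot addrAC addrK addrAC subrr add0r.
have ey : aw_tot (B (sh z)) = BA z by rewrite /aw_tot aw_B_sh aw_B_Phi_B_sh addr0.
rewrite (linD sh_tot_linear) {1 2}/sh_tot (linD lb) (linD lB) addrACA e ey.
rewrite BB addr0 bB (linN lPhi) opprK b_sh.
exact: addr_cancel_mid.
Qed.

Lemma aw_tot_chain x : aw_tot (b x + B x) = bA (aw_tot x) + BA (aw_tot x).
Proof.
have e : Phi (b x + B x) = sh_tot (aw_tot x) - x - (b (Phi x) + B (Phi x)).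
  by rewrite sh_tot_aw_tot -[RHS]addrA -opprD addrAC subrr add0r.
have ey u : aw (B (sh_tot u)) = BA u.
  by rewrite /sh_tot (linD lB) (linD law) aw_B_sh aw_B_Phi_B_sh addr0.
rewrite {1}/aw_tot e !(linB lB) (linD lB) BB addr0 !(linB law) ey (linD law).
rewrite -[B (b (Phi x))]opprK -bB (linN law) opprK !aw_b.
by rewrite addr_cancel_mid [in RHS]/aw_tot (linD lbA).
Qed.
End Total.
End Perturbation.

(** * Homogeneous operators on products *)

Section Graded.
Context {k : pzRingType}.
Implicit Types M N : nat -> lmodType k.

(** [up], [down] and [level] extend homogeneous operators of degree 1, -1 and 0 to
    the product of all degrees; the shift of the index is definitional. *)
Definition up M N (F : forall n, M n -> N n.+1) (u : dprodm M) : dprodm N :=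
  fun j => match j with 0%N => 0 | j'.+1 => F j' (u j') end.
Definition down M N (F : forall n, M n.+1 -> N n) (u : dprodm M) : dprodm N :=
  fun j => F j (u j.+1).
Definition level M N (F : forall n, M n -> N n) (u : dprodm M) : dprodm N :=
  fun j => F j (u j).
Definition delta M n (x : M n) : dprodm M := fun j => hcomp M j x.

Lemma up_linear M N (F : forall n, M n -> N n.+1) :
  (forall n, linear (F n)) -> linear (up F).
Proof.
move=> h a x y; apply: functional_extensionality_dep => -[|j] /=; last exact: h.
by rewrite [RHS]addr0 [RHS]scaler0.
Qed.
Lemma down_linear M N (F : forall n, M n.+1 -> N n) :
  (forall n, linear (F n)) -> linear (down F).
Proof. by move=> h a x y; apply: functional_extensionality_dep => j; exact: h. Qed.
Lemma level_linear M N (F : forall n, M n -> N n) :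
  (forall n, linear (F n)) -> linear (level F).
Proof. by move=> h a x y; apply: functional_extensionality_dep => j; exact: h. Qed.

Lemma delta_id M n (x : M n) : delta x n = x.
Proof. exact: hcomp_id. Qed.
Lemma delta_inj M n : injective (@delta M n).
Proof. by move=> x y e; rewrite -(delta_id x) -(delta_id y) e. Qed.
Lemma delta_hcomp M n m (x : M n) : n = m -> delta (hcomp M m x) = delta x.
Proof.
by move=> e; apply: functional_extensionality_dep => j; exact: hcomp_hcomp.
Qed.

Lemma up_delta M N (F : forall n, M n -> N n.+1) n (x : M n) :
  (forall n, linear (F n)) -> up F (delta x) = delta (F n x).
Proof.
move=> h; apply: functional_extensionality_dep => -[|j] /=.
  by rewrite /delta hcomp_neq.
by rewrite /delta (hcomp_map (g := S) (F := F) succn_inj h).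
Qed.

Lemma level_delta M N (F : forall n, M n -> N n) n (x : M n) :
  (forall n, linear (F n)) -> level F (delta x) = delta (F n x).
Proof.
move=> h; apply: functional_extensionality_dep => j.
by rewrite /level /delta (hcomp_map (g := id) (F := F) (@inj_id _) h).
Qed.
End Graded.

Lemma bdry_delta (k : comPzRingType) (M : mixedModule k) n (x : M n) :
  (forall n, linear (@mb k M n)) -> down (@mb k M) (delta x) = delta (bdry x).
Proof.
move=> h; apply: functional_extensionality_dep => j; rewrite /down.
case: n x => [|n] x; rewrite /delta /=.
  by rewrite hcomp_neq // hcomp0 (lin0 (h _)).
have [e|/eqP ne] := eqVneq n j; first by case: j / e; rewrite !hcomp_id.
by rewrite !hcomp_neq ?(lin0 (h _)) // => -[].
Qed.

(** * Negative cyclic complexes *)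

Section Support.
Context {k : pzRingType}.
Implicit Types M N : nat -> lmodType k.

Definition supported M (d : int) (u : dprodm M) :=
  forall n : nat, (forall i : nat, d + i.*2%:Z <> n%:Z) -> u n = 0.

Lemma supported_up M N (F : forall n, M n -> N n.+1) (d : int) (u : dprodm M) :
  (forall n, linear (F n)) -> supported d u ->
  supported (d + 1) (up F u).
Proof.
move=> hF h [//|n] hn /=; rewrite h ?(lin0 (hF n)) // => i e.
by apply: (hn i); rewrite addrAC e; lia.
Qed.

Lemma supported2 M (d : int) (u : dprodm M) : supported (d + 1 + 1) u -> supported d u.
Proof. by move=> h n hn; apply: h => i e; apply: (hn i.+1); move: e; lia. Qed.
End Support.

Section Cneg.
Context {k : comPzRingType}.
Implicit Types M N : mixedModule k.

Lemma extz_ext M (e : int) (x y : extz M e) :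
  (forall n : nat, e = n%:Z -> hcomp (extz M) n%:Z x = hcomp (extz M) n%:Z y) -> x = y.
Proof.
case: e x y => n x y h; last by rewrite (thinmx0 x) (thinmx0 y).
by have := h n erefl; rewrite !hcomp_id.
Qed.

(** [C^-_d(M)] as a submodule of the product of all the [M_n], namely that of the
    elements supported in the degrees [d + 2 i]. If [n] is not of this form the
    degrees do not match and [hcomp] gives zero. *)
Definition total M (d : int) (z : cneg M d) : dprodm (mcar M) :=
  fun n => hcomp (extz M) n%:Z (z (`|n%:Z - d|./2)%N).

Definition untotal M (d : int) (u : dprodm (mcar M)) : cneg M d :=
  fun i => match d + i.*2%:Z as e return extz M e with Posz n => u n | Negz _ => 0 end.

Lemma total_linear M d : linear (@total M d).
Proof.
move=> a x y; apply: functional_extensionality_dep => n; exact: (@hcomp_linear k _ (extz M) _ n%:Z).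
Qed.

Lemma untotal_linear M d : linear (@untotal M d).
Proof.
move=> a x y; apply: functional_extensionality_dep => i.
transitivity (a *: untotal d x i + untotal d y i); last by [].
rewrite /untotal; case: (d + _) => // n; by rewrite scaler0 addr0.
Qed.

Lemma totalE M d (z : cneg M d) i (n : nat) : d + i.*2%:Z = n%:Z ->
  total z n = hcomp (extz M) n%:Z (z i).
Proof. by move=> e; rewrite /total (_ : (`|n%:Z - d|./2)%N = i) //; lia. Qed.

Lemma total_supported M d (z : cneg M d) : supported d (total z).
Proof. by move=> n h; rewrite /total hcomp_neq //; exact: h. Qed.

Lemma total_inj M d : injective (@total M d).
Proof.
move=> x y e; apply: functional_extensionality_dep => i; apply: extz_ext => n hn.
by rewrite -!(totalE _ hn) e.
Qed.

Lemma untotalK M d (u : dprodm (mcar M)) : supported d u -> total (untotal d u) = u.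
Proof.
move=> hu; apply: functional_extensionality_dep => n.
have [[i e]|h] := pselect (exists i : nat, d + i.*2%:Z = n%:Z).
  rewrite (totalE _ e) /untotal; move: (d + i.*2%:Z) e => e ->.
  by rewrite hcomp_id.
rewrite total_supported ?hu // => i e; apply: h; by exists i.
Qed.

Lemma zmapE M N (r : nat -> nat) (F : forall n, M n -> N (r n)) (e f : int)
    (x : extz M e) (n : nat) :
  e = n%:Z -> f = (r n)%:Z ->
  hcomp (extz N) (r n)%:Z (zmap F f x) = F n (hcomp (extz M) n%:Z x).
Proof. by move=> h h'; subst; rewrite !hcomp_id /zmap hcomp_id. Qed.

Lemma zmap_neg M N (r : nat -> nat) (F : forall n, M n -> N (r n)) (e f : int)
    (x : extz M e) : e < 0 -> zmap F f x = 0.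
Proof. by case: e x => n x //; lia. Qed.

Lemma zmap_linear M N (r : nat -> nat) (F : forall n, M n -> N (r n)) (e f : int) :
  (forall n, linear (F n)) -> linear (zmap F f : extz M e -> extz N f).
Proof.
move=> hF; case: e => n a x y; last by rewrite /= scaler0 addr0.
by rewrite /zmap hF hcomp_linear.
Qed.

Section Ops.
Context {M : mixedModule k}.
Hypotheses (lb : forall n, linear (@mb k M n)) (lB : forall n, linear (@mB k M n)).

Lemma total_cneg_d d (z : cneg M (d + 1)) :
  total (cneg_d z) = down (@mb k M) (total z) + up (@mB k M) (total z).
Proof.
apply: functional_extensionality_dep => n.
transitivity (mb (total z n.+1) + up (@mB k M) (total z) n); last by [].
have [[i e]|h] := pselect (exists i : nat, d + i.*2%:Z = n%:Z); last first.
  rewrite total_supported => [|i e]; last by apply: h; exists i.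
  rewrite (_ : total z n.+1 = 0); last first.
    by apply: total_supported => i e; apply: h; exists i; lia.
  rewrite (lin0 (@lb n)) add0r; case: n h => [//|n] h /=.
  rewrite total_supported ?(lin0 (@lB n)) // => i e.
  by apply: h; exists i.+1; lia.
have e1 : d + 1 + i.*2%:Z = n.+1%:Z by lia.
rewrite (totalE _ e) /cneg_d (linD (@hcomp_linear _ _ _ _ _)) (totalE _ e1).
rewrite (zmapE (@bdry k M) (z i) e1 e); congr (_ + _).
case: i e e1 => [|j] e e1.
  rewrite hcomp0; case: n e e1 => [//|n] e e1 /=.
  by rewrite total_supported ?(lin0 (@lB n)) // => i e2; lia.
case: n e e1 => [|n] e e1 /=.
  by rewrite zmap_neg ?hcomp0 //; lia.
have e2 : d + 1 + j.*2%:Z = n%:Z by lia.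
by rewrite (totalE _ e2) (zmapE (@mB k M) (z j) e2 e).
Qed.
End Ops.

Section Maps.
Context {M N : mixedModule k} (F : forall m n, M n -> N (m.*2 + n)%N).
Context (X : nat -> dprodm (mcar M) -> dprodm (mcar N)).
Hypothesis hF : forall m n, linear (@F m n).
Hypothesis X_val : forall m u n, X m u (m.*2 + n)%N = @F m n (u n).
Hypothesis X_low : forall m u j, (j < m.*2)%N -> X m u j = 0.

(** The sum of the operators [X m], where [X m] takes its values in degrees at
    least [m], so that each component is a finite sum. *)
Definition series u : dprodm (mcar N) := fun j => \sum_(m < j.+1) X m u j.

Lemma cneg_map_linear d : linear (cneg_map F (d := d)).
Proof.
move=> a x y; apply: functional_extensionality_dep => i.
transitivity (a *: cneg_map F x i + cneg_map F y i); last by [].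
rewrite /cneg_map scaler_sumr -big_split; apply: eq_bigr => m _.
exact: (@zmap_linear M N (fun n => m.*2 + n)%N (@F m) _ _ (@hF m) a (x (i - m)%N)
  (y (i - m)%N)).
Qed.

Lemma sum_trunc (V : nmodType) (g : nat -> V) a b : (a <= b)%N ->
  (forall m, (a <= m)%N -> g m = 0) -> \sum_(m < b) g m = \sum_(m < a) g m.
Proof.
move=> h hg; rewrite (big_ord_widen b g h) [RHS]big_mkcond.
by apply: eq_bigr => m _; case: ltnP => // /hg.
Qed.

(** Both sides are sums over different ranges of [m]; the terms that are not in both
    ranges vanish, either because they involve a negative degree or because
    [total z] has no component below degree [d]. *)
Lemma total_cneg_map d (z : cneg M d) : total (cneg_map F z) = series (total z).
Proof.
apply: functional_extensionality_dep => n; rewrite /series.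
have [[i e]|h] := pselect (exists i : nat, d + i.*2%:Z = n%:Z); last first.
  rewrite total_supported => [|i e]; last by apply: h; exists i.
  rewrite big1 // => -[m /= _] _; have [h'|h'] := ltnP n m.*2; first exact: X_low.
  rewrite -(subnKC h') X_val total_supported ?(lin0 (@hF _ _)) // => i e.
  by apply: h; exists (i + m)%N; lia.
rewrite (totalE _ e) /cneg_map (lin_sum (@hcomp_linear _ _ _ _ _)).
have hlow m : (n < m.*2)%N -> X m (total z) n = 0 by exact: X_low.
have hhigh m : (i < m)%N -> X m (total z) n = 0.
  move=> hm; have [h'|h'] := ltnP n m.*2; first exact: X_low.
  rewrite -(subnKC h') X_val total_supported ?(lin0 (@hF _ _)) // => i' e'; lia.
transitivity (\sum_(m < i.+1) X m (total z) n).
  apply: eq_bigr => -[m /= hm] _; have [h'|h'] := ltnP n m.*2.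
    by rewrite hlow // zmap_neg ?hcomp0 //; lia.
  have e1 : d + (i - m).*2%:Z = (n - m.*2)%N%:Z by lia.
  have := zmapE (@F m) (z (i - m)%N) e1 (f := d + i.*2%:Z).
  rewrite -(totalE _ e1) -X_val subnKC // => -> //.
have [h|h] := leqP i n.
  exact/esym/(@sum_trunc _ (fun m => X m (total z) n) i.+1 n.+1).
by apply: (@sum_trunc _ (fun m => X m (total z) n) n.+1 i.+1) => [|m hm];
  [exact: leqW|apply: X_low; lia].
Qed.
End Maps.
End Cneg.

(** * The theorem *)

Section Main.
Context {k : comPzRingType}.
Context (phi : forall (P Q : cyclicModule k) (n : nat),
     normalized (cprod P Q) n -> normalized (cprod P Q) n.+1).
Hypothesis hphi : special_homotopy phi.
Context (P Q : cyclicModule k).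
Local Notation C := (normalized (cprod P Q)).
Local Notation A := (tensMixed (normalized P) (normalized Q)).
Local Notation TC := (dprodm (mcar C)).
Local Notation TA := (dprodm (mcar A)).

Let phin n : C n -> C n.+1 := @phi P Q n.
Let lphi n : linear (@phin n). Proof. exact: (@special_linear _ _ hphi P Q). Qed.
Let lmbC n : linear (@mb k C n). Proof. exact: mb_linear. Qed.
Let lmBC n : linear (@mB k C n). Proof. exact: mB_linear. Qed.
Let lmbA n : linear (@mb k A n).
Proof.
exact: (@tot_b_linear _ (normalized P) (normalized Q) (@mb_linear _ P) (@mb_linear _ Q)).
Qed.
Let lmBA n : linear (@mB k A n).
Proof.
exact: (@tot_B_linear _ (normalized P) (normalized Q) (@mB_linear _ P) (@mB_linear _ Q)).
Qed.

(** The operators of the theorem on the products of all degrees. *)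
Definition gb : TC -> TC := down (@mb k C).
Definition gB : TC -> TC := up (@mB k C).
Definition gphi : TC -> TC := up phin.
Definition gbA : TA -> TA := down (@mb k A).
Definition gBA : TA -> TA := up (@mB k A).
Definition gsh : TA -> TC := level (@nsh k P Q).
Definition gaw : TC -> TA := level (@nAW k P Q).

Let lb : linear gb. Proof. exact: down_linear. Qed.
Let lB : linear gB. Proof. exact: up_linear. Qed.
Let lP : linear gphi. Proof. exact: up_linear. Qed.
Let lbA : linear gbA. Proof. exact: down_linear. Qed.
Let lBA : linear gBA. Proof. exact: up_linear. Qed.
Let lsh : linear gsh. Proof. exact/level_linear/nsh_linear. Qed.
Let law : linear gaw. Proof. exact/level_linear/nAW_linear. Qed.

Let bB x : gb (gB x) = - gB (gb x).
Proof.
apply: functional_extensionality_dep => -[|j]; last exact: mb_mB.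
exact: (etrans (mb_mB0 (x 0%N)) (esym (oppr0 (C 0)))).
Qed.
Let BB x : gB (gB x) = 0.
Proof.
apply: functional_extensionality_dep => -[|[|j]]; [by []|exact: (lin0 (@lmBC 0))|].
exact: mB_mB.
Qed.
Let sh_aw x : gsh (gaw x) = x + gb (gphi x) + gphi (gb x).
Proof.
apply: functional_extensionality_dep => j; rewrite /gsh /gaw /level.
rewrite (special_sh_AW hphi); congr (_ + _).
case: j => [|j]; last exact: (hcomp_id (M := C)).
transitivity (hcomp C 0%N (phin (0 : C 0%N))); first by [].
by rewrite (lin0 (@lphi 0)); exact: (hcomp0 C).
Qed.
Let phi_sh z : gphi (gsh z) = 0.
Proof.
apply: functional_extensionality_dep => -[|j] //; exact: (special_phi_sh hphi).
Qed.
Let aw_phi x : gaw (gphi x) = 0.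
Proof.
apply: functional_extensionality_dep => -[|j]; last exact: (special_AW_phi hphi).
exact: (lin0 (@nAW_linear _ P Q 0)).
Qed.
Let phi_phi x : gphi (gphi x) = 0.
Proof.
apply: functional_extensionality_dep => -[|[|j]] //.
  exact: (lin0 (@lphi 0)).
exact: (special_phi_phi hphi).
Qed.
Let aw_sh z : gaw (gsh z) = z.
Proof. by apply: functional_extensionality_dep => j; exact: nAW_nsh. Qed.
Let aw_b x : gaw (gb x) = gbA (gaw x).
Proof. by apply: functional_extensionality_dep => j; exact/esym/nAW_mb. Qed.
Let bb x : gb (gb x) = 0.
Proof. by apply: functional_extensionality_dep => j; exact: mb_mb. Qed.

(** [sh AW = 1 + b phi + phi b] commutes with [b] because [b b = 0]; insert
    [AW sh = 1]. *)
Let b_sh z : gb (gsh z) = gsh (gbA z).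
Proof.
have e x : gb (gsh (gaw x)) = gsh (gaw (gb x)).
  by rewrite !sh_aw !(linD lb) !bb (lin0 lP) !addr0.
by rewrite -[in LHS](aw_sh z) e aw_b aw_sh.
Qed.
Let aw_B_sh z : gaw (gB (gsh z)) = gBA z.
Proof.
apply: functional_extensionality_dep => -[|j]; last exact: nAW_mB_nsh.
exact: (lin0 (@nAW_linear _ P Q 0)).
Qed.

Lemma iter_phiB_low m (v : TC) j : (j < m.*2)%N -> iter m (fun x => gphi (gB x)) v j = 0.
Proof.
elim: m j => [//|m ih] [|[|j]] h; [by []|exact: (lin0 (@lphi 0))|].
transitivity (phin (mB (iter m (fun x => gphi (gB x)) v j))); first by [].
by rewrite ih // (lin0 (@lmBC j)) (lin0 (@lphi j.+1)).
Qed.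
Lemma iter_phiB_val m (v : TC) n :
  iter m (fun x => gphi (gB x)) v (m.*2 + n)%N = phiB_pow phin m (v n).
Proof. by elim: m => [//|m ih]; rewrite iterS /= -ih. Qed.
Lemma iter_Bphi_low m (v : TC) j : (j < m.*2)%N -> iter m (fun x => gB (gphi x)) v j = 0.
Proof.
elim: m j => [//|m ih] [|[|j]] h; [by []|exact: (lin0 (@lmBC 0))|].
transitivity (mB (phin (iter m (fun x => gB (gphi x)) v j)) : C j.+2); first by [].
by rewrite ih // (lin0 (@lphi j)) (lin0 (@lmBC j.+1)).
Qed.
Lemma iter_Bphi_val m (v : TC) n :
  iter m (fun x => gB (gphi x)) v (m.*2 + n)%N = Bphi_pow phin m (v n).
Proof. by elim: m => [//|m ih]; rewrite iterS /= -ih. Qed.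

Lemma iter_phiB_delta m n (x : C n) :
  iter m (fun x => gphi (gB x)) (delta x) = delta (phiB_pow phin m x).
Proof. by elim: m => [//|m ih]; rewrite iterS ih /gB /gphi !up_delta. Qed.
Lemma iter_Bphi_delta m n (x : C n) :
  iter m (fun x => gB (gphi x)) (delta x) = delta (Bphi_pow phin m x).
Proof. by elim: m => [//|m ih]; rewrite iterS ih /gB /gphi !up_delta. Qed.

Local Notation gsh_comp := (sh_comp (B := gB) (phi := gphi) (sh := gsh)).
Local Notation gaw_comp := (aw_comp (B := gB) (phi := gphi) (aw := gaw)).

Let aw_B_phiB_sh m z : gaw (gB (gsh_comp m.+1 z)) = 0.
Proof.
apply: functional_extensionality_dep => -[|j].
  exact: (lin0 (@nAW_linear _ P Q 0)).
transitivity (nAW (mB (gsh_comp m.+1 z j) : C j.+1)); first by [].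
rewrite /sh_comp; have [h|h] := ltnP j m.+1.*2.
  by rewrite iter_phiB_low // (lin0 (@lmBC j)) (lin0 (@nAW_linear _ P Q _)).
have -> : j = (m.+1.*2 + (j - m.+1.*2))%N by rewrite subnKC.
by rewrite iter_phiB_val; exact: (nAW_mB_phiB_nsh hphi).
Qed.

Lemma sh_infE m n (z : A n) : sh_inf phin m z = phiB_pow phin m (nsh z).
Proof.
case: m => [//|m]; apply: delta_inj.
rewrite /sh_inf delta_hcomp; last by rewrite doubleS !addSn !addnS.
by rewrite /phi_inf -!iter_phiB_delta iterSr /gphi /gB !up_delta.
Qed.

Lemma AW_infE m n (w : C n) : AW_inf phin m w = nAW (Bphi_pow phin m w).
Proof.
case: m => [//|m]; rewrite /AW_inf; congr nAW; apply: delta_inj.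
rewrite delta_hcomp; last by rewrite doubleS !addSn !addnS.
rewrite /phi_inf -iter_Bphi_delta -(up_delta _ (F := @mB k C)) //.
rewrite -iter_phiB_delta -(up_delta _ (F := phin)) // -/gB -/gphi.
by rewrite -(iter_B_phi (B := gB) (phi := gphi)) -iterSr.
Qed.

Lemma gsh_comp_delta m n (z : A n) : gsh_comp m (delta z) = delta (sh_inf phin m z).
Proof.
by rewrite /sh_comp sh_infE -iter_phiB_delta /gsh level_delta //; exact: nsh_linear.
Qed.
Lemma gaw_comp_delta m n (w : C n) : gaw_comp m (delta w) = delta (AW_inf phin m w).
Proof.
by rewrite /aw_comp AW_infE iter_Bphi_delta /gaw level_delta //; exact: nAW_linear.
Qed.

Lemma sh_comp_val m (u : TA) n : gsh_comp m u (m.*2 + n)%N = sh_inf phin m (u n).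
Proof. by rewrite /sh_comp iter_phiB_val sh_infE. Qed.
Lemma sh_comp_low m (u : TA) j : (j < m.*2)%N -> gsh_comp m u j = 0.
Proof. exact: iter_phiB_low. Qed.
Lemma aw_comp_val m (u : TC) n : gaw_comp m u (m.*2 + n)%N = AW_inf phin m (u n).
Proof. by rewrite /aw_comp /gaw /level iter_Bphi_val AW_infE. Qed.
Lemma aw_comp_low m (u : TC) j : (j < m.*2)%N -> gaw_comp m u j = 0.
Proof.
move=> h; rewrite /aw_comp /gaw /level iter_Bphi_low //.
exact: (lin0 (@nAW_linear _ P Q _)).
Qed.

Lemma sh_inf_linear m n : linear (@sh_inf k P Q phin m n).
Proof.
move=> a x y; rewrite !sh_infE (@nsh_linear _ P Q n).
exact: (@phiB_pow_linear _ _ hphi P Q m n).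
Qed.
Lemma AW_inf_linear m n : linear (@AW_inf k P Q phin m n).
Proof.
have h : linear (fun x : C n => Bphi_pow phin m x).
  elim: m => [|m ih] /=; first exact: lin_id.
  apply: lin_comp (@lmBC _) _.
  exact: lin_comp (@lphi _) ih.
by move=> a x y; rewrite !AW_infE h (@nAW_linear _ P Q _).
Qed.

Lemma sh_coextension : coextension (@nsh k P Q) (@sh_inf k P Q phin).
Proof.
split=> //.
- exact: sh_inf_linear.
- move=> n x; have := congr1 (fun u : TC => u n) (b_sh (delta x)).
  rewrite /gsh level_delta ?/gbA ?bdry_delta ?level_delta; try exact: nsh_linear; try exact: lmbA.
  rewrite /gb bdry_delta // !delta_id /= => ->.
  by rewrite subrr.
move=> m n x.
have := congr1 (fun u : TC => u (m.*2 + n).+1)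
  (sh_comp_coextension lB lP lsh bB BB sh_aw b_sh aw_B_sh aw_B_phiB_sh m (delta x)).
rewrite /gbA bdry_delta // /gBA up_delta // !gsh_comp_delta.
rewrite /gb bdry_delta // /gB up_delta // => e.
apply: etrans e; congr (_ - _ + (_ - _)).
  exact/esym/(delta_id (mb (sh_inf phin m.+1 x : C (m.*2 + n).+2))).
exact/esym/(delta_id (mB (sh_inf phin m x))).
Qed.

Lemma AW_coextension : coextension (@nAW k P Q) (@AW_inf k P Q phin).
Proof.
split=> //.
- exact: AW_inf_linear.
- by move=> n x; apply/eqP; rewrite subr_eq0; apply/eqP; exact: nAW_mb.
move=> m n x.
have := congr1 (fun u : TA => u (m.*2 + n).+1)
  (aw_comp_coextension lB lP law bB BB sh_aw aw_b aw_B_sh aw_B_phiB_sh m (delta x)).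
rewrite /gb bdry_delta // /gB up_delta // !gaw_comp_delta.
rewrite /gbA bdry_delta // /gBA up_delta // => e.
apply: etrans e; congr (_ - _ + (_ - _)).
  exact/esym/(delta_id (mb (AW_inf phin m.+1 x : A (m.*2 + n).+2))).
exact/esym/(delta_id (mB (AW_inf phin m x))).
Qed.

(** The component [(phi B)^m phi] of the series [Phi]. *)
Definition gPhi_comp m (u : TC) : TC := iter m (fun x => gphi (gB x)) (gphi u).
Arguments gPhi_comp : simpl never.
Definition gPhi : TC -> TC := series gPhi_comp.

Lemma gPhi_comp_low m u j : (j <= m)%N -> gPhi_comp m u j = 0.
Proof.
case: m => [|m] h; first by move: h; rewrite leqn0 => /eqP ->.
by apply: iter_phiB_low; rewrite -addnn; lia.
Qed.

Lemma gPhi_comp_linear m : linear (gPhi_comp m).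
Proof. exact: lin_comp (iter_linear m (lin_comp lP lB)) lP. Qed.

Let lPhi : linear gPhi.
Proof.
move=> a x y; apply: functional_extensionality_dep => j.
transitivity (a *: gPhi x j + gPhi y j); last by [].
rewrite /gPhi /series scaler_sumr -big_split; apply: eq_bigr => m _.
by rewrite gPhi_comp_linear.
Qed.

Lemma gPhi_recl u j : gPhi u j = gphi u j + \sum_(m < j) gPhi_comp m.+1 u j.
Proof. by rewrite /gPhi /series big_ord_recl. Qed.
Lemma gPhi_recr u j : gPhi u j = \sum_(m < j) gPhi_comp m u j.
Proof. by rewrite /gPhi /series big_ord_recr /= gPhi_comp_low // addr0. Qed.

Let Phi_l x : gPhi x = gphi x + gphi (gB (gPhi x)).
Proof.
apply: functional_extensionality_dep => j; rewrite gPhi_recl; congr (_ + _).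
case: j => [|[|j]]; first by rewrite big_ord0.
  by rewrite big_ord1 gPhi_comp_low //; exact/esym/(lin0 (@lphi 0)).
rewrite big_ord_recr /= gPhi_comp_low // addr0.
transitivity (phin (mB (gPhi x j))); last by [].
rewrite /gPhi /series (lin_sum (@lmBC j)) (lin_sum (@lphi j.+1)).
by apply: eq_bigr.
Qed.

Let Phi_r x : gPhi x = gphi x + gPhi (gB (gphi x)).
Proof.
apply: functional_extensionality_dep => j; rewrite gPhi_recl; congr (_ + _).
by rewrite gPhi_recr; apply: eq_bigr => m _; rewrite /gPhi_comp -iterSr.
Qed.

Local Notation gsh_tot := (sh_tot (B := gB) (sh := gsh) (Phi := gPhi)).
Local Notation gaw_tot := (aw_tot (B := gB) (aw := gaw) (Phi := gPhi)).

Lemma series_sh z : series (fun m => gsh_comp m) z = gsh_tot z.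
Proof.
apply: functional_extensionality_dep => j; rewrite /series big_ord_recl.
congr (_ + _); rewrite gPhi_recr; apply: eq_bigr => m _.
by rewrite /sh_comp /gPhi_comp -iterSr.
Qed.

Arguments gaw : clear implicits.
Lemma gaw_gB_gPhi x j : gaw (gB (gPhi x)) j = \sum_(m < j) gaw (gB (gPhi_comp m x)) j.
Proof.
case: j => [|j]; first by rewrite big_ord0; exact: (lin0 (@nAW_linear _ P Q 0)).
transitivity (nAW (mB (gPhi x j) : C j.+1)); first by [].
rewrite /gPhi /series (lin_sum (@lmBC j)) (lin_sum (@nAW_linear _ P Q j.+1)).
by apply: eq_bigr.
Qed.

Lemma series_aw x : series (fun m => gaw_comp m) x = gaw_tot x.
Proof.
apply: functional_extensionality_dep => j; rewrite /series big_ord_recl.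
congr (_ + _); rewrite gaw_gB_gPhi; apply: eq_bigr => m _.
by rewrite /aw_comp iterSr iter_B_phi.
Qed.

Let aw_B_Phi_B_sh z : gaw (gB (gPhi (gB (gsh z)))) = 0.
Proof.
apply: functional_extensionality_dep => j; rewrite gaw_gB_gPhi big1 // => m _.
have := congr1 (fun u : TA => u j) (aw_B_phiB_sh m z).
by rewrite /sh_comp iterSr.
Qed.

Lemma total_sh d (z : cneg A d) :
  total (cneg_map (@sh_inf k P Q phin) z) = gsh_tot (total z).
Proof.
rewrite (total_cneg_map (X := fun m => gsh_comp m) sh_inf_linear) ?series_sh //.
- by move=> m u n; exact: sh_comp_val.
- by move=> m u j; exact: sh_comp_low.
Qed.

Lemma total_aw d (z : cneg C d) :
  total (cneg_map (@AW_inf k P Q phin) z) = gaw_tot (total z).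
Proof.
rewrite (total_cneg_map (X := fun m => gaw_comp m) AW_inf_linear) ?series_aw //.
- by move=> m u n; exact: aw_comp_val.
- by move=> m u j; exact: aw_comp_low.
Qed.

Lemma sh_chain_map : chain_map (cneg_map (@sh_inf k P Q phin)).
Proof.
split=> [d|d z]; first exact: cneg_map_linear sh_inf_linear _.
apply: total_inj; rewrite total_sh !total_cneg_d // total_sh.
exact/esym/(sh_tot_chain lb lB lP lsh law bB BB sh_aw b_sh aw_B_sh lPhi Phi_l Phi_r aw_B_Phi_B_sh).
Qed.

Lemma aw_chain_map : chain_map (cneg_map (@AW_inf k P Q phin)).
Proof.
split=> [d|d z]; first exact: cneg_map_linear AW_inf_linear _.
apply: total_inj; rewrite total_aw !total_cneg_d // total_aw.
exact: (aw_tot_chain lb lB lP lbA law bB BB sh_aw aw_b aw_B_sh lPhi Phi_l Phi_r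
  aw_B_Phi_B_sh).
Qed.

Lemma gPhi_comp_supported m d u : supported d u -> supported (d + 1) (gPhi_comp m u).
Proof.
move=> h; elim: m => [|m ih]; first exact: supported_up.
by apply: supported2; do 2! apply: supported_up => //.
Qed.

Lemma gPhi_supported d u : supported d u -> supported (d + 1) (gPhi u).
Proof. by move=> h n hn; apply: big1 => m _; exact: gPhi_comp_supported h _ hn. Qed.

Lemma sh_aw_inverse : inverse_up_to_homotopy (cneg_map (@sh_inf k P Q phin))
       (cneg_map (@AW_inf k P Q phin)).
Proof.
split.
  exists (fun d _ => 0); split=> [d a x y|d z]; first by rewrite scaler0 addr0.
  apply: total_inj; rewrite addr0 (linB (@total_linear _ _ _)).
  rewrite total_aw total_sh total_cneg_d //.
  rewrite (aw_tot_sh_tot lB lP law phi_sh aw_phi phi_phi aw_sh lPhi Phi_l Phi_r) subrr (lin0 (@total_linear _ _ _)).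
  by rewrite (lin0 (down_linear lmbA)) (lin0 (up_linear lmBA)) addr0.
exists (fun d z => untotal (d + 1) (gPhi (total z))); split=> [d|d z].
  apply: lin_comp (@untotal_linear _ _ _) _.
  exact: lin_comp lPhi (@total_linear _ _ _).
apply: total_inj; rewrite (linB (@total_linear _ _ _)) [RHS](linD (@total_linear _ _ _)).
rewrite total_sh total_aw total_cneg_d // !untotalK;
  try exact: gPhi_supported (total_supported _).
rewrite total_cneg_d // (sh_tot_aw_tot lb lB lP law bB BB sh_aw lPhi Phi_l Phi_r).
by rewrite -[X in X - _]addrA addrAC subrr add0r.
Qed.
End Main.

Theorem mainTheorem1 (k : comPzRingType)
    (phi : forall (P Q : cyclicModule k) (n : nat),
       normalized (cprod P Q) n -> normalized (cprod P Q) n.+1)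
    (hphi : special_homotopy phi) (P Q : cyclicModule k) :
  (forall m n (z : tensMixed (normalized P) (normalized Q) n),
     sh_inf (phi P Q) m z = phiB_pow (phi P Q) m (nsh z))
  /\ (forall m n (w : normalized (cprod P Q) n),
     AW_inf (phi P Q) m w = nAW (Bphi_pow (phi P Q) m w))
  /\ coextension (@nsh k P Q) (@sh_inf k P Q (phi P Q))
  /\ coextension (@nAW k P Q) (@AW_inf k P Q (phi P Q))
  /\ chain_map (cneg_map (@sh_inf k P Q (phi P Q)))
  /\ chain_map (cneg_map (@AW_inf k P Q (phi P Q)))
  /\ inverse_up_to_homotopy (cneg_map (@sh_inf k P Q (phi P Q)))
       (cneg_map (@AW_inf k P Q (phi P Q))).
Proof.
split; first by move=> m n z; exact: sh_infE.
split; first by move=> m n w; exact: AW_infE.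
split; first exact: sh_coextension.
split; first exact: AW_coextension.
split; first exact: sh_chain_map.
split; first exact: aw_chain_map.
exact: sh_aw_inverse.
Qed.
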